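(* Under the model, standing assumptions, Assumptions 1–5 and notation of the context, let $\widehat\beta^{(0)}$ be an initial estimator with $\|\widehat\beta^{(0)}-\beta^*\|_2=O_{\mathbb P}(\delta_{m,0})$, and let the bandwidth $h_1>0$ satisfy $h_1=o(1)$ and $\frac{p\log n}{nh_1^3}=o(1)$. Let $$\widehat\beta^{(1)}=\widehat\beta^{(0)}-\big[\nabla^2F_{h_1}(\widehat\beta^{(0)})\big]^{-1}\nabla F_{h_1}(\widehat\beta^{(0)}).$$ Then $$\|\widehat\beta^{(1)}-\beta^*\|_2=O_{\mathbb P}\left(\delta_{m,0}^2+h_1^\alpha+\sqrt{\frac{p}{nh_1}}+\delta_{m,0}\sqrt{\frac{p\log n}{nh_1^3}}\right).$$
   Context: Model. $Y=\mathrm{sign}(X+Z^\top\beta^*+\epsilon)\in\{-1,+1\}$ with $\beta^*\in\mathbb R^p$, $X,\epsilon$ real random variables and $Z$ an $\mathbb R^p$-valued random vector. One observes $(y_i,x_i,z_i)$, $i=1,\dots,n$, coming from i.i.d. copies of $(Y,X,Z,\epsilon)$ (split over $L$ machines with $m=n/L$ observations each). The initial estimator $\widehat\beta^{(0)}$ may depend on the data. Standing (identifiability) assumptions: (a) $\mathrm{median}(\epsilon\mid X,Z)=0$; (b) the support of $(X,Z)$ is not contained in any proper linear subspace of $\mathbb R^{p+1}$; (c) $0<P(Y=-1\mid X,Z)<1$ for almost every $(X,Z)$; (d) the conditional distribution of $X$ given $Z$ has an a.e. positive density. Assumption 1 (kernel). $\alpha\ge2$ is an integer, $H:\mathbb R\to\mathbb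 R$, $H(x)=1$ for $x>1$, $H(x)=0$ for $x<-1$; $\pi_U:=\int_{-1}^1x^\alpha H'(x)\,dx\neq0$, $\int_{-1}^1x^kH'(x)\,dx=0$ for $k=1,\dots,\alpha-1$; $\pi_V:=\int_{-1}^1[H'(x)]^2dx<\infty$; $H''$ is bounded and Lipschitz continuous. Assumption 2. The conditional density $\rho(\cdot\mid Z)$ of $\zeta:=X+Z^\top\beta^*$ given $Z$ is positive and bounded uniformly for almost every $Z$; for $1\le k\le\alpha$ its $k$th derivative exists and is bounded for almost every $Z$. Assumption 3. $\epsilon$ and $X$ are independent given $Z$; the conditional c.d.f. $F(\cdot\mid Z)$ of $\epsilon$ given $Z$ has, for $1\le k\le\alpha+1$, a $k$th derivative bounded uniformly for almost every $Z$. Assumption 4. With $V:=2\,\mathbb E[\rho(0\mid Z)F'(0\mid Z)ZZ^\top]$ and $V_s:=\pi_V\,\mathbb E[\rho(0\mid Z)ZZ^\top]$, there is a constant $c_1>1$ such that all eigenvalues of $V$ and of $V_s$ lie in $(c_1^{-1},c_1)$. Assumption 5. There is $\eta>0$ with $\sup_{\|v\|_2=1}\mathbb E\,e^{\eta(v^\top Z)^2}<\infty$. Notation. $F_h(\beta)=\frac1n\sum_{i=1}^n(-y_i)H\big(\frac{x_i+z_i^\top\beta}{h}\big)$, so $\nabla F_h(\beta)=\frac1{nh}\sum_i(-y_i)H'\big(\frac{x_i+z_i^\top\beta}{h}\big)z_i$ and $\nabla^2F_h(\beta)=\frac1{nh^2}\sum_i(-y_i)H''\big(\frac{x_i+z_i^\top\beta}{h}\big)z_iz_i^\top$.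 Asymptotics. $n\to\infty$; $p,m,L,h_1,\delta_{m,0}$ may depend on $n$.
   Formalization: The rate of the initial estimator is additionally assumed to vanish, δ_{m,0} = o(1) (and δ_{m,0} ≥ 0); for δ_{m,0} of constant order the claim fails, since the Hessian at the initial estimator may then tend to a singular limit. *)

(* Defs.v *)
From HB Require Import structures.
From mathcomp Require Import all_boot all_order all_algebra.
From mathcomp Require Import all_classical all_reals all_analysis measurable_realfun.

Set Implicit Arguments.
Unset Strict Implicit.
Unset Printing Implicit Defensive.

Import Order.TTheory GRing.Theory Num.Theory.
Import numFieldNormedType.Exports.
Local Open Scope classical_set_scope.
Local Open Scope ring_scope.

Definition dotv (R : realType) (p : nat) (u v : 'cV[R]_p) : R :=
  \sum_(i < p) u i 0 * v i 0.

(* The library norm on matrices is the sup norm. *)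
Definition norm2 (R : realType) (p : nat) (u : 'cV[R]_p) : R :=
  Num.sqrt (dotv u u).

(* Random vectors take values in [p.-tuple R], which carries the product
   sigma-algebra; [colv] moves them to the type used for linear algebra. *)
Definition colv (R : realType) (p : nat) (z : p.-tuple R) : 'cV[R]_p :=
  \col_i tnth z i.

(* [U_ n = O_P(a_ n)], each [U_ n] living on its own probability space.  The
   event is asked to lie in a measurable event of small probability, so that
   the definition does not depend on the values of [P_ n] at non-measurable
   sets; for measurable [U_ n] this is the usual definition. *)
Definition bigO_P (R : realType) (d : nat -> measure_display)
    (T : forall n, measurableType (d n)) (P : forall n, probability (T n) R)
    (U : forall n, T n -> R) (a : nat -> R) : Prop :=
  forall e : R, 0 < e -> exists M : R, 0 < M /\
    \forall n \near \oo, exists B : set (T n),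
      [/\ measurable B, [set w | M * a n < U n w] `<=` B
        & (P n B <= e%:E)%E].

Section conditioning.
Context (R : realType) (d dE dG : measure_display) (T : measurableType d)
  (E : measurableType dE) (G : measurableType dG) (P : probability T R).

(* [f] is a version of [v |-> P(A | V = v)] *)
Definition cond_prob (V : T -> E) (A : set T) (f : E -> \bar R) : Prop :=
  [/\ measurable_fun setT f, (forall v, (0 <= f v)%E) &
    forall B, measurable B ->
      P (A `&` V @^-1` B) = (\int[P]_(w in V @^-1` B) f (V w))%E].

(* [k] is a regular conditional distribution of [U] given [V] *)
Definition cond_dist (V : T -> E) (U : T -> G) (k : R.-pker E ~> G) : Prop :=
  forall A, measurable A -> cond_prob V (U @^-1` A) (fun v => k v A).

(* [f v] is the conditional density of [U] given [V = v] *)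
Definition cond_density (V : T -> E) (U : T -> R) (f : E -> R -> R) : Prop :=
  [/\ measurable_fun setT (fun q : E * R => f q.1 q.2),
      (forall v t, 0 <= f v t) &
    forall A : set R, measurable A ->
      cond_prob V (U @^-1` A)
        (fun v => (\int[lebesgue_measure]_(t in A) (f v t)%:E)%E)].

(* [U1] and [U2] are independent given [V] *)
Definition cond_indep (V : T -> E) (U1 U2 : T -> G) : Prop :=
  forall (A B : set G) (f g : E -> \bar R), measurable A -> measurable B ->
    cond_prob V (U1 @^-1` A) f -> cond_prob V (U2 @^-1` B) g ->
    cond_prob V (U1 @^-1` A `&` U2 @^-1` B) (fun v => (f v * g v)%E).

(* [F(t | v)] for the conditional distribution [k] of a real variable *)
Definition cond_cdf (k : R.-pker E ~> R) (v : E) (t : R) : R :=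
  fine (k v `]-oo, t]%classic).

(* topological support of the law of [W] *)
Definition support_law (p : nat) (W : T -> 'cV[R]_p) : set 'cV[R]_p :=
  [set x | forall U : set 'cV[R]_p, open U -> U x -> (0 < P (W @^-1` U))%E].

End conditioning.

(* [f^`(j)] exists everywhere and is bounded by [C] for 1 <= j <= k *)
Definition bounded_derivs (R : realType) (k : nat) (C : R) (f : R -> R) : Prop :=
  forall j, (j < k)%N -> forall t : R,
    derivable f^`(j)%classic t 1 /\ `|f^`(j.+1)%classic t| <= C.

Record observation (R : realType) (d : measure_display) (T : measurableType d)
    (p : nat) := Observation {
  obsX : {mfun T >-> R} ;
  obsZ : {mfun T >-> p.-tuple R} ;
  obsE : {mfun T >-> R} }.

Section model.
Context (R : realType) (d : measure_display) (T : measurableType d)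
  (P : probability T R) (p : nat) (beta : 'cV[R]_p).
Implicit Types (o : observation R T p) (rho : p.-tuple R -> R -> R)
  (k : R.-pker (p.-tuple R) ~> R).

Definition zvec o (w : T) : 'cV[R]_p := colv (obsZ o w).

Definition obs_triple o (w : T) : R * p.-tuple R * R :=
  (obsX o w, obsZ o w, obsE o w).

Definition covariates o (w : T) : R * p.-tuple R := (obsX o w, obsZ o w).

Definition zeta o (w : T) : R := obsX o w + dotv (zvec o w) beta.

(* sign with values in {-1, +1}; the value 0 has probability 0 in the model *)
Definition response o (w : T) : R :=
  if 0 <= zeta o w + obsE o w then 1 else -1.

Definition iid_copies (n : nat) o (s : 'I_n -> observation R T p) : Prop :=
  (forall i B, measurable B ->
     P (obs_triple (s i) @^-1` B) = P (obs_triple o @^-1` B)) /\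
  (forall B : 'I_n -> set (R * p.-tuple R * R), (forall i, measurable (B i)) ->
     P (\bigcap_(i in [set: 'I_n]) (obs_triple (s i) @^-1` B i)) =
     (\prod_(i < n) P (obs_triple (s i) @^-1` B i))%E).

Definition median_zero o : Prop :=
  exists k : R.-pker (R * p.-tuple R)%type ~> R,
    cond_dist P (covariates o) (obsE o) k /\
    {ae P, forall w,
      (2^-1%:E <= k (covariates o w) `]-oo, 0%R]%classic)%E /\
      (2^-1%:E <= k (covariates o w) `[0%R, +oo[%classic)%E}.

Definition full_support o : Prop :=
  forall U : {vspace 'cV[R]_(1 + p)},
    (forall x, support_law P
       (fun w => col_mx (const_mx (obsX o w) : 'cV[R]_1) (zvec o w)) x ->
       x \in U) ->
    U = fullv.

Definition nondegenerate_response o : Prop :=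
  exists f, cond_prob P (covariates o) [set w | response o w = -1] f /\
    {ae P, forall w, (0 < f (covariates o w) < 1)%E}.

Definition positive_density_X o : Prop :=
  exists f, cond_density P (obsZ o) (obsX o) f /\
    {ae P, forall w, {ae lebesgue_measure, forall t, 0 < f (obsZ o w) t}}.

Definition identifiable o : Prop :=
  [/\ median_zero o, full_support o, nondegenerate_response o
    & positive_density_X o].

Definition Vmx o rho k : 'M[R]_p :=
  \matrix_(i, j) (2 * \int[P]_w
    (rho (obsZ o w) 0 * (cond_cdf k (obsZ o w))^`()%classic 0 *
     (zvec o w i 0 * zvec o w j 0))).

Definition Vsmx (piV : R) o rho : 'M[R]_p :=
  \matrix_(i, j) (piV * \int[P]_w
    (rho (obsZ o w) 0 * (zvec o w i 0 * zvec o w j 0))).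

End model.

Definition kernel_moment (R : realType) (H : R -> R) (k : nat) : R :=
  \int[lebesgue_measure]_(x in `[(-1)%R, 1%R]%classic)
    (x ^+ k * H^`()%classic x).

Definition pi_V (R : realType) (H : R -> R) : R :=
  \int[lebesgue_measure]_(x in `[(-1)%R, 1%R]%classic)
    (H^`()%classic x ^+ 2).

Definition kernel_cond (R : realType) (alpha : nat) (H : R -> R) : Prop :=
  [/\ (2 <= alpha)%N,
      (forall x, 1 < x -> H x = 1) /\ (forall x, x < -1 -> H x = 0),
      kernel_moment H alpha != 0 /\ (forall k, (0 < k < alpha)%N -> kernel_moment H k = 0),
      (\int[lebesgue_measure]_(x in `[(-1)%R, 1%R]%classic)
         ((H^`()%classic x ^+ 2)%:E) < +oo)%E
    & [/\ (forall x : R, derivable H x 1),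
          (forall x : R, derivable H^`()%classic x 1),
          (exists C : R, forall x, `|H^`(2)%classic x| <= C)
        & exists K : R, forall x y,
            `|H^`(2)%classic x - H^`(2)%classic y| <= K * `|x - y|]].

Section newton.
Context (R : realType) (d : measure_display) (T : measurableType d)
  (n p : nat) (beta : 'cV[R]_p) (s : 'I_n -> observation R T p)
  (H : R -> R) (h : R).
Implicit Types (b : 'cV[R]_p) (w : T).

Definition smoothed_loss w b : R :=
  n%:R^-1 * \sum_(i < n) - response beta (s i) w *
    H ((obsX (s i) w + dotv (zvec (s i) w) b) / h).

(* [grad_loss] and [hess_loss] are the gradient and the Hessian of
   [smoothed_loss w] at [b]. *)
Definition grad_loss w b : 'cV[R]_p :=
  (n%:R * h)^-1 *: \sum_(i < n) (- response beta (s i) w *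
    H^`()%classic ((obsX (s i) w + dotv (zvec (s i) w) b) / h))
    *: zvec (s i) w.

Definition hess_loss w b : 'M[R]_p :=
  (n%:R * h ^+ 2)^-1 *: \sum_(i < n) (- response beta (s i) w *
    H^`(2)%classic ((obsX (s i) w + dotv (zvec (s i) w) b) / h))
    *: (zvec (s i) w *m (zvec (s i) w)^T).

(* [invmx A] is [A] when [A] is singular. *)
Definition newton_step w b : 'cV[R]_p :=
  b - invmx (hess_loss w b) *m grad_loss w b.

End newton.

(* Main.v *)
(* Let u = b - beta, and let G and g be the sample Hessian and gradient.  The
   error x of the Newton step from b solves G x = G u - g(b), so that
   c |x| <= v.(G u - g(b)) with v = x / |x| as soon as v.G v >= c for all unit v.
   Split G u - g(b) = (G u - g(beta + u) + g(beta)) - g(beta).  Conditionally on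
   Z, the variable - Y times the density of zeta is a smooth function vanishing
   at 0 by the median condition; integrating it against H'' and H' shows that
   the mean of v.G v is v.V v up to O(h + |u|), that the first bracket has mean
   O(|u|^2), and, the moments of H' being 0, that g(beta) has mean O(h^alpha).
   The fluctuation of g(beta) is controlled by Chebyshev's inequality.  The
   initial estimator depends on the data, so v.G v and the first bracket divided
   by the radius r of the ball are controlled uniformly in |u| <= r and |v| = 1:
   a Chernoff bound, where the windows |zeta + Z.u| <= h have probability O(h),
   and a union bound over a grid of mesh n^-6, between whose points the sample
   averages vary little since their Lipschitz constant is polynomial in n. *)
Require Import Defs.
From HB Require Import structures.
From mathcomp Require Import all_boot all_order all_algebra.
From mathcomp Require Import all_classical all_reals all_analysis measurable_realfun.
From mathcomp Require Import ring lra zify.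

Set Implicit Arguments.
Unset Strict Implicit.
Unset Printing Implicit Defensive.

Import Order.TTheory GRing.Theory Num.Theory.
Import numFieldNormedType.Exports.
Local Open Scope classical_set_scope.
Local Open Scope ring_scope.

(** * Measure theory and sums of independent variables *)

(** Up to the last section everything is proved at a fixed n with explicit constants:
    [one_step_bound] produces an event that does not mention the starting point, outside of which
    all starting points of a ball obey the bound at once. This is how an estimator computed from the
    same data can be substituted. The summands have size h^-2 on a window of probability O(h), hence
    a second moment of order h^-3; the resulting uniform deviation sqrt(p ln n / (n h^3)) is
    affordable for v.Gv. The bracket is smaller by a factor |u|; dividing it by r removes that
    factor from its size and from its Lipschitz constant, so that one grid argument serves both
    quantities, and multiplying back gives the last term of the rate. The gradient at beta involves
    no u and is linear in v, so coordinatewise variances suffice and no logarithm appears in sqrt(p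
    / (n h)). Conditional statements are handled as identities between finite measures: they are
    checked on rectangles, extended by uniqueness of measures, and only then used on functions. *)

Section density_measure.

Context d (T : measurableType d) (R : realType) (m : {measure set T -> \bar R}).
Variables (Y : T -> R).
Hypotheses (mY : measurable_fun setT Y) (Y0 : forall x, 0 <= Y x).

(** The proofs [mY] and [Y0] are arguments so that the measure structure declared below, which
    depends on them, can be inferred from the term. *)
Definition density_measure (mY : measurable_fun setT Y)
  (Y0 : forall x, 0 <= Y x) (A : set T) := (\int[m]_(x in A) (Y x)%:E)%E.

Local Notation nu := (density_measure mY Y0).

Let nu0 : nu set0 = 0%E.
Proof. by rewrite /density_measure integral_set0. Qed.

Let nu_ge0 A : (0 <= nu A)%E.
Proof. by apply: integral_ge0 => x _; rewrite lee_fin. Qed.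

Let nu_sigma_additive : semi_sigma_additive nu.
Proof.
move=> F mF tF mUF; rewrite /density_measure.
have /= -> := @ge0_integral_bigcup _ _ _ m F (EFin \o Y) mF _ _ tF.
- apply: is_cvg_ereal_nneg_natsum_cond => n _ _.
  by apply: integral_ge0 => x _; rewrite lee_fin.
- by apply: measurable_funTS; exact/measurable_EFinP.
- by move=> x _; rewrite lee_fin.
Qed.

HB.instance Definition _ := isMeasure.Build _ _ _ nu
  nu0 nu_ge0 nu_sigma_additive.

Import HBNNSimple.

(** Both sides are continuous along increasing sequences of simple functions and additive, which
    leaves indicators, where the left side is the definition of the measure. *)
Lemma ge0_integral_density_measure (f : T -> \bar R) :
  measurable_fun setT f -> (forall x, (0 <= f x)%E) ->
  (\int[nu]_x f x = \int[m]_x ((Y x)%:E * f x))%E.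
Proof.
move=> mf f0; pose h := nnsfun_approx measurableT mf.
have mh n : measurable_fun setT (EFin \o h n) by exact/measurable_EFinP.
have hf x : EFin \o h ^~ x @ \oo --> f x by exact: cvg_nnsfun_approx.
have ndh x : {homo (fun n => (h n x)%:E) : a b / (a <= b)%N >-> (a <= b)%E}.
  by move=> a b ab; rewrite lee_fin; exact/lefP/nd_nnsfun_approx.
transitivity (limn (fun n => \int[nu]_x (h n x)%:E)%E).
  rewrite -monotone_convergence//; last by move=> n x _; rewrite lee_fin.
  by apply: eq_integral => x _; apply/esym/cvg_lim => //; exact: hf.
transitivity (limn (fun n => \int[m]_x ((Y x)%:E * (h n x)%:E))%E); last first.
  rewrite -monotone_convergence//.
  - apply: eq_integral => x _; apply/cvg_lim => //.
    by apply: cvgeZl => //; exact: hf.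
  - by move=> n; apply: emeasurable_funM => //; exact/measurable_EFinP.
  - by move=> n x _; rewrite mule_ge0 ?lee_fin.
  - by move=> x _ a b ab; apply: lee_wpmul2l; [rewrite lee_fin|exact: ndh].
congr (limn _); apply/funext => n.
transitivity (\int[nu]_x
   (\sum_(y \in range (h n)) (y * \1_(h n @^-1` [set y]) x)%:E))%E.
  by apply: eq_integral => t tE; rewrite /= fimfunE -fsumEFin.
have indich r : measurable_fun setT
    (fun x => (r * \1_(h n @^-1` [set r]) x)%:E).
  by apply: measurableT_comp => //; exact: measurable_funM.
rewrite ge0_integral_fsum//; last by move=> y x _; exact: nnfun_muleindic_ge0.
transitivity (\int[m]_x (\sum_(y \in range (h n))
    ((Y x)%:E * (y * \1_(h n @^-1` [set y]) x)%:E)))%E; last first.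
  apply: eq_integral => x _; rewrite [in RHS](fimfunE (h n)) -fsumEFin//.
  by rewrite ge0_mule_fsumr// => y; exact: nnfun_muleindic_ge0.
rewrite ge0_integral_fsum//; last 2 first.
  - by move=> y; apply: emeasurable_funM => //; exact/measurable_EFinP.
  - move=> y x _; apply: mule_ge0; first by rewrite lee_fin.
    exact: nnfun_muleindic_ge0.
apply: eq_fsbigr => r /set_mem [x _ <-].
rewrite integralZl_indic_nnsfun// integral_indic// setIT.
under eq_integral do rewrite EFinM muleCA.
rewrite ge0_integralZl ?lee_fin//; last 2 first.
  - by apply: emeasurable_funM => //; exact/measurable_EFinP.
  - by move=> y _; rewrite mule_ge0 ?lee_fin.
congr (_ * _)%E; rewrite /= /density_measure integral_mkcond.
apply: eq_integral => y _; rewrite /patch indicE.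
by case: ifPn => _; rewrite (mule1, mule0).
Qed.

End density_measure.

Section weighted_laws.
Context d1 d2 dG (T1 : measurableType d1) (T2 : measurableType d2)
  (G : measurableType dG) (R : realType) (m1 : {measure set T1 -> \bar R})
  (m2 : {measure set T2 -> \bar R}).
Variables (Y1 : T1 -> R) (Y2 : T2 -> R) (W1 : T1 -> G) (W2 : T2 -> G).
Hypotheses (mY1 : measurable_fun setT Y1) (mY2 : measurable_fun setT Y2).
Hypotheses (Y1_ge0 : forall x, 0 <= Y1 x) (Y2_ge0 : forall x, 0 <= Y2 x).
Hypotheses (mW1 : measurable_fun setT W1) (mW2 : measurable_fun setT W2).

(** The hypothesis says that the measures with densities [Y1] and [Y2] have the same image in [G];
    integrating [f] against this image gives both sides. All conditioning arguments pass from sets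
    to functions through this lemma. *)
Lemma ge0_eq_integral_law :
  (forall B, measurable B -> (\int[m1]_(x in W1 @^-1` B) (Y1 x)%:E =
                              \int[m2]_(x in W2 @^-1` B) (Y2 x)%:E)%E) ->
  forall f : G -> \bar R, measurable_fun setT f -> (forall g, (0 <= f g)%E) ->
  (\int[m1]_x ((Y1 x)%:E * f (W1 x)) = \int[m2]_x ((Y2 x)%:E * f (W2 x)))%E.
Proof.
move=> eqB f mf f0.
have mf1 : measurable_fun setT (f \o W1) by exact: measurableT_comp.
have mf2 : measurable_fun setT (f \o W2) by exact: measurableT_comp.
rewrite -[LHS](ge0_integral_density_measure m1 mY1 Y1_ge0 mf1)//; last first.
  by move=> x; exact: f0.
rewrite -[RHS](ge0_integral_density_measure m2 mY2 Y2_ge0 mf2)//; last first.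
  by move=> x; exact: f0.
transitivity (\int[pushforward (density_measure m1 mY1 Y1_ge0) W1]_x f x)%E.
  by rewrite ge0_integral_pushforward.
transitivity (\int[pushforward (density_measure m2 mY2 Y2_ge0) W2]_x f x)%E.
  by apply: eq_measure_integral => B mB _; exact: eqB.
by rewrite ge0_integral_pushforward.
Qed.

(** Uniqueness of finite measures on a pi-system, for the images of the two weighted measures. Since
    [C] contains [setT], finiteness of one total mass is enough. *)
Lemma eq_weighted_law_pi_system (C : set (set G)) :
  (@measurable _ G = <<s C >>) -> setI_closed C -> C setT ->
  (\int[m1]_x (Y1 x)%:E < +oo)%E ->
  (forall B, C B -> (\int[m1]_(x in W1 @^-1` B) (Y1 x)%:E =
                              \int[m2]_(x in W2 @^-1` B) (Y2 x)%:E)%E) ->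
  forall B, measurable B -> (\int[m1]_(x in W1 @^-1` B) (Y1 x)%:E =
                              \int[m2]_(x in W2 @^-1` B) (Y2 x)%:E)%E.
Proof.
move=> CE CI CT Yoo eqC B mB.
have /= := @measure_unique _ R G C (fun=> setT) CE CI (fun=> CT) _
   (pushforward (density_measure m1 mY1 Y1_ge0) W1)
   (pushforward (density_measure m2 mY2 Y2_ge0) W2) _ _ _ mB.
apply=> //.
by apply/seteqP; split => // x _; exists 0%N.
Qed.

End weighted_laws.

Import HBNNSimple.

(* Neither function is assumed measurable: the integral is then a lower
   integral, which still ignores null sets. *)
Lemma ae_eq_ge0_lower_integral d (T : measurableType d) (R : realType)
    (m : {measure set T -> \bar R}) (f g : T -> \bar R) :
  (forall x, (0 <= f x)%E) -> (forall x, (0 <= g x)%E) ->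
  {ae m, forall x, f x = g x} -> (\int[m]_x f x = \int[m]_x g x)%E.
Proof.
wlog suff le : f g / (forall x, (0 <= f x)%E) -> (forall x, (0 <= g x)%E) ->
    {ae m, forall x, f x = g x} -> (\int[m]_x f x <= \int[m]_x g x)%E.
  move=> f0 g0 fg; apply/eqP; rewrite eq_le !le//.
  by apply: filterS fg => x ->.
move=> f0 g0 [N [mN N0 fgN]].
rewrite !ge0_integralTE//; apply: ge_ereal_sup => _ /= [h hf <-].
have mNC : measurable (~` N) by exact: measurableC.
(* Setting a simple function below [f] to 0 on the null set [N] puts it below [g] and keeps its
   integral. *)
pose k := mul_nnsfun h (indic_nnsfun R mNC).
apply: ereal_sup_ubound; exists k.
  move=> x; rewrite /k /= /mindic indicE; have [xN|xN] := pselect (N x).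
    by rewrite memNset ?mulr0//= => /(_ xN).
  rewrite mem_set// mulr1; apply: (le_trans (hf x)).
  by have -> : f x = g x by apply: contrapT => /fgN.
rewrite -!integralT_nnsfun; apply: ge0_ae_eq_integral => //.
- exact/measurable_EFinP.
- exact/measurable_EFinP.
- by move=> x _; rewrite lee_fin.
- by move=> x _; rewrite lee_fin.
exists N; split=> // x /= hx; apply: contrapT => xN; apply: hx => _.
by rewrite /k /= /mindic indicE mem_set// mulr1.
Qed.

(** * Factorization of integrals under independence *)

Section independence.
Context d dG (T : measurableType d) (G : measurableType dG) (R : realType)
  (P : probability T R) (n : nat) (W : 'I_n -> T -> G).
Hypothesis mW : forall i, measurable_fun setT (W i).
Hypothesis indep : forall B : 'I_n -> set G, (forall i, measurable (B i)) ->
  P (\bigcap_(i in [set: 'I_n]) (W i @^-1` B i)) =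
  (\prod_(i < n) P (W i @^-1` B i))%E.

Lemma measurable_comp_prod (A : pred 'I_n) (f : 'I_n -> G -> R) :
  (forall i, measurable_fun setT (f i)) ->
  measurable_fun setT (fun w => \prod_(i < n | A i) f i (W i w)).
Proof.
move=> mf; rewrite [X in measurable_fun _ X](_ : _ =
  fun w => \prod_(i <- [seq i <- enum 'I_n | A i]) f i (W i w)).
  by apply: measurable_prod => i _; exact: measurableT_comp.
by apply/funext => w; rewrite big_filter big_enum_cond.
Qed.

(** Independence is given on sets, that is for indicators. General factors are let in one index at a
    time: in [main] the factors of index at least [k] are still indicators. *)
Lemma integral_prod_indep (f : 'I_n -> G -> R) :
  (forall i, measurable_fun setT (f i)) -> (forall i x, 0 <= f i x) ->
  (forall i, (\int[P]_w (f i (W i w))%:E < +oo)%E) ->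
  (\int[P]_w (\prod_(i < n) f i (W i w))%:E =
   \prod_(i < n) \int[P]_w (f i (W i w))%:E)%E.
Proof.
suff main k : forall g : 'I_n -> G -> R,
    (forall i, measurable_fun setT (g i)) -> (forall i x, 0 <= g i x) ->
    (forall i, (\int[P]_w (g i (W i w))%:E < +oo)%E) ->
    (forall i : 'I_n, (k <= i)%N -> exists2 B, measurable B & g i = \1_B) ->
    (\int[P]_w (\prod_(i < n) g i (W i w))%:E =
     \prod_(i < n) \int[P]_w (g i (W i w))%:E)%E.
  move=> mf f0 fy; apply: (main n) => // i.
  by rewrite leqNgt ltn_ord.
elim: k => [|k IH] g mg g0 gy gB.
  have /choice[B HB] : forall i, exists B, measurable B /\ g i = \1_B.
    by move=> i; have [B ? ?] := gB i isT; exists B.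
  have mWB i : measurable (W i @^-1` B i).
    by rewrite -[X in measurable X]setTI; apply: mW => //; case: (HB i).
  have gE i w : g i (W i w) = \1_(W i @^-1` B i) w.
    by case: (HB i) => _ ->; rewrite !indicE.
  transitivity (P (\bigcap_(i in [set: 'I_n]) (W i @^-1` B i))); last first.
    rewrite indep; last by move=> i; case: (HB i).
    apply: eq_bigr => i _; under eq_integral do rewrite gE.
    by rewrite integral_indic// setIT.
  rewrite -[X in P X]setIT -integral_indic//; last first.
    by apply: fin_bigcap_measurable => //; exact: finite_finset.
  apply: eq_integral => w _; congr (_%:E); under eq_bigr do rewrite gE.
  have [wB|wB] := pselect ((\bigcap_(i in [set: 'I_n]) (W i @^-1` B i)) w).
    rewrite indicE mem_set// big1// => i _.
    by rewrite indicE mem_set//; exact: wB.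
  rewrite [RHS]indicE memNset//=.
  have [i Bi] : exists i, ~ B i (W i w).
    by apply/existsNP => H; apply: wB => i _; exact: H.
  by rewrite (bigD1 i)//= indicE memNset ?mul0r.
have [kn|nk] := ltnP k n; last first.
  apply: IH => // i ki; exfalso; have := ltn_ord i; lia.
pose i0 := Ordinal kn.
pose c := (\prod_(i < n | i != i0) \int[P]_w (g i (W i w))%:E)%E.
have c_fin : c \is a fin_num.
  apply: (big_ind (fun x => x \is a fin_num)) => //.
    by move=> x y ? ?; rewrite fin_numM.
  move=> i _; rewrite ge0_fin_numE ?gy//.
  by apply: integral_ge0 => w _; rewrite lee_fin.
have c0 : (0 <= c)%E.
  apply: prode_ge0 => i _; apply: integral_ge0 => w _; by rewrite lee_fin.
pose Y w := \prod_(i < n | i != i0) g i (W i w).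
have mY : measurable_fun setT Y by exact: measurable_comp_prod.
have Y0 w : 0 <= Y w by apply: prodr_ge0.
have mYc : measurable_fun setT (cst (fine c) : T -> R) by [].
(* With the other factors frozen into the weight [Y], both sides integrate [g i0] against weighted
   laws of [W i0]. These laws agree on a set [B] by the induction hypothesis, applied with [g i0]
   replaced by the indicator of [B]. *)
have key : (\int[P]_w ((Y w)%:E * (g i0 (W i0 w))%:E) =
            \int[P]_w ((fine c)%:E * (g i0 (W i0 w))%:E))%E.
  apply: (@ge0_eq_integral_law _ _ _ T T G R P P Y (cst (fine c)) (W i0) (W i0)
    _ _ _ _ _ _ _ (EFin \o g i0)) => //.
  - by move=> w; rewrite /= fine_ge0.
  - move=> B mB.
    pose g' i := if i == i0 then \1_B else g i.
    have g'0 : g' i0 = \1_B by rewrite /g' eqxx.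
    have g'N i : i != i0 -> g' i = g i by rewrite /g' => /negbTE ->.
    have mWB : measurable (W i0 @^-1` B).
      by rewrite -[X in measurable X]setTI; exact: mW.
    have := IH g'; rewrite (bigD1 i0)//=.
    rewrite g'0.
    have -> : (\prod_(i < n | i != i0) \int[P]_w (g' i (W i w))%:E = c)%E.
      by apply: eq_bigr => i ii0; rewrite g'N.
    have gB1 : (\int[P]_w ((\1_B : G -> R) (W i0 w))%:E = P (W i0 @^-1` B))%E.
      by rewrite -[X in P X]setIT -integral_indic.
    rewrite gB1 => IHg'.
    transitivity (P (W i0 @^-1` B) * c)%E.
      rewrite -IHg'.
      + rewrite integral_mkcond; apply: eq_integral => w _.
        rewrite (bigD1 i0)//= g'0.
        have -> : \prod_(i < n | i != i0) g' i (W i w) = Y w.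
          by apply: eq_bigr => i ii0; rewrite g'N.
        rewrite patchE indicE; case: ifPn => wB.
          by rewrite mem_set ?mul1r//; exact: (set_mem wB).
        by rewrite memNset ?mul0r//; move/negP: wB => wB H; apply: wB; exact: mem_set.
      + by move=> i; rewrite /g'; case: ifPn => // _; exact: measurable_indic.
      + by move=> i x; rewrite /g'; case: ifPn => // _; rewrite indicE.
      + move=> i; rewrite /g'; case: ifPn => // /eqP ->.
        by rewrite gB1 (le_lt_trans (probability_le1 _ _))// ltry.
      + move=> i ki; rewrite /g'; case: ifPn => [_|ii0]; first by exists B.
        apply: gB; rewrite ltn_neqAle ki andbT.
        by apply: contraNN ii0 => /eqP ki'; apply/eqP/val_inj.
    by rewrite integral_cst// fineK// muleC.
  - exact/measurable_EFinP.
  - by move=> x; rewrite lee_fin.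
rewrite (bigD1 i0)//= -/c muleC.
transitivity (\int[P]_w ((Y w)%:E * (g i0 (W i0 w))%:E))%E.
  by apply: eq_integral => w _; rewrite (bigD1 i0)//= mulrC EFinM.
rewrite key fineK// ge0_integralZl//.
- by apply/measurable_EFinP; exact: measurableT_comp.
- by move=> w _; rewrite lee_fin.
Qed.

End independence.

Lemma measurable_set_ler d (T : measurableType d) (R : realType) (f g : T -> R) :
  measurable_fun setT f -> measurable_fun setT g ->
  measurable [set x | f x <= g x].
Proof.
move=> mf mg.
have := @measurable_fun_ler _ _ _ _ _ _ mf mg measurableT [set true].
by rewrite setTI; apply.
Qed.

Lemma measurable_set_ltr d (T : measurableType d) (R : realType) (f g : T -> R) :
  measurable_fun setT f -> measurable_fun setT g ->
  measurable [set x | f x < g x].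
Proof.
move=> mf mg.
have := @measurable_fun_ltr _ _ _ _ _ _ mf mg measurableT [set true].
by rewrite setTI; apply.
Qed.

Section real_integrable.
Context d (T : measurableType d) (R : realType) (m : {measure set T -> \bar R}).
Implicit Types f g : T -> R.

Lemma le_integrable_EFin f g : measurable_fun setT f ->
  (forall x, `|f x| <= g x) -> m.-integrable setT (EFin \o g) ->
  m.-integrable setT (EFin \o f).
Proof.
move=> mf fg; apply: le_integrable => //; first exact/measurable_EFinP.
by move=> x _ /=; rewrite lee_fin (le_trans (fg x))// ler_norm.
Qed.

Lemma ge0_integrable_EFin f (C : R) : measurable_fun setT f ->
  (forall x, 0 <= f x) -> (\int[m]_x (f x)%:E <= C%:E)%E ->
  m.-integrable setT (EFin \o f).
Proof.
move=> mf f0 fC; apply/integrableP; split; first exact/measurable_EFinP.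
under eq_integral do rewrite /= ger0_norm//.
by rewrite (le_lt_trans fC)// ltry.
Qed.

Lemma EFin_Rintegral f : m.-integrable setT (EFin \o f) ->
  ((\int[m]_x f x)%:E = \int[m]_x (f x)%:E)%E.
Proof. by move=> fi; rewrite fineK//; exact: integrable_fin_num. Qed.

Lemma ge0_Rintegral_le f (C : R) : measurable_fun setT f ->
  (forall x, 0 <= f x) -> (\int[m]_x (f x)%:E <= C%:E)%E ->
  \int[m]_x f x <= C.
Proof.
move=> mf f0 fC; rewrite -lee_fin EFin_Rintegral//.
exact: ge0_integrable_EFin fC.
Qed.

Lemma ge0_markov f (c : R) : measurable_fun setT f -> (forall x, 0 <= f x) ->
  0 < c -> (m [set x | (c <= f x)%R] <= c^-1%:E * \int[m]_x (f x)%:E)%E.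
Proof.
move=> mf f0 c0.
have mA : measurable [set x | c <= f x].
  exact: measurable_set_ler.
have -> : m [set x | (c <= f x)%R] =
    (c^-1%:E * \int[m]_x (c * \1_[set x | (c <= f x)%R] x)%:E)%E.
  under eq_integral do rewrite EFinM.
  rewrite ge0_integralZl//= ?lee_fin ?(ltW c0)//; last first.
    by apply/measurable_EFinP; exact: measurable_indic.
  rewrite muleA -EFinM mulVf ?gt_eqF// mul1e integral_indic// setIT//.
apply: lee_wpmul2l; first by rewrite lee_fin invr_ge0 ltW.
apply: ge0_le_integral => //.
- by move=> x _; rewrite lee_fin mulr_ge0// ltW.
- by apply/measurable_EFinP; apply: measurable_funM.
- exact/measurable_EFinP.
- move=> x _; rewrite lee_fin indicE; case: (boolP (x \in _)) => xA.
    by rewrite mulr1; exact: (set_mem xA).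
  by rewrite mulr0.
Qed.

End real_integrable.

Lemma Rintegral_cst_probability d (T : measurableType d) (R : realType)
  (P : probability T R) (c : R) : \int[P]_w c = c.
Proof.
rewrite Rintegral_cst// -[RHS]mulr1; congr (_ * _).
exact: (congr1 fine (probability_setT P)).
Qed.

(** Comes from e^y - 1 <= y e^y used once or twice. Integrated, it controls a moment generating
    function by an exponentially weighted second moment, so the summands may be unbounded. *)
Lemma expR_le_quad (R : realType) (x : R) :
  expR x <= 1 + x + x ^+ 2 * expR `|x|.
Proof.
have lin (y : R) : expR y - 1 <= y * expR y.
  rewrite -subr_ge0.
  have -> : y * expR y - (expR y - 1) = expR y * (expR (- y) - (1 - y)).
    by rewrite mulrBr expRN divff ?gt_eqF ?expR_gt0//; ring.
  by rewrite mulr_ge0 ?expR_ge0// subr_ge0 expR_ge1Dx.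
have lx := lin x; have [x0|x0] := leP 0 x.
  rewrite ger0_norm//.
  have : x * (expR x - 1) <= x * (x * expR x) by rewrite ler_wpM2l.
  nra.
rewrite ltr0_norm//.
have e1 : 1 <= expR (- x) by rewrite -expR0 ler_expR; lra.
have := expR_ge1Dx x.
nra.
Qed.

(** * Chernoff and variance bounds for sums of i.i.d. variables *)

Section iid_sums.
Context d dG (T : measurableType d) (G : measurableType dG) (R : realType)
  (P : probability T R) (n : nat) (W : 'I_n -> T -> G) (W0 : T -> G).
Hypothesis mW : forall i, measurable_fun setT (W i).
Hypothesis mW0 : measurable_fun setT W0.
Hypothesis indep : forall B : 'I_n -> set G, (forall i, measurable (B i)) ->
  P (\bigcap_(i in [set: 'I_n]) (W i @^-1` B i)) =
  (\prod_(i < n) P (W i @^-1` B i))%E.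
Hypothesis eqlaw : forall i B, measurable B ->
  P (W i @^-1` B) = P (W0 @^-1` B).

Lemma ge0_integral_eqlaw i (f : G -> \bar R) : measurable_fun setT f ->
  (forall g, (0 <= f g)%E) -> (\int[P]_w f (W i w) = \int[P]_w f (W0 w))%E.
Proof.
move=> mf f0.
have := @ge0_eq_integral_law _ _ _ T T G R P P (cst 1) (cst 1) (W i) W0
  _ _ _ _ _ _ _ f mf f0.
under eq_integral do rewrite mul1e; under [in RHS]eq_integral do rewrite mul1e.
apply=> // B mB.
have int1 A : measurable A -> (\int[P]_(x in A) (cst 1 x)%:E = P A)%E.
  by move=> mA; rewrite (integral_cst _ mA 1%E) mul1e.
rewrite !int1.
- exact: eqlaw.
- by rewrite -[X in measurable X]setTI; exact: mW0.
- by rewrite -[X in measurable X]setTI; exact: mW.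
Qed.

Lemma integral_eqlaw i (f : G -> R) : measurable_fun setT f ->
  (\int[P]_w (f (W i w))%:E = \int[P]_w (f (W0 w))%:E)%E.
Proof.
move=> mf; rewrite [LHS]integralE [RHS]integralE.
have mEf : measurable_fun setT (EFin \o f) by exact/measurable_EFinP.
have pE (V : T -> G) :
    ((fun w => (f (V w))%:E)^\+ = (EFin \o f)^\+ \o V)%E.
  by apply/funext => w; rewrite /= !funeposE.
have nE (V : T -> G) :
    ((fun w => (f (V w))%:E)^\- = (EFin \o f)^\- \o V)%E.
  by apply/funext => w; rewrite /= !funenegE.
rewrite !pE !nE; congr (_ - _)%E.
  exact: (ge0_integral_eqlaw i (measurable_funepos mEf) (funepos_ge0 _)).
exact: (ge0_integral_eqlaw i (measurable_funeneg mEf) (funeneg_ge0 _)).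
Qed.

Lemma Rintegral_eqlaw i (f : G -> R) : measurable_fun setT f ->
  \int[P]_w f (W i w) = \int[P]_w f (W0 w).
Proof. by move=> mf; rewrite /Rintegral integral_eqlaw. Qed.

Lemma integrable_eqlaw i (f : G -> R) : measurable_fun setT f ->
  P.-integrable setT (fun w => (f (W0 w))%:E) ->
  P.-integrable setT (fun w => (f (W i w))%:E).
Proof.
move=> mf /integrableP[_ fi]; apply/integrableP; split.
  by apply/measurable_EFinP; exact: measurableT_comp.
rewrite (@ge0_integral_eqlaw i (fun g => `|(f g)%:E|%E))//.
by apply: measurableT_comp => //; exact/measurable_EFinP.
Qed.

Let N1 (a : R) : 0 <= a ^+ 2 + 1 - `|a|.
Proof.
have := sqr_ge0 (`|a| - 1); rewrite sqrrB1 real_normK ?num_real//.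
have := sqr_ge0 a; lra.
Qed.

Lemma integrable_sqr (f : T -> R) (B : R) : measurable_fun setT f ->
  (\int[P]_w (f w ^+ 2)%:E <= B%:E)%E -> P.-integrable setT (EFin \o f).
Proof.
move=> mf fB; apply: (@le_integrable_EFin _ _ _ _ _ (fun w => f w ^+ 2 + 1)).
- by [].
- by move=> w; have := N1 (f w); lra.
- rewrite (_ : _ \o _ = (EFin \o (fun w => f w ^+ 2)) \+ cst 1%E)//.
  apply: integrableD => //; last exact: finite_measure_integrable_cst.
  apply: ge0_integrable_EFin fB => [|w]; last exact: sqr_ge0.
  exact: measurable_funX.
Qed.

Section chernoff.
Variables (f : G -> R) (B l : R).
Hypothesis mf : measurable_fun setT f.
Hypothesis l0 : 0 <= l.
Hypothesis fB : (\int[P]_w (f (W0 w) ^+ 2 * expR (l * `|f (W0 w)|))%:E <= B%:E)%E.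

Let mfW : measurable_fun setT (f \o W0). Proof. exact: measurableT_comp. Qed.

Let mq : measurable_fun setT
  (fun w => f (W0 w) ^+ 2 * expR (l * `|f (W0 w)|)).
Proof.
apply: measurable_funM; first exact: measurable_funX.
apply: measurableT_comp => //; apply: measurable_funM => //.
exact: measurableT_comp.
Qed.

Let q0 w : 0 <= f (W0 w) ^+ 2 * expR (l * `|f (W0 w)|).
Proof. by rewrite mulr_ge0 ?sqr_ge0 ?expR_ge0. Qed.

Let iq : P.-integrable setT
  (EFin \o (fun w => f (W0 w) ^+ 2 * expR (l * `|f (W0 w)|))).
Proof. exact: ge0_integrable_EFin fB. Qed.

Let if_ : P.-integrable setT (EFin \o (f \o W0)).
Proof.
apply: (@integrable_sqr _ B) => //; apply: le_trans fB.
apply: ge0_le_integral => //.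
- by move=> w _; rewrite lee_fin sqr_ge0.
- by apply/measurable_EFinP; exact: measurable_funX.
- exact/measurable_EFinP.
move=> w _; rewrite lee_fin ler_peMr ?sqr_ge0//.
by rewrite -expR0 ler_expR mulr_ge0.
Qed.

Let mu := \int[P]_w f (W0 w).

Lemma integral_expR_le :
  (\int[P]_w (expR (l * f (W0 w)))%:E <= (expR (l * mu + l ^+ 2 * B))%:E)%E.
Proof.
have il : P.-integrable setT (EFin \o (fun w => 1 + l * f (W0 w))).
  rewrite (_ : _ \o _ = cst 1%E \+ (fun w => l%:E * (f (W0 w))%:E)%E)//.
  apply: integrableD => //; first exact: finite_measure_integrable_cst.
  exact: integrableZl.
have iq2 : P.-integrable setT (EFin \o (fun w =>
    l ^+ 2 * (f (W0 w) ^+ 2 * expR (l * `|f (W0 w)|)))).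
  exact: (@integrableZl _ _ _ _ _ _ (l ^+ 2) _ iq).
have ib : P.-integrable setT (EFin \o (fun w => 1 + l * f (W0 w) +
    l ^+ 2 * (f (W0 w) ^+ 2 * expR (l * `|f (W0 w)|)))).
  exact: (integrableD _ il iq2).
apply: (@le_trans _ _ (\int[P]_w (1 + l * f (W0 w) +
    l ^+ 2 * (f (W0 w) ^+ 2 * expR (l * `|f (W0 w)|))))%:E).
  rewrite EFin_Rintegral//; apply: ge0_le_integral => //.
  - apply/measurable_EFinP; apply: measurableT_comp => //.
    exact: measurable_funM.
  - exact: measurable_int ib.
  move=> w _; rewrite lee_fin (le_trans (expR_le_quad _))//.
  by rewrite normrM (ger0_norm l0) exprMn mulrA.
rewrite lee_fin RintegralD//.
have -> : \int[P]_w (1 + l * f (W0 w)) = 1 + l * mu.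
  rewrite RintegralD//; last 2 first.
  - exact: finite_measure_integrable_cst.
  - exact: (@integrableZl _ _ _ _ _ _ l _ if_).
  by rewrite Rintegral_cst_probability RintegralZl.
rewrite RintegralZl//.
have := expR_ge1Dx (l * mu + l ^+ 2 * B).
have : \int[P]_x (f (W0 x) ^+ 2 * expR (l * `|f (W0 x)|)) <= B.
  exact: ge0_Rintegral_le.
move=> /(ler_wpM2l (sqr_ge0 l)); lra.
Qed.

(** Markov's inequality for exp(l sum), whose mean factors by independence. The parameter [l] stays
    free because the moment hypothesis on [f] depends on it. *)
Lemma chernoff_upper (s : R) :
  (P [set w | n%:R * (mu + s) <= \sum_(i < n) f (W i w)]%R <=
   (expR (- (n%:R * (l * s - l ^+ 2 * B))))%:E)%E.
Proof.
pose e w := \prod_(i < n) expR (l * f (W i w)).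
have me : measurable_fun setT e.
  apply: (@measurable_comp_prod _ _ _ _ _ _ W mW predT
    (fun _ x => expR (l * f x))) => i.
  by apply: measurableT_comp => //; exact: measurable_funM.
have ee w : e w = expR (l * \sum_(i < n) f (W i w)).
  by rewrite mulr_sumr expR_sum.
pose c := expR (l * (n%:R * (mu + s))).
have c0 : 0 < c by exact: expR_gt0.
have e0 w : 0 <= e w by rewrite ee expR_ge0.
apply: (@le_trans _ _ (P [set w | (c <= e w)%R])).
  apply: le_measure; rewrite ?inE.
  - apply: measurable_set_ler => //.
    by apply: measurable_sum => i; exact: measurableT_comp.
  - exact: measurable_set_ler.
  by move=> w /= H; rewrite ee ler_expR ler_wpM2l.
apply: (le_trans (ge0_markov P me e0 c0)).
have gE i : (\int[P]_w (expR (l * f (W i w)))%:E =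
            \int[P]_w (expR (l * f (W0 w)))%:E)%E.
  apply: (@integral_eqlaw i (fun x => expR (l * f x))).
  by apply: measurableT_comp => //; exact: measurable_funM.
have I0 : (0 <= \int[P]_w (expR (l * f (W0 w)))%:E)%E.
  by apply: integral_ge0 => w _; rewrite lee_fin expR_ge0.
rewrite (@integral_prod_indep _ _ _ _ _ P n W mW indep
    (fun _ x => expR (l * f x))); last 3 first.
- by move=> i; apply: measurableT_comp => //; exact: measurable_funM.
- by move=> i x; exact: expR_ge0.
- by move=> i; rewrite gE (le_lt_trans integral_expR_le)// ltry.
under eq_bigr do rewrite gE.
have [a [a0 aE]] : exists a, 0 <= a /\
    (\int[P]_w (expR (l * f (W0 w)))%:E = a%:E)%E.
  exists (fine (\int[P]_w (expR (l * f (W0 w)))%:E)%E); split.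
    exact: fine_ge0.
  by rewrite fineK// ge0_fin_numE// (le_lt_trans integral_expR_le)// ltry.
have := integral_expR_le; rewrite aE lee_fin => aB.
rewrite -(big_morph EFin (@EFinM R) (erefl _)) -EFinM lee_fin prodr_const card_ord.
apply: (@le_trans _ _ (c^-1 * expR (l * mu + l ^+ 2 * B) ^+ n)).
  by rewrite ler_wpM2l ?invr_ge0 ?(ltW c0)// lerXn2r ?nnegrE ?expR_ge0.
rewrite -expRM_natl -expRN -expRD ler_expR -mulr_natl.
by rewrite le_eqVlt; apply/orP; left; apply/eqP; ring.
Qed.

End chernoff.
Lemma chernoff_two_sided (f : G -> R) (B s : R) : measurable_fun setT f ->
  0 < B -> 0 <= s ->
  (\int[P]_w (f (W0 w) ^+ 2 * expR (s / (2 * B) * `|f (W0 w)|))%:E <= B%:E)%E ->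
  (P [set w | n%:R * s <=
       `|\sum_(i < n) f (W i w) - n%:R * \int[P]_w f (W0 w)| ]%R <=
   (2 * expR (- (n%:R * (s ^+ 2 / (4 * B)))))%:E)%E.
Proof.
move=> mf B0 s0 fB; set mu := \int[P]_w f (W0 w).
(* The maximizer of l s - l^2 B, with value s^2 / (4 B). *)
pose l := s / (2 * B).
have l0 : 0 <= l by rewrite /l divr_ge0// mulr_ge0// ltW.
have lE : l * s - l ^+ 2 * B = s ^+ 2 / (4 * B).
  by rewrite /l; field; rewrite gt_eqF.
have mNf : measurable_fun setT (fun x => - f x) by exact: measurable_funN.
have NfB : (\int[P]_w ((- f (W0 w)) ^+ 2 * expR (l * `|- f (W0 w)|))%:E <= B%:E)%E.
  by under eq_integral do rewrite sqrrN normrN.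
have if_ : P.-integrable setT (EFin \o (f \o W0)).
  apply: (@integrable_sqr _ B); first exact: measurableT_comp.
  apply: le_trans fB; apply: ge0_le_integral => //.
  - by move=> w _; rewrite lee_fin sqr_ge0.
  - apply/measurable_EFinP; apply: measurable_funX; exact: measurableT_comp.
  - apply/measurable_EFinP; apply: measurable_funM.
      by apply: measurable_funX; exact: measurableT_comp.
    apply: measurableT_comp => //; apply: measurable_funM => //.
    by apply: measurableT_comp => //; exact: measurableT_comp.
  move=> w _; rewrite lee_fin ler_peMr ?sqr_ge0//.
  by rewrite -[X in X <= _]expR0 ler_expR; exact: (mulr_ge0 l0 (normr_ge0 _)).
have muN : \int[P]_w (- f (W0 w)) = - mu.
  transitivity (\int[P]_w (-1 * f (W0 w))).
    by apply: eq_Rintegral => w _; rewrite mulN1r.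
  by rewrite RintegralZl// mulN1r.
have U1 := @chernoff_upper f B l mf l0 fB s.
have U2 := @chernoff_upper (fun x => - f x) B l mNf l0 NfB s.
rewrite muN in U2; rewrite lE in U1, U2.
pose A1 := [set w | n%:R * (mu + s) <= \sum_(i < n) f (W i w)].
pose A2 := [set w | n%:R * (- mu + s) <= \sum_(i < n) - f (W i w)].
have mS (g : G -> R) : measurable_fun setT g ->
    measurable_fun setT (fun w => \sum_(i < n) g (W i w)).
  by move=> mg; apply: measurable_sum => i; exact: measurableT_comp.
have mA1 : measurable A1 by apply: measurable_set_ler => //; exact: mS.
have mA2 : measurable A2.
  by apply: measurable_set_ler => //; exact: (mS (fun x => - f x)).
apply: (@le_trans _ _ (P (A1 `|` A2))).
  apply: le_measure; rewrite ?inE.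
  - apply: measurable_set_ler => //; apply: measurableT_comp => //.
    by apply: measurable_funB => //; exact: mS.
  - exact: measurableU.
  move=> w /=; rewrite /A1 /A2 /= ler_normr sumrN => /orP[] H; [left|right]; lra.
apply: (le_trans (measureU2 _ mA1 mA2)).
have -> x : (2 * x)%:E = (x%:E + x%:E)%E :> \bar R by rewrite -EFinD; congr EFin; ring.
exact: leeD.
Qed.

Lemma integral_mul_indep i j (a b : G -> R) : i != j ->
  measurable_fun setT a -> measurable_fun setT b ->
  (forall x, 0 <= a x) -> (forall x, 0 <= b x) ->
  P.-integrable setT (EFin \o (a \o W0)) ->
  P.-integrable setT (EFin \o (b \o W0)) ->
  (\int[P]_w (a (W i w) * b (W j w))%:E =
   \int[P]_w (a (W0 w))%:E * \int[P]_w (b (W0 w))%:E)%E.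
Proof.
move=> ij ma mb a0 b0 ia ib.
pose f k : G -> R := if k == i then a else if k == j then b else cst 1.
have fi : f i = a by rewrite /f eqxx.
have fj : f j = b by rewrite /f eq_sym (negbTE ij) eqxx.
have fk k : (k != i) && (k != j) -> f k = cst 1.
  by rewrite /f => /andP[/negbTE -> /negbTE ->].
have fin (g : G -> R) : (forall x, 0 <= g x) ->
    P.-integrable setT (EFin \o (g \o W0)) ->
    (\int[P]_w (g (W0 w))%:E < +oo)%E.
  by move=> g0 /integrable_lty; apply.
have mf k : measurable_fun setT (f k).
  by rewrite /f; case: ifPn => // _; case: ifPn.
have int1 : (\int[P]_w (1%R : R)%:E = 1)%E.
  by rewrite (integral_cst P measurableT 1%E) mul1e; exact: probability_setT.
have := @integral_prod_indep _ _ _ _ _ P n W mW indep f mf.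
rewrite (bigD1 i)//= (bigD1 j) ?(eq_sym j)//= fi fj.
rewrite [X in (_ * (_ * X))%E]big1 ?mule1; last first.
  by move=> k /andP[ki kj]; rewrite fk ?ki.
rewrite !integral_eqlaw// => <-.
- apply: eq_integral => w _; congr EFin.
  rewrite (bigD1 i)//= (bigD1 j) ?(eq_sym j)//= fi fj.
  by rewrite [X in _ = _ * (_ * X)]big1 ?mulr1// => k H; rewrite fk.
- by move=> k x; rewrite /f; case: ifPn => // _; case: ifPn.
- move=> k; rewrite integral_eqlaw//; rewrite /f; case: ifPn => _.
    exact: fin.
  case: ifPn => _; first exact: fin.
  by rewrite int1 ltry.
Qed.

Lemma sum_sqr_dev_le (f : G -> R) (B : R) : measurable_fun setT f ->
  (\int[P]_w (f (W0 w) ^+ 2)%:E <= B%:E)%E ->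
  (\int[P]_w ((\sum_(i < n) f (W i w) - n%:R * \int[P]_w f (W0 w)) ^+ 2)%:E
   <= (n%:R * B)%:E)%E.
Proof.
move=> mf fB; set mu := \int[P]_w f (W0 w).
pose g x := f x - mu.
have mg : measurable_fun setT g by exact: measurable_funB.
have mfW : measurable_fun setT (f \o W0) by exact: measurableT_comp.
have if_ : P.-integrable setT (EFin \o (f \o W0)).
  exact: (@integrable_sqr _ B).
have if2 : P.-integrable setT (EFin \o (fun w => f (W0 w) ^+ 2)).
  by apply: ge0_integrable_EFin fB => [|w]; [exact: measurable_funX|exact: sqr_ge0].
have ic c : P.-integrable setT (EFin \o (cst c : T -> R)).
  exact: finite_measure_integrable_cst.
have ig : P.-integrable setT (EFin \o (g \o W0)).
  by apply: (integrableB _ if_ (ic mu)).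
have Eg : \int[P]_w g (W0 w) = 0.
  rewrite RintegralB//; last exact: ic.
  by rewrite Rintegral_cst_probability subrr.
have g2E w : g (W0 w) ^+ 2 = f (W0 w) ^+ 2 + (- (2 * mu) * f (W0 w) + mu ^+ 2).
  by rewrite /g; ring.
have il : P.-integrable setT (EFin \o (fun w => - (2 * mu) * f (W0 w) + mu ^+ 2)).
  exact: (integrableD measurableT
    (@integrableZl _ _ _ _ _ measurableT (- (2 * mu)) _ if_) (ic (mu ^+ 2))).
have ig2 : P.-integrable setT (EFin \o (fun w => g (W0 w) ^+ 2)).
  rewrite (_ : _ \o _ = EFin \o (fun w => f (W0 w) ^+ 2 +
    (- (2 * mu) * f (W0 w) + mu ^+ 2))); first exact: (integrableD _ if2 il).
  by apply/funext => w; rewrite /= g2E.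
have Eg2 : \int[P]_w g (W0 w) ^+ 2 <= B.
  under eq_Rintegral do rewrite g2E.
  rewrite RintegralD// RintegralD//; last 2 first.
  - exact: (@integrableZl _ _ _ _ _ measurableT (- (2 * mu)) _ if_).
  - exact: ic.
  rewrite RintegralZl// Rintegral_cst_probability -/mu.
  have : \int[P]_w (f (W0 w) ^+ 2) <= B.
    by apply: ge0_Rintegral_le => // [|w]; [exact: measurable_funX|exact: sqr_ge0].
  have := sqr_ge0 mu; lra.
have mgW i : measurable_fun setT (fun w => g (W i w)) by exact: measurableT_comp.
have igW2 i : P.-integrable setT (EFin \o (fun w => g (W i w) ^+ 2)).
  apply: (@integrable_eqlaw i (fun x => g x ^+ 2)) => //.
  exact: measurable_funX.
have igg i j : P.-integrable setT (EFin \o (fun w => g (W i w) * g (W j w))).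
  apply: (@le_integrable_EFin _ _ _ _ _ (fun w => g (W i w) ^+ 2 + g (W j w) ^+ 2)).
  - exact: measurable_funM.
  - move=> w; rewrite ler_norml; apply/andP.
    have := sqr_ge0 (g (W i w) + g (W j w)).
    have := sqr_ge0 (g (W i w) - g (W j w)).
    have := sqr_ge0 (g (W i w)); have := sqr_ge0 (g (W j w)); split; nra.
  - exact: (integrableD _ (igW2 i) (igW2 j)).
have Egg i j : i != j -> \int[P]_w (g (W i w) * g (W j w)) = 0.
  move=> ij.
  (* The product rule for independent variables is available for nonnegative functions, so the
     centered [g] is split into its positive and negative parts. They have equal means, and the four
     products cancel. *)
  pose a x := Num.max (g x) 0; pose b x := Num.max (- g x) 0.
  have gab x : g x = a x - b x.
    by rewrite /a /b; case: (leP (g x) 0) => ?; case: (leP (- g x) 0) => ?; lra.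
  have a0 x : 0 <= a x by rewrite /a le_max lexx orbT.
  have b0 x : 0 <= b x by rewrite /b le_max lexx orbT.
  have ale x : `|a x| <= `|g x|.
    by rewrite ger0_norm// /a ge_max ler_norm/=.
  have ble x : `|b x| <= `|g x|.
    by rewrite ger0_norm// /b ge_max normr_ge0 andbT -normrN ler_norm.
  have ma : measurable_fun setT a by exact: measurable_maxr.
  have mb : measurable_fun setT b.
    by apply: measurable_maxr => //; exact: measurable_funN.
  have ign : P.-integrable setT (EFin \o (fun w => `|g (W0 w)|)).
    exact: integrable_norm.
  have ia : P.-integrable setT (EFin \o (a \o W0)).
    apply: le_integrable_EFin ign => [|w]; last exact: ale.
    exact: measurableT_comp.
  have ib : P.-integrable setT (EFin \o (b \o W0)).
    apply: le_integrable_EFin ign => [|w]; last exact: ble.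
    exact: measurableT_comp.
  have Eab : \int[P]_w a (W0 w) = \int[P]_w b (W0 w).
    apply/eqP; rewrite -subr_eq0 -RintegralB//; apply/eqP; rewrite -Eg.
    by apply: eq_Rintegral => w _; rewrite gab.
  have prod (u v : G -> R) : measurable_fun setT u -> measurable_fun setT v ->
      (forall x, 0 <= u x) -> (forall x, 0 <= v x) ->
      P.-integrable setT (EFin \o (u \o W0)) ->
      P.-integrable setT (EFin \o (v \o W0)) ->
      P.-integrable setT (EFin \o (fun w => u (W i w) * v (W j w))) /\
      \int[P]_w (u (W i w) * v (W j w)) =
      \int[P]_w u (W0 w) * \int[P]_w v (W0 w).
    move=> mu_ mv u0 v0 iu iv.
    have E := integral_mul_indep ij mu_ mv u0 v0 iu iv.
    have E' : (\int[P]_w (u (W i w) * v (W j w))%:E =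
        (\int[P]_w u (W0 w) * \int[P]_w v (W0 w))%:E)%E.
      by rewrite E EFinM !EFin_Rintegral.
    split; last by rewrite /Rintegral E'.
    apply: (@ge0_integrable_EFin _ _ _ _ _ (\int[P]_w u (W0 w) * \int[P]_w v (W0 w))).
    - by apply: measurable_funM; exact: measurableT_comp.
    - by move=> w; exact: mulr_ge0.
    - by rewrite E'.
  have [iaa Eaa] := prod a a ma ma a0 a0 ia ia.
  have [iab Eab'] := prod a b ma mb a0 b0 ia ib.
  have [iba Eba] := prod b a mb ma b0 a0 ib ia.
  have [ibb Ebb] := prod b b mb mb b0 b0 ib ib.
  transitivity (\int[P]_w (a (W i w) * a (W j w) - a (W i w) * b (W j w) -
      (b (W i w) * a (W j w) - b (W i w) * b (W j w)))).
    by apply: eq_Rintegral => w _; rewrite !gab; ring.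
  rewrite RintegralB//; [|exact: (integrableB _ iaa iab)|exact: (integrableB _ iba ibb)].
  rewrite !RintegralB// Eaa Eab' Eba Ebb Eab; ring.
have SE w : (\sum_(i < n) f (W i w) - n%:R * mu) ^+ 2 =
    \sum_(i < n) \sum_(j < n) g (W i w) * g (W j w).
  have -> : \sum_(i < n) f (W i w) - n%:R * mu = \sum_(i < n) g (W i w).
    by rewrite /g sumrB sumr_const card_ord -[in RHS]mulr_natl.
  by rewrite expr2 big_distrlr.
under eq_integral do rewrite SE.
have iS i : P.-integrable setT (fun w => (\sum_(j < n) g (W i w) * g (W j w))%:E).
  under eq_fun do rewrite -sumEFin.
  by apply: integrable_sum => // j _; exact: igg.
under eq_integral do rewrite -sumEFin.
rewrite integral_sum//.
have -> : (n%:R * B)%:E = (\sum_(i < n) B%:E)%E :> \bar R.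
  by rewrite sumEFin sumr_const card_ord mulr_natl.
apply: lee_sum => i _.
under eq_integral do rewrite -sumEFin.
rewrite integral_sum//; last by move=> j; exact: igg.
rewrite (bigD1 i)//= big1 ?adde0; last first.
  by move=> j ji; rewrite -EFin_Rintegral ?Egg// eq_sym.
rewrite -EFin_Rintegral; last exact: igg.
rewrite lee_fin; apply: le_trans Eg2.
by rewrite -(@Rintegral_eqlaw i (fun x => g x ^+ 2))//; exact: measurable_funX.
Qed.

End iid_sums.

(** * Smoothing by the kernel *)

Section smooth_functions.
Context (R : realType).
Implicit Types (f g : R -> R) (x y t l : R).

Lemma derivable_is_derive1 f x : derivable f x 1 -> is_derive x 1 f (f^`()%classic x).
Proof. by move=> df; rewrite derive1E; exact: derivableP. Qed.

Lemma is_derive1_derive1 f x l : is_derive x 1 f l -> f^`()%classic x = l.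
Proof. by move=> df; rewrite derive1E derive_val. Qed.

Lemma derivable_continuous f : (forall x, derivable f x 1) -> continuous f.
Proof.
by move=> df x; apply: differentiable_continuous; exact/derivable1_diffP.
Qed.

Lemma mean_value f : (forall x, derivable f x 1) -> forall x y,
  exists c, `|c - y| <= `|x - y| /\ f x - f y = f^`()%classic c * (x - y).
Proof.
move=> df.
have cf : continuous f by exact: derivable_continuous.
have main a b : a <= b ->
    exists2 c, c \in `[a, b] & f b - f a = f^`()%classic c * (b - a).
  move=> ab; apply: (@MVT_segment R f f^`()%classic) => //.
    by move=> x _; exact: derivable_is_derive1.
  exact: continuous_subspaceT.
move=> x y; have [xy|/ltW yx] := leP x y.
  have [c] := main _ _ xy; rewrite in_itv/= => /andP[xc cy] E.
  exists c; split; last by lra.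
  by rewrite ler0_norm ?subr_le0// ler0_norm ?subr_le0//; lra.
have [c] := main _ _ yx; rewrite in_itv/= => /andP[yc cx] E.
exists c; split; last by [].
by rewrite ger0_norm ?subr_ge0// ger0_norm ?subr_ge0//; lra.
Qed.

Lemma lipschitz_of_derive f C : (forall x, derivable f x 1) ->
  (forall x, `|f^`()%classic x| <= C) -> forall x y, `|f x - f y| <= C * `|x - y|.
Proof.
move=> df fC x y; have [c [_ ->]] := mean_value df x y.
by rewrite normrM ler_wpM2r.
Qed.

(** Two uses of the mean value theorem; the constant 1/2 of Taylor's formula is given up. *)
Lemma taylor2 f C : (forall x, derivable f x 1) ->
  (forall x, derivable f^`()%classic x 1) ->
  (forall x, `|f^`(2)%classic x| <= C) ->
  forall x y, `|f x - f y - f^`()%classic y * (x - y)| <= C * (x - y) ^+ 2.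
Proof.
move=> df ddf fC x y; have [c [cy ->]] := mean_value df x y.
rewrite -mulrBl normrM -[(x - y) ^+ 2]real_normK ?num_real// expr2 mulrA.
rewrite ler_wpM2r//.
apply: (le_trans (lipschitz_of_derive ddf fC c y)).
by rewrite ler_wpM2l// (le_trans (normr_ge0 _) (fC 0)).
Qed.

(** [bounded_derivs] starts at the first derivative. Bounding the function as well makes the class
    stable under products. *)
Definition smooth_bounded k C f :=
  (forall t, `|f t| <= C) /\ bounded_derivs k C f.

Lemma smooth_boundedS k C f : smooth_bounded k.+1 C f <->
  [/\ forall t, `|f t| <= C, forall t, derivable f t 1 &
      smooth_bounded k C f^`()%classic].
Proof.
split=> [[fC H]|[fC df [f'C H]]]; last first.
  split=> // -[|j] jk t; first by split; [exact: df|exact: f'C].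
  by rewrite (derive1Sn f j) (derive1Sn f j.+1); exact: H.
split=> //; first by move=> t; have [] := H 0%N isT t.
split=> [t|j jk t]; first by have [] := H 0%N isT t.
by rewrite -(derive1Sn f j) -(derive1Sn f j.+1); exact: H.
Qed.

Lemma smooth_bounded_ge0 k C f : smooth_bounded k C f -> 0 <= C.
Proof. by case=> /(_ 0) fC _; exact: le_trans fC. Qed.

Lemma smooth_boundedW k C D f : C <= D -> smooth_bounded k C f ->
  smooth_bounded k D f.
Proof.
move=> CD [fC H]; split=> [t|j jk t]; first exact: le_trans CD.
by have [? fj] := H j jk t; split=> //; exact: le_trans CD.
Qed.

Lemma smooth_bounded_leq k j C f : (k <= j)%N -> smooth_bounded j C f ->
  smooth_bounded k C f.
Proof.
by move=> kj [fC H]; split=> // i ik t; apply: H; exact: leq_trans kj.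
Qed.

Lemma smooth_bounded_ext k C f g : f =1 g -> smooth_bounded k C f ->
  smooth_bounded k C g.
Proof. by move=> /funext ->. Qed.

Lemma smooth_boundedD k C D f g : smooth_bounded k C f -> smooth_bounded k D g ->
  smooth_bounded k (C + D) (fun t => f t + g t).
Proof.
elim: k f g => [|k IH] f g.
  by move=> [fC _] [gD _]; split=> // t; rewrite (le_trans (ler_normD _ _))// lerD.
move=> /smooth_boundedS[fC df f'C] /smooth_boundedS[gD dg g'D].
have dfg t : is_derive t 1 (fun t => f t + g t) (f^`()%classic t + g^`()%classic t).
  apply: (@is_deriveD _ _ _ f g); exact: derivable_is_derive1.
apply/smooth_boundedS; split.
- by move=> t; rewrite (le_trans (ler_normD _ _))// lerD.
- by move=> t; case: (dfg t).
- apply: smooth_bounded_ext (IH _ _ f'C g'D) => t.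
  by rewrite (is_derive1_derive1 (dfg t)).
Qed.

(** Each differentiation replaces a product by two products of the same kind, hence the factor 2 ^+
    k. *)
Lemma smooth_boundedM k C D f g : smooth_bounded k C f -> smooth_bounded k D g ->
  smooth_bounded k (2 ^+ k * (C * D)) (fun t => f t * g t).
Proof.
elim: k C D f g => [|k IH] C D f g.
  move=> [fC _] [gD _]; split=> // t.
  by rewrite expr0 mul1r normrM ler_pM.
move=> fk gk; have C0 := smooth_bounded_ge0 fk; have D0 := smooth_bounded_ge0 gk.
have := fk => /smooth_boundedS[fC df f'C]; have := gk => /smooth_boundedS[gD dg g'D].
have dfg t : is_derive t 1 (fun t => f t * g t)
    (f^`()%classic t * g t + f t * g^`()%classic t).
  have := @is_deriveM _ _ f g t 1 _ _ (derivable_is_derive1 (df t))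
    (derivable_is_derive1 (dg t)).
  move=> /is_derive_eq; apply.
  by rewrite /GRing.scale/= addrC [g t * _]mulrC.
apply/smooth_boundedS; split.
- move=> t; rewrite normrM; apply: (@le_trans _ _ (C * D)).
    exact: ler_pM.
  by rewrite ler_peMl ?mulr_ge0// exprn_ege1// ler1n.
- by move=> t; case: (dfg t).
- have fk' : smooth_bounded k C f by exact: smooth_bounded_leq fk.
  have gk' : smooth_bounded k D g by exact: smooth_bounded_leq gk.
  have -> : 2 ^+ k.+1 * (C * D) = 2 ^+ k * (C * D) + 2 ^+ k * (C * D).
    by rewrite exprS; ring.
  apply: smooth_bounded_ext (smooth_boundedD (IH _ _ _ _ f'C gk') (IH _ _ _ _ fk' g'D)).
  by move=> t; rewrite (is_derive1_derive1 (dfg t)).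
Qed.

Lemma smooth_bounded_cst k c : smooth_bounded k `|c| (cst c : R -> R).
Proof.
elim: k c => [|k IH] c; first by split.
apply/smooth_boundedS; split=> //.
apply: (@smooth_bounded_ext _ _ (cst 0)) => [t|].
  by rewrite derive1_cst.
by apply: smooth_boundedW (IH 0); rewrite normr0.
Qed.

Lemma smooth_boundedN k C f : smooth_bounded k C f ->
  smooth_bounded k C (fun t => - f t).
Proof.
elim: k f => [|k IH] f.
  by move=> [fC _]; split=> // t; rewrite normrN.
move=> /smooth_boundedS[fC df f'C].
have dN t : is_derive t 1 (fun t => - f t) (- f^`()%classic t).
  by apply: (@is_deriveN _ _ _ f); exact: derivable_is_derive1.
apply/smooth_boundedS; split.
- by move=> t; rewrite normrN.
- by move=> t; case: (dN t).
- apply: smooth_bounded_ext (IH _ f'C) => t.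
  by rewrite (is_derive1_derive1 (dN t)).
Qed.

Lemma is_derive_comp_opp f x : derivable f (- x) 1 ->
  is_derive x 1 (fun t => f (- t)) (- f^`()%classic (- x)).
Proof.
move=> df; have := @is_derive1_comp R f -%R x _ _ (derivable_is_derive1 df)
  (is_deriveNid x 1).
by move=> /is_derive_eq; apply; rewrite mulrN1.
Qed.

Lemma smooth_bounded_comp_opp k C f : smooth_bounded k C f ->
  smooth_bounded k C (fun t => f (- t)).
Proof.
elim: k f => [|k IH] f; first by move=> [fC _].
move=> /smooth_boundedS[fC df f'C].
have dN t := is_derive_comp_opp (df (- t)).
apply/smooth_boundedS; split.
- by move=> t; exact: fC.
- by move=> t; case: (dN t).
- apply: smooth_bounded_ext (smooth_boundedN (IH _ f'C)) => t.
  by rewrite (is_derive1_derive1 (dN t)).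
Qed.

(** By induction, [P] is the antiderivative of the polynomial of f' with value f(0) at 0; the
    remainder vanishes at 0, so the mean value theorem gains one power of |x|. Of the coefficients
    only their number and the constant one are recorded, since the moments of the kernel remove the
    others. *)
Lemma taylor_poly k C f : smooth_bounded k C f -> exists p : {poly R},
  [/\ (size p <= k)%N, (0 < k)%N -> p.[0] = f 0 &
      forall x, `|f x - p.[x]| <= C * `|x| ^+ k].
Proof.
elim: k f => [|k IH] f.
  move=> [fC _]; exists 0; split=> //; first by rewrite size_poly0.
  by move=> x; rewrite horner0 subr0 expr0 mulr1.
move=> fk; have C0 := smooth_bounded_ge0 fk.
move: fk => /smooth_boundedS[fC df /IH[p [sp p0 pE]]].
pose P := (f 0)%:P + \poly_(i < k.+1) (if i is j.+1 then p`_j / j.+1%:R else 0).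
have P0 : P.[0] = f 0.
  rewrite hornerD hornerC [X in _ + X]horner_coef0 coef_poly/= addr0//.
have dP : P^`()%R = p.
  apply/polyP => i; rewrite coef_deriv coefD coefC/= add0r coef_poly ltnS.
  case: ltnP => ik; last by rewrite mul0rn nth_default// (leq_trans sp).
  by rewrite -[LHS]mulr_natr divfK// pnatr_eq0.
exists P; split.
- by rewrite (leq_trans (size_polyD _ _))// geq_max size_poly (leq_trans (size_polyC_leq1 _)).
- by move=> _.
pose r x := f x - P.[x].
have dr x : is_derive x 1 r (f^`()%classic x - p.[x]).
  rewrite -dP; apply: (@is_deriveB _ _ _ f (horner P)).
  exact: derivable_is_derive1.
have ddr x : derivable r x 1 by case: (dr x).
move=> x; have [c [cx]] := mean_value ddr x 0; rewrite /r P0 subrr !subr0 => ->.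
rewrite (is_derive1_derive1 (dr c)) normrM exprSr mulrA ler_wpM2r//.
rewrite (le_trans (pE c))// ler_wpM2l// lerXn2r ?nnegrE//.
by move: cx; rewrite !subr0.
Qed.

End smooth_functions.

(** What is used of the kernel, with one constant. The derivatives vanish at the points 1 and -1
    themselves, which removes the boundary terms when integrating by parts. *)
Record kernel_facts (R : realType) (alpha : nat) (H : R -> R) (C : R) : Prop :=
  KernelFacts {
  kf_deriv1 : forall x : R, derivable H^`()%classic x 1 ;
  kf_supp1 : forall x : R, 1 <= `|x| -> H^`()%classic x = 0 ;
  kf_supp2 : forall x : R, 1 <= `|x| -> H^`(2)%classic x = 0 ;
  kf_bound1 : forall x : R, `|H^`()%classic x| <= C ;
  kf_bound2 : forall x : R, `|H^`(2)%classic x| <= C ;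
  kf_lip1 : forall x y : R, `|H^`()%classic x - H^`()%classic y| <= C * `|x - y| ;
  kf_lip2 : forall x y : R, `|H^`(2)%classic x - H^`(2)%classic y| <= C * `|x - y| ;
  kf_mass : \int[lebesgue_measure]_(x in `[(-1)%R, 1%R]%classic) H^`()%classic x = 1 ;
  kf_moment : forall k, (0 < k < alpha)%N -> kernel_moment H k = 0 }.

Section integrals_on_segment.
Context (R : realType).
Implicit Types (f g F : R -> R).
Local Notation leb := (@lebesgue_measure R).
Local Notation I11 := (`[(-1)%R, 1%R]%classic : set R).

Lemma continuous_integrable_segment f (a b : R) : continuous f ->
  leb.-integrable `[a, b] (EFin \o f).
Proof.
move=> cf; apply: continuous_compact_integrable; first exact: segment_compact.
exact: continuous_subspaceT.
Qed.

Lemma Rintegral_derive F f (a b : R) : a < b -> continuous f ->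
  (forall x : R, is_derive x 1 F (f x)) ->
  \int[leb]_(x in `[a, b]) f x = F b - F a.
Proof.
move=> ab cf dF; rewrite /Rintegral (continuous_FTC2 ab (F := F))//.
- exact: continuous_subspaceT.
- have cF : continuous F.
    by apply: derivable_continuous => x; case: (dF x).
  split=> [x _||]; first by case: (dF x).
  + exact/cvg_at_right_filter/cF.
  + exact/cvg_at_left_filter/cF.
- by move=> x _; exact: is_derive1_derive1.
Qed.

Lemma Rintegral_segment_bound f (M : R) : continuous f ->
  (forall x, -1 <= x <= 1 -> `|f x| <= M) ->
  `|\int[leb]_(x in I11) f x| <= 2 * M.
Proof.
move=> cf fM; have mI : measurable (I11 : set (measurableTypeR R)) by exact: measurable_itv.
have cM : continuous (cst M : R -> R) by move=> ?; exact: cvg_cst.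
have fi := @continuous_integrable_segment f (-1) 1 cf.
apply: le_trans; first exact: (le_normr_Rintegral mI fi).
apply: (@le_trans _ _ (\int[leb]_(x in I11) cst M x)).
  apply: le_Rintegral => //.
  - exact: integrable_norm.
  - exact: continuous_integrable_segment.
rewrite Rintegral_cst// (_ : fine _ = 2) 1?mulrC//.
transitivity (fine (lebesgue_measure I11)) => //.
rewrite lebesgue_measure_itv/= lte_fin.
have -> : (-1 < 1 :> R) by lra.
by rewrite /=; lra.
Qed.

Lemma compact_supp_scale (q psi : R -> R) (h c : R) : 0 < h ->
  (forall x, 1 <= `|x| -> psi x = 0) ->
  (fun t => q t * psi ((t + c) / h)) =
  (fun t => q t * psi ((t + c) / h)) \_ `[- h - c, h - c].
Proof.
move=> h0 psi0; apply/funext => t; rewrite patchE; case: ifPn => // /negP tn.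
rewrite psi0 ?mulr0// leNgt; apply/negP => tc; apply: tn.
rewrite inE/= in_itv/=.
move: tc; rewrite normrM [`|h^-1|]gtr0_norm ?invr_gt0// ltr_pdivrMr// mul1r.
by rewrite ltr_norml => /andP[? ?]; apply/andP; split; lra.
Qed.

Lemma continuous_affine_comp (psi : R -> R) (a c : R) : continuous psi ->
  continuous (fun t => psi (a * t + c)).
Proof.
move=> cpsi t; apply: (@continuous_comp _ _ _ (fun t => a * t + c) psi);
  last exact: cpsi.
apply: continuousD; last exact: cvg_cst.
by apply: continuousM; [exact: cvg_cst|exact: cvg_id].
Qed.

Lemma continuous_scale_comp (q psi : R -> R) (h c : R) :
  continuous q -> continuous psi -> continuous (fun t => q t * psi ((t + c) / h)).
Proof.
move=> cq cpsi t; apply: continuousM; first exact: cq.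
have -> : (fun t => psi ((t + c) / h)) = (fun t => psi (h^-1 * t + c / h)).
  by apply/funext => s; rewrite mulrDl [s / h]mulrC.
exact: continuous_affine_comp.
Qed.

Lemma integrable_scale_comp (q psi : R -> R) (h c : R) : 0 < h ->
  continuous q -> continuous psi -> (forall x, 1 <= `|x| -> psi x = 0) ->
  leb.-integrable setT (EFin \o (fun t => q t * psi ((t + c) / h))).
Proof.
move=> h0 cq cpsi psi0; rewrite (compact_supp_scale _ _ h0 psi0).
have := @integrable_mkcond _ _ _ leb `[- h - c, h - c]
  (EFin \o (fun t => q t * psi ((t + c) / h))) (measurable_itv _).
rewrite restrict_EFin => <-.
by apply: continuous_integrable_segment; exact: continuous_scale_comp.
Qed.

(** Substitution t = h x - c, after restricting to the segment where psi((t + c) / h) can be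
    nonzero. *)
Lemma Rintegral_scale_comp (q psi : R -> R) (h c : R) : 0 < h ->
  continuous q -> continuous psi -> (forall x, 1 <= `|x| -> psi x = 0) ->
  \int[leb]_t (q t * psi ((t + c) / h)) =
  h * \int[leb]_(x in I11) (q (h * x - c) * psi x).
Proof.
move=> h0 cq cpsi psi0; rewrite [in LHS](compact_supp_scale _ _ h0 psi0).
rewrite -Rintegral_mkcond -RintegralZl//; last 1 first.
  apply: continuous_integrable_segment => x; apply: continuousM; last exact: cpsi.
  exact: (@continuous_affine_comp q h (- c) cq x).
pose F x := h * x - c.
have dF (x : R) : is_derive x 1 F h.
  have dm : is_derive x 1 (fun y : R => h * y) h.
    have := @is_deriveZ _ _ _ (@id R) h x 1 _ (is_derive_id x 1).
    by move=> /is_derive_eq; apply; rewrite /GRing.scale/= mulr1.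
  have := @is_deriveB _ _ _ (fun y : R => h * y) (cst c) x 1 _ _ dm (is_derive_cst c x 1).
  by move=> /is_derive_eq; apply; rewrite subr0.
have F' : F^`()%classic = cst h by apply/funext => x; exact: is_derive1_derive1.
have cF : continuous F.
  by apply: derivable_continuous => x; case: (dF x).
have -> : - h - c = F (-1) by rewrite /F mulrN1.
have -> : h - c = F 1 by rewrite /F mulr1.
rewrite /Rintegral (@integration_by_substitution_increasing _ F).
- congr fine; apply: eq_integral => x _; congr EFin.
  rewrite F'; transitivity (q (F x) * psi ((F x + c) / h) * h) => //.
  rewrite /F subrK [h * x / h]mulrAC divff ?gt_eqF// mul1r.
  by rewrite mulrC.
- by lra.
- by move=> x y _ _ xy; rewrite /F ltrD2r ltr_pM2l.
- by move=> x _; rewrite F'; exact: cvg_cst.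
- by rewrite F'; exact: is_cvg_cst.
- by rewrite F'; exact: is_cvg_cst.
- split=> [x _||]; first by case: (dF x).
  + exact/cvg_at_right_filter/cF.
  + exact/cvg_at_left_filter/cF.
- by apply: continuous_subspaceT; exact: continuous_scale_comp.
Qed.

End integrals_on_segment.

Lemma lipschitz_continuous (R : realType) (f : R -> R) (K : R) :
  (forall x y : R, `|f x - f y| <= K * `|x - y|) -> continuous f.
Proof.
move=> fK x; apply/cvgrPdist_lt => e e0.
have K1 : 0 < Num.max K 1 by rewrite lt_max ltr01 orbT.
near=> y; apply: (le_lt_trans (fK x y)).
apply: (@le_lt_trans _ _ (Num.max K 1 * `|x - y|)).
  by rewrite ler_wpM2r// le_max lexx.
rewrite mulrC -ltr_pdivlMr//; near: y.
by apply: cvgr_dist_lt => //; rewrite divr_gt0.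
Unshelve. all: by end_near. Qed.

Lemma continuous_funM (R : realType) (f g : R -> R) :
  continuous f -> continuous g -> continuous (fun x => f x * g x).
Proof. by move=> cf cg x; apply: continuousM; [exact: cf|exact: cg]. Qed.

Lemma continuous_funB (R : realType) (f g : R -> R) :
  continuous f -> continuous g -> continuous (fun x => f x - g x).
Proof. by move=> cf cg x; apply: continuousB; [exact: cf|exact: cg]. Qed.

Lemma continuous_funD (R : realType) (f g : R -> R) :
  continuous f -> continuous g -> continuous (fun x => f x + g x).
Proof. by move=> cf cg x; apply: continuousD; [exact: cf|exact: cg]. Qed.

Lemma continuous_cstM (R : realType) (a : R) (f : R -> R) :
  continuous f -> continuous (fun x => a * f x).
Proof.
by apply: (@continuous_funM _ (cst a)) => x; exact: cvg_cst.
Qed.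

Lemma EFin_Rintegral_in d (T : measurableType d) (R : realType)
    (m : {measure set T -> \bar R}) (D : set T) (f : T -> R) :
  measurable D -> m.-integrable D (EFin \o f) ->
  ((\int[m]_(x in D) f x)%:E = \int[m]_(x in D) (f x)%:E)%E.
Proof. by move=> mD fi; rewrite fineK//; exact: integrable_fin_num. Qed.

Section kernel_smoothing.
Context (R : realType) (alpha : nat) (H : R -> R) (C D : R) (q : R -> R).
Hypotheses (alpha2 : (2 <= alpha)%N) (kf : kernel_facts alpha H C)
  (qD : smooth_bounded alpha D q) (C0 : 0 <= C).
Local Notation leb := (@lebesgue_measure R).
Local Notation I11 := (`[(-1)%R, 1%R]%classic : set R).
Local Notation K1 := (H^`()%classic).
Local Notation K2 := (H^`(2)%classic).

Let D0 : 0 <= D. Proof. exact: smooth_bounded_ge0 qD. Qed.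
Let dq (x : R) : derivable q x 1.
Proof. by case: qD => _ /(_ 0%N (ltnW alpha2) x) []. Qed.
Let dq1 (x : R) : derivable q^`()%classic x 1.
Proof. by case: qD => _ /(_ 1%N alpha2 x) []. Qed.
Let q2D (x : R) : `|q^`(2)%classic x| <= D.
Proof. by case: qD => _ /(_ 1%N alpha2 x) []. Qed.
Let cq : continuous q. Proof. exact: derivable_continuous. Qed.
Let cq1 : continuous q^`()%classic. Proof. exact: derivable_continuous. Qed.
Let cK1 : continuous K1. Proof. exact: derivable_continuous (kf_deriv1 kf). Qed.
Let cK2 : continuous K2. Proof. exact: lipschitz_continuous (kf_lip2 kf). Qed.
Let cMK (f : R -> R) (h c : R) : continuous f ->
  continuous (fun x => f (h * x - c) * K1 x).
Proof.
move=> cf; apply: continuous_funM; last exact: cK1.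
exact: (@continuous_affine_comp _ f h (- c) cf).
Qed.

(** Integration by parts moves one derivative from H' to q, and the chain rule yields the factor h
    that lowers the order of the Hessian prefactor. *)
Lemma smoothing_by_parts (h c : R) :
  \int[leb]_(x in I11) (q (h * x - c) * K2 x) =
  - (h * \int[leb]_(x in I11) (q^`()%classic (h * x - c) * K1 x)).
Proof.
pose F x := q (h * x - c) * K1 x.
have dm (x : R) : is_derive x 1 (fun y : R => h * y - c) h.
  have dm : is_derive x 1 (fun y : R => h * y) h.
    have := @is_deriveZ _ _ _ (@id R) h x 1 _ (is_derive_id x 1).
    by move=> /is_derive_eq; apply; rewrite /GRing.scale/= mulr1.
  have := @is_deriveB _ _ _ (fun y : R => h * y) (cst c) x 1 _ _ dm (is_derive_cst c x 1).
  by move=> /is_derive_eq; apply; rewrite subr0.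
pose f x := h * (q^`()%classic (h * x - c) * K1 x) + q (h * x - c) * K2 x.
have dF (x : R) : is_derive x 1 F (f x).
  have dqh : is_derive x 1 (fun x => q (h * x - c)) (q^`()%classic (h * x - c) * h).
    have := @is_derive1_comp _ q (fun y : R => h * y - c) x _ _
      (derivable_is_derive1 (@dq (h * x - c))) (dm x).
    by move=> /is_derive_eq; apply; rewrite mulrC.
  have := @is_deriveM _ _ _ _ x 1 _ _ dqh (derivable_is_derive1 (@kf_deriv1 _ _ _ _ kf x)).
  move=> /is_derive_eq; apply; rewrite /f /GRing.scale/=.
  by rewrite addrC; congr (_ + _); ring.
have c1 : continuous (fun x => q^`()%classic (h * x - c) * K1 x) by exact: cMK.
have c1h : continuous (fun x => h * (q^`()%classic (h * x - c) * K1 x)).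
  exact: continuous_cstM c1.
have c2 : continuous (fun x => q (h * x - c) * K2 x).
  apply: continuous_funM; last exact: cK2.
  exact: (@continuous_affine_comp _ q h (- c) cq).
have cf : continuous f by exact: continuous_funD c1h c2.
have lt11 : (-1 : R) < 1 by lra.
have := Rintegral_derive lt11 cf dF.
rewrite /F !(kf_supp1 kf) ?normrN ?normr1// !mulr0 subrr.
rewrite RintegralD//; [|exact: continuous_integrable_segment..].
rewrite RintegralZl//; last exact: continuous_integrable_segment.
by move=> /eqP; rewrite addrC addr_eq0 => /eqP.
Qed.

(** Scaling and integration by parts turn the first term into minus an average of q'(h x - c) with
    weight H'. As H' has mass 1, the sum with q'(0) is an average of increments of the Lipschitz
    function q' over distances at most h + |c|. *)
Lemma smoothing_hessian (h c : R) : 0 < h ->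
  `|h ^- 2 * \int[leb]_t (q t * K2 ((t + c) / h)) + q^`()%classic 0| <=
  2 * (C * D) * (h + `|c|).
Proof.
move=> h0; rewrite (Rintegral_scale_comp _ h0 cq cK2 (kf_supp2 kf)).
rewrite smoothing_by_parts.
set J := \int[leb]_(x in I11) (_ * _).
have -> : h ^- 2 * (h * - (h * J)) = - J by field; rewrite gt_eqF.
have -> : q^`()%classic 0 = \int[leb]_(x in I11) (q^`()%classic 0 * K1 x).
  rewrite RintegralZl ?(kf_mass kf) ?mulr1//.
  exact: continuous_integrable_segment.
have c0 : continuous (fun x => q^`()%classic 0 * K1 x).
  exact: continuous_cstM cK1.
have c1 : continuous (fun x => q^`()%classic (h * x - c) * K1 x) by exact: cMK.
rewrite addrC -RintegralB//; [|exact: continuous_integrable_segment..].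
have -> : 2 * (C * D) * (h + `|c|) = 2 * (D * (h + `|c|) * C) by ring.
apply: Rintegral_segment_bound.
  exact: continuous_funB c0 c1.
move=> x /andP[x1 x2]; rewrite -mulrBl normrM ler_pM//; last exact: (kf_bound1 kf).
apply: (le_trans (lipschitz_of_derive dq1 q2D _ _)).
rewrite ler_wpM2l// sub0r normrN (le_trans (ler_normB _ _))// lerD2r.
rewrite normrM gtr0_norm// ler_piMr ?(ltW h0)// ler_norml; lra.
Qed.

(** After scaling, the Taylor polynomial of q of degree below alpha integrates to 0 against H',
    which leaves a remainder of order h ^+ alpha. *)
Lemma smoothing_gradient (h : R) : 0 < h -> q 0 = 0 ->
  `|h^-1 * \int[leb]_t (q t * K1 (t / h))| <= 2 * (C * D) * h ^+ alpha.
Proof.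
move=> h0 q0.
have -> : \int[leb]_t (q t * K1 (t / h)) = \int[leb]_t (q t * K1 ((t + 0) / h)).
  by apply: eq_Rintegral => t _; rewrite addr0.
rewrite (Rintegral_scale_comp _ h0 cq cK1 (kf_supp1 kf)).
rewrite mulKf ?gt_eqF//.
have [p [sp p0 pE]] := taylor_poly qD.
have cp : continuous (fun x => p.[h * x] * K1 x).
  apply: continuous_funM; last exact: cK1.
  have := @continuous_affine_comp _ (horner p) h 0 (@continuous_horner _ p).
  by under [X in continuous X -> _]eq_fun do rewrite addr0.
have cqK : continuous (fun x => q (h * x - 0) * K1 x) by exact: cMK.
have pint : \int[leb]_(x in I11) (p.[h * x] * K1 x) = 0.
  have cX i : continuous (fun x : R => x ^+ i * K1 x).
    by apply: continuous_funM; [exact: exprn_continuous|exact: cK1].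
  have ciX i : continuous (fun x : R => (p`_i * h ^+ i) * (x ^+ i * K1 x)).
    exact: (@continuous_cstM _ _ _ (cX i)).
  rewrite /Rintegral.
  under eq_integral => x _.
    rewrite (horner_coef_wide _ sp) mulr_suml -sumEFin.
    under eq_bigr do rewrite exprMn mulrA -mulrA.
    over.
  rewrite integral_sum//; last first.
    by move=> i; exact: continuous_integrable_segment.
  rewrite big1// => i _.
  rewrite -EFin_Rintegral_in//; last exact: continuous_integrable_segment.
  rewrite RintegralZl//; last exact: continuous_integrable_segment.
  (* The mass of H' is 1, so the constant coefficient has to vanish by itself, thanks to q(0) = 0;
     the others meet vanishing moments. *)
  case: i => [[|i] ilt] /=.
    by rewrite -horner_coef0 p0 ?q0 ?mul0r// ltnW.
  have := kf_moment kf (k := i.+1) ilt.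
  by rewrite /kernel_moment => ->; rewrite mulr0.
set J := \int[leb]_(x in I11) (q (h * x - 0) * K1 x).
have -> : J = J - \int[leb]_(x in I11) (p.[h * x] * K1 x) by rewrite pint subr0.
rewrite /J -RintegralB//; [|exact: continuous_integrable_segment..].
have -> : 2 * (C * D) * h ^+ alpha = 2 * (D * h ^+ alpha * C) by ring.
apply: Rintegral_segment_bound.
  exact: continuous_funB cqK cp.
move=> x x1; rewrite subr0 -mulrBl normrM ler_pM//; last exact: (kf_bound1 kf).
rewrite (le_trans (pE _))// ler_wpM2l// lerXn2r ?nnegrE ?(ltW h0)//.
by rewrite normrM gtr0_norm// ler_piMr ?(ltW h0)// ler_norml.
Qed.

Lemma smoothing_newton_integrable (h c : R) : 0 < h ->
  leb.-integrable setT (EFin \o (fun t => q t * (K2 ((t + c) / h) * c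
    - h * K1 ((t + c) / h) + h * K1 (t / h)))).
Proof.
move=> h0.
have j1 := integrable_scale_comp c h0 cq cK2 (kf_supp2 kf).
have j2 := integrable_scale_comp c h0 cq cK1 (kf_supp1 kf).
have j3 := integrable_scale_comp 0 h0 cq cK1 (kf_supp1 kf).
have i1 := @integrableZl _ _ _ leb _ measurableT c _ j1.
have i2 := @integrableZl _ _ _ leb _ measurableT h _ j2.
have i3 := @integrableZl _ _ _ leb _ measurableT h _ j3.
have := integrableD measurableT (integrableB measurableT i1 i2) i3.
apply: eq_integrable => // t _ /=.
rewrite -!EFinM -EFinB -EFinD addr0; congr EFin; ring.
Qed.

(** All powers of h cancel after scaling and integration by parts: what remains is the second-order
    Taylor remainder of q between h x - c and h x, averaged with weight H'. Hence a bound in c^2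
    alone. *)
Lemma smoothing_newton (h c : R) : 0 < h ->
  `|h ^- 2 * \int[leb]_t (q t * (K2 ((t + c) / h) * c - h * K1 ((t + c) / h)
                                 + h * K1 (t / h)))| <= 2 * (C * D) * c ^+ 2.
Proof.
move=> h0.
pose f1 t := c * (q t * K2 ((t + c) / h)).
pose f2 t := h * (q t * K1 ((t + c) / h)).
pose f3 t := h * (q t * K1 ((t + 0) / h)).
have j1 := integrable_scale_comp c h0 cq cK2 (kf_supp2 kf).
have i1 : leb.-integrable setT (EFin \o f1).
  exact: (@integrableZl _ _ _ leb _ measurableT c _ j1).
have j2 := integrable_scale_comp c h0 cq cK1 (kf_supp1 kf).
have i2 : leb.-integrable setT (EFin \o f2).
  exact: (@integrableZl _ _ _ leb _ measurableT h _ j2).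
have j3 := integrable_scale_comp 0 h0 cq cK1 (kf_supp1 kf).
have i3 : leb.-integrable setT (EFin \o f3).
  exact: (@integrableZl _ _ _ leb _ measurableT h _ j3).
have -> : \int[leb]_t (q t * (K2 ((t + c) / h) * c - h * K1 ((t + c) / h)
    + h * K1 (t / h))) = \int[leb]_t f1 t - \int[leb]_t f2 t + \int[leb]_t f3 t.
  transitivity (\int[leb]_t (f1 t - f2 t + f3 t)).
    by apply: eq_Rintegral => t _; rewrite /f1 /f2 /f3 addr0; ring.
  rewrite (RintegralD measurableT (integrableB measurableT i1 i2) i3).
  by rewrite (RintegralB measurableT i1 i2).
rewrite (RintegralZl _ measurableT j1) (RintegralZl _ measurableT j2).
rewrite (RintegralZl _ measurableT j3).
rewrite !(Rintegral_scale_comp _ h0 cq cK1 (kf_supp1 kf)).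
rewrite (Rintegral_scale_comp _ h0 cq cK2 (kf_supp2 kf)) smoothing_by_parts.
have c1 : continuous (fun x => q^`()%classic (h * x - c) * K1 x) by exact: cMK.
have c1c : continuous (fun x => c * (q^`()%classic (h * x - c) * K1 x)).
  exact: continuous_cstM c1.
have c2 : continuous (fun x => q (h * x - c) * K1 x) by exact: cMK.
have c3 : continuous (fun x => q (h * x - 0) * K1 x) by exact: cMK.
set J1 := \int[leb]_(x in I11) (q^`()%classic (h * x - c) * K1 x).
set J2 := \int[leb]_(x in I11) (q (h * x - c) * K1 x).
set J3 := \int[leb]_(x in I11) (q (h * x - 0) * K1 x).
have -> : h ^- 2 * (c * (h * - (h * J1)) - h * (h * J2) + h * (h * J3)) =
    J3 - J2 - c * J1 by field; rewrite gt_eqF.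
have -> : J3 - J2 - c * J1 = \int[leb]_(x in I11) (q (h * x - 0) * K1 x -
    q (h * x - c) * K1 x - c * (q^`()%classic (h * x - c) * K1 x)).
  have mI : measurable (I11 : set (measurableTypeR R)) by exact: measurable_itv.
  have e1 := @continuous_integrable_segment R _ (-1) 1 c1.
  have e1c := @continuous_integrable_segment R _ (-1) 1 c1c.
  have e2 := @continuous_integrable_segment R _ (-1) 1 c2.
  have e3 := @continuous_integrable_segment R _ (-1) 1 c3.
  rewrite (RintegralB mI (integrableB mI e3 e2) e1c) (RintegralB mI e3 e2).
  by rewrite (RintegralZl _ mI e1).
have -> : 2 * (C * D) * c ^+ 2 = 2 * (D * c ^+ 2 * C) by ring.
apply: Rintegral_segment_bound.
  apply: continuous_funB; last exact: c1c.
  exact: continuous_funB c3 c2.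
move=> x _.
rewrite (_ : _ - _ - _ = (q (h * x - 0) - q (h * x - c) -
  q^`()%classic (h * x - c) * ((h * x - 0) - (h * x - c))) * K1 x); last by ring.
rewrite normrM ler_pM//; last exact: (kf_bound1 kf).
apply: (le_trans (taylor2 dq dq1 q2D _ _)).
by rewrite (_ : h * x - 0 - (h * x - c) = c)//; ring.
Qed.

End kernel_smoothing.

Lemma eq_of_dist_le (R : realType) (K a b : R) :
  (forall e, 0 < e -> `|a - b| <= K * e) -> a = b.
Proof.
move=> H; apply/eqP; rewrite -subr_eq0 -normr_le0; apply/ler_addgt0Pr => e e0.
have K1 : 0 < Num.max K 1 by rewrite lt_max ltr01 orbT.
have := H (e / Num.max K 1) (divr_gt0 e0 K1); rewrite add0r => /le_trans; apply.
by rewrite mulrA ler_pdivrMr// mulrC ler_pM2l// le_max lexx.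
Qed.

Lemma derive1_locally_cst (R : realType) (f : R -> R) (c x : R) :
  (\forall y \near x, f y = c) -> f^`()%classic x = 0.
Proof.
move=> H; rewrite derive1E (@near_eq_derive _ _ _ f (cst c))//.
by rewrite -derive1E derive1_cst.
Qed.

Lemma derive1_zero_outside (R : realType) (f : R -> R) (a b : R) :
  (forall x, 1 < x -> f x = a) -> (forall x, x < -1 -> f x = b) ->
  forall x, 1 < `|x| -> f^`()%classic x = 0.
Proof.
move=> fa fb x; rewrite ltr_normr => /orP[x1|x1].
  apply: (@derive1_locally_cst _ _ a); near=> y; apply: fa; near: y.
  exact: lt_nbhsr.
apply: (@derive1_locally_cst _ _ b); near=> y; apply: fb; near: y.
by apply: lt_nbhsl; lra.
Unshelve. all: by end_near. Qed.

(** The assumptions on the kernel concern |x| > 1 only; continuity carries the values to the two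
    endpoints. *)
Lemma lipschitz_zero_outside (R : realType) (f : R -> R) (K a b : R) :
  (forall x y, `|f x - f y| <= K * `|x - y|) ->
  (forall x, 1 < x -> f x = a) -> (forall x, x < -1 -> f x = b) ->
  f 1 = a /\ f (-1) = b.
Proof.
move=> fK fa fb; split; apply: (@eq_of_dist_le _ K) => e e0.
  have : f (1 + e) = a by apply: fa; lra.
  move=> <-; rewrite (le_trans (fK _ _))//.
  by rewrite opprD addrA subrr sub0r normrN gtr0_norm.
have : f (-1 - e) = b by apply: fb; lra.
move=> <-; rewrite (le_trans (fK _ _))//.
by rewrite (_ : -1 - (-1 - e) = e) ?gtr0_norm//; ring.
Qed.

Lemma kernel_cond_facts (R : realType) (alpha : nat) (H : R -> R) :
  kernel_cond alpha H -> exists2 C : R, 1 <= C & kernel_facts alpha H C.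
Proof.
case=> alpha2 [H1 H0] [_ mom] _ [dH ddH [C0 HC0] [K HK]].
have C00 : 0 <= C0 by apply: le_trans (HC0 0).
have lip1 x y : `|H^`()%classic x - H^`()%classic y| <= C0 * `|x - y|.
  exact: lipschitz_of_derive.
have z1 : forall x, 1 < `|x| -> H^`()%classic x = 0 := derive1_zero_outside H1 H0.
have z1r x : 1 < x -> H^`()%classic x = 0.
  by move=> x1; apply: z1; rewrite ltr_normr x1.
have z1l x : x < -1 -> H^`()%classic x = 0.
  by move=> x1; apply: z1; rewrite ltr_normr; apply/orP; right; clear -x1; lra.
have [e1 eN1] := lipschitz_zero_outside lip1 z1r z1l.
have z2 : forall x, 1 < `|x| -> H^`(2)%classic x = 0.
  exact: (derive1_zero_outside z1r z1l).
have z2r x : 1 < x -> H^`(2)%classic x = 0.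
  by move=> x1; apply: z2; rewrite ltr_normr x1.
have z2l x : x < -1 -> H^`(2)%classic x = 0.
  by move=> x1; apply: z2; rewrite ltr_normr; apply/orP; right; clear -x1; lra.
have [g1 gN1] := lipschitz_zero_outside HK z2r z2l.
have closed (f : R -> R) : (forall x, 1 < `|x| -> f x = 0) -> f 1 = 0 ->
    f (-1) = 0 -> forall x, 1 <= `|x| -> f x = 0.
  move=> fz f1 fN1 x; rewrite le_eqVlt => /orP[/eqP x1|]; last exact: fz.
  case: (ger0P x) x1 => [_ <-//|_ x1].
  by rewrite -[x]opprK -x1.
(* H' vanishes at 2, which is at distance at most 3 from each point of [-1, 1]. *)
have bd1 x : `|H^`()%classic x| <= 3 * C0.
  have [x1|x1] := ltP 1 `|x|; first by rewrite z1// normr0 mulr_ge0.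
  have two : (1 : R) < 2 by rewrite ltr1n.
  have := lip1 x 2; rewrite (z1r _ two) subr0.
  move=> /le_trans; apply; rewrite mulrC ler_wpM2r//.
  by clear -x1; move: x1; rewrite !ler_norml => /andP[? ?]; apply/andP; split; lra.
have lip0 x y : `|H x - H y| <= (3 * C0) * `|x - y|.
  exact: lipschitz_of_derive.
have [h1 hN1] := lipschitz_zero_outside lip0 H1 H0.
have CC : C0 <= 1 + 3 * C0 + `|K| by clear -C00; have := normr_ge0 K; lra.
exists (1 + 3 * C0 + `|K|); first by clear -C00; have := normr_ge0 K; lra.
split.
- exact: ddH.
- exact: closed.
- exact: closed.
- by move=> x; apply: (le_trans (bd1 x)); clear -C00; have := normr_ge0 K; lra.
- by move=> x; apply: (le_trans (HC0 x)).
- by move=> x y; apply: (le_trans (lip1 x y)); rewrite ler_wpM2r.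
- move=> x y; apply: (le_trans (HK x y)); rewrite ler_wpM2r//.
  by clear -C00; have := ler_norm K; lra.
(* The mass of H' is H(1) - H(-1) = 1 by the fundamental theorem of calculus. *)
- have cK1 : continuous H^`()%classic by exact: derivable_continuous.
  have lt11 : (-1 : R) < 1 by clear; lra.
  have dH1 (x : R) : is_derive x 1 H (H^`()%classic x) by exact: derivable_is_derive1.
  by rewrite (Rintegral_derive lt11 cK1 dH1) h1 hN1 subr0.
- exact: mom.
Qed.

(** * Conditional laws and independence *)

Section kernel_fst.
Context d d' d'' (E : measurableType d) (F : measurableType d')
  (G : measurableType d'') (R : realType) (k : R.-pker E ~> G).

(** Under conditional independence, this is the conditional law of [U1] given the pair [(V, U2)]. *)
Definition kernel_fst (q : E * F) : {measure set G -> \bar R} := k q.1.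

Let measurable_kernel_fst U : measurable U ->
  measurable_fun setT (kernel_fst ^~ U).
Proof.
move=> mU; apply: (@measurableT_comp _ _ _ _ _ _ (k ^~ U) _ fst) => //.
exact: measurable_kernel.
Qed.

HB.instance Definition _ := isKernel.Build _ _ _ _ _ kernel_fst
  measurable_kernel_fst.

Let kernel_fst_prob q : kernel_fst q setT = 1%E.
Proof. exact: prob_kernel. Qed.

HB.instance Definition _ := Kernel_isProbability.Build _ _ _ _ _ kernel_fst
  kernel_fst_prob.

End kernel_fst.

Section conditional_laws.
Context d dE dG (T : measurableType d) (E : measurableType dE)
  (G : measurableType dG) (R : realType) (P : probability T R).
Variables (V : T -> E).
Hypothesis mV : measurable_fun setT V.

Let int_cst1 A : measurable A -> (\int[P]_(x in A) (cst 1 x)%:E = P A)%E.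
Proof. by move=> mA; rewrite (integral_cst _ mA 1%E) mul1e. Qed.

Let rectangles d1 d2 (T1 : measurableType d1) (T2 : measurableType d2) :=
  [set A `*` B | A in @measurable _ T1 & B in @measurable _ T2].

Let rectanglesI d1 d2 (T1 : measurableType d1) (T2 : measurableType d2) :
  setI_closed (@rectangles _ _ T1 T2).
Proof.
move=> _ _ [X1 mX1 [X2 mX2 <-]] [Y1 mY1 [Y2 mY2 <-]].
exists (X1 `&` Y1); first exact: measurableI.
by exists (X2 `&` Y2); [exact: measurableI|rewrite setXI].
Qed.

Let rectanglesT d1 d2 (T1 : measurableType d1) (T2 : measurableType d2) :
  @rectangles _ _ T1 T2 setT.
Proof. by exists setT => //; exists setT => //; rewrite setXTT. Qed.

Let m2 := (P \x (@lebesgue_measure R))%E.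
(** The Lebesgue measure lives on [measurableTypeR R]; this identity map transports its points to
    the measurable space [R] of the random variables. *)
Let fromleb (t : measurableTypeR R) : R := t.
Let mfromleb : measurable_fun setT fromleb.
Proof. by move=> _ B mB; rewrite setTI. Qed.

Section density.
Variables (U : T -> R) (f : E -> R -> R).
Hypotheses (mU : measurable_fun setT U) (Uf : cond_density P V U f).

Let mf : measurable_fun setT (fun q : E * R => f q.1 q.2).
Proof. by case: Uf. Qed.
Let f0 v t : 0 <= f v t. Proof. by case: Uf. Qed.

Let W2 (q : T * measurableTypeR R) : E * R := (V q.1, fromleb q.2).
Let mW2 : measurable_fun setT W2.
Proof.
apply: measurable_fun_pair; first exact: measurableT_comp.
exact: measurableT_comp.
Qed.

(** The law of [(V, U)] is the image of P times Lebesgue, weighted by the density, under [W2]: on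
    rectangles this is the definition of a conditional density. Tonelli's theorem then iterates the
    integral. *)
Lemma cond_density_integral (g : E * R -> \bar R) : measurable_fun setT g ->
  (forall q, (0 <= g q)%E) ->
  (\int[P]_w g (V w, U w) =
   \int[P]_w \int[lebesgue_measure]_t ((f (V w) t)%:E * g (V w, t)))%E.
Proof.
move=> mg g0.
pose Y2 (q : T * measurableTypeR R) := f (V q.1) (fromleb q.2).
have mY2 : measurable_fun setT Y2 by exact: (measurableT_comp mf mW2).
have mEY2 : measurable_fun setT (EFin \o Y2) by exact/measurable_EFinP.
have mVU : measurable_fun setT (fun w => (V w, U w)) by exact: measurable_fun_pair.
have lawE : forall B, measurable B ->
    (\int[P]_(w in (fun w => (V w, U w)) @^-1` B) (cst 1 w)%:E =
     \int[m2]_(q in W2 @^-1` B) (Y2 q)%:E)%E.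
  apply: (@eq_weighted_law_pi_system _ _ _ _ _ (E * R)%type R P m2
    (cst 1) Y2 _ W2 _ mY2 _ _ mVU mW2 (@rectangles _ _ E R)) => //.
  - by move=> q; exact: f0.
  - exact: measurable_prod_measurableType.
  - exact: rectanglesI.
  - by rewrite int_cst1// (le_lt_trans (probability_le1 _ _))// ltry.
  - move=> _ [B mB [A mA <-]].
    have mVB : measurable (V @^-1` B) by rewrite -[X in measurable X]setTI; exact: mV.
    have mUA : measurable (U @^-1` A) by rewrite -[X in measurable X]setTI; exact: mU.
    transitivity (P (U @^-1` A `&` V @^-1` B)).
      rewrite -int_cst1; last exact: measurableI.
      by congr (integral _ _ _); apply/seteqP; split => w /= [].
    have [_ _ /(_ A mA) [_ _ ->//]] := Uf.
    rewrite [RHS]integral_mkcond [LHS]integral_mkcond.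
    rewrite fubini_tonelli1.
    + apply: eq_integral => w _; rewrite /fubini_F patchE.
      case: ifPn => wB.
        rewrite [LHS]integral_mkcond; apply: eq_integral => t _.
        rewrite !patchE.
        have -> : ((w, t) \in W2 @^-1` (B `*` A)) = (t \in A).
          apply/idP/idP => /set_mem H; apply/mem_set; first by case: H.
          by split => //; exact: (set_mem wB).
        by [].
      rewrite integral0_eq// => t _; rewrite patchE ifF//.
      by apply: contraNF wB => /set_mem[? _]; exact/mem_set.
    + have mWBA : measurable (W2 @^-1` (B `*` A)).
        have mBA : measurable (B `*` A) by exact: measurableX.
        by have := mW2 measurableT mBA; rewrite setTI.
      exact: ((measurable_restrictT _ mWBA).1 (measurable_funTS mEY2)).
    + by move=> q; rewrite patchE; case: ifPn => // _; rewrite lee_fin f0.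
have := @ge0_eq_integral_law _ _ _ _ _ (E * R)%type R P m2 (cst 1) Y2
  (fun w => (V w, U w)) W2 _ mY2 _ _ mVU mW2 lawE g mg g0.
under eq_integral do rewrite mul1e.
move=> -> //; last by move=> q; exact: f0.
rewrite fubini_tonelli1//.
- apply: (emeasurable_funM mEY2).
  exact: measurableT_comp.
- by move=> q; rewrite mule_ge0// lee_fin f0.
Qed.

End density.
Section independence.
Variables (U1 U2 : T -> R) (k : R.-pker E ~> R) (f : E -> R -> R).
Hypotheses (mU1 : measurable_fun setT U1) (mU2 : measurable_fun setT U2).
Hypotheses (U1k : cond_dist P V U1 k) (U2f : cond_density P V U2 f).
Hypothesis indep : cond_indep P V U1 U2.

Let W w := (V w, U2 w).
Let mW : measurable_fun setT W. Proof. exact: measurable_fun_pair. Qed.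

Let fin_k v A : measurable A -> k v A \is a fin_num.
Proof.
move=> mA; rewrite ge0_fin_numE// (@le_lt_trans _ _ 1%E) ?ltry//.
rewrite -(@prob_kernel _ _ _ _ _ k v).
by apply: le_measure; rewrite ?inE.
Qed.

Let mkV A : measurable A -> measurable_fun setT (fun w => k (V w) A).
Proof.
move=> mA; apply: (@measurableT_comp _ _ _ _ _ _ (k ^~ A)) => //.
exact: measurable_kernel.
Qed.

Let f0 v t : 0 <= f v t. Proof. by case: U2f. Qed.

(** As functions of [S] both sides are finite weighted laws of [(V, U2)], so [S] may be a rectangle,
    and there conditional independence applies. *)
Lemma cond_indep_rectangle (A : set R) (S : set (E * R)) :
  measurable A -> measurable S ->
  P (U1 @^-1` A `&` W @^-1` S) = (\int[P]_(w in W @^-1` S) k (V w) A)%E.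
Proof.
move=> mA mS.
have mU1A : measurable (U1 @^-1` A) by rewrite -[X in measurable X]setTI; exact: mU1.
pose Y1 w : R := \1_(U1 @^-1` A) w.
pose Y2 w : R := fine (k (V w) A).
have mY1 : measurable_fun setT Y1 by exact: measurable_indic.
have mY2 : measurable_fun setT Y2 by apply: measurableT_comp => //; exact: mkV.
have Y10 w : 0 <= Y1 w by rewrite /Y1 indicE.
have Y20 w : 0 <= Y2 w by exact: fine_ge0.
have intY1 D : measurable D -> (\int[P]_(w in D) (Y1 w)%:E = P (U1 @^-1` A `&` D))%E.
  by move=> mD; rewrite integral_indic.
have intY2 D : (\int[P]_(w in D) (Y2 w)%:E = \int[P]_(w in D) k (V w) A)%E.
  by apply: eq_integral => w _; rewrite fineK//; exact: fin_k.
have mWS : measurable (W @^-1` S) by rewrite -[X in measurable X]setTI; exact: mW.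
rewrite -intY1// -intY2.
apply: (@eq_weighted_law_pi_system _ _ _ _ _ (E * R)%type R P P
  Y1 Y2 W W mY1 mY2 Y10 Y20 mW mW (@rectangles _ _ E R)) => //.
- exact: measurable_prod_measurableType.
- exact: rectanglesI.
- by rewrite intY1// setIT (le_lt_trans (probability_le1 _ _))// ltry.
move=> _ [B mB [C mC <-]].
have mVB : measurable (V @^-1` B) by rewrite -[X in measurable X]setTI; exact: mV.
have mUC : measurable (U2 @^-1` C) by rewrite -[X in measurable X]setTI; exact: mU2.
have WE : W @^-1` (B `*` C) = U2 @^-1` C `&` V @^-1` B.
  by apply/seteqP; split => w /= [].
rewrite WE intY1 ?intY2; last exact: measurableI.
rewrite setIA.
have [_ _ ->//] := indep mA mC (U1k mA) (let: And3 _ _ H := U2f in H C mC).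
(* Integrating [g] through the density of [U2] turns the factor P(U2 in C | V) back into the
   indicator of this event. *)
pose g (q : E * R) := ((\1_B q.1 * \1_C q.2)%:E * k q.1 A)%E.
have mg : measurable_fun setT g.
  apply: emeasurable_funM.
    apply/measurable_EFinP; apply: measurable_funM.
      by apply: measurableT_comp => //; exact: measurable_indic.
    by apply: measurableT_comp => //; exact: measurable_indic.
  apply: (@measurableT_comp _ _ _ _ _ _ (k ^~ A)) => //.
  exact: measurable_kernel.
have g0 q : (0 <= g q)%E.
  by rewrite mule_ge0// lee_fin mulr_ge0// indicE.
have mfv v : measurable_fun setT (fun t : measurableTypeR R => f v t).
  have [mf _ _] := U2f.
  have mp : measurable_fun setT (fun t : measurableTypeR R => (v, fromleb t)).
    by apply: measurable_fun_pair => //; exact: mfromleb.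
  exact: (measurableT_comp mf mp).
transitivity (\int[P]_w g (W w))%E; last first.
  rewrite [RHS]integral_mkcond; apply: eq_integral => w _.
  rewrite /g patchE /W /= !indicE; case: ifPn => [/set_mem[Cw Bw]|wn].
    by rewrite mem_set// mem_set// mulr1 mul1e.
  have [Bw|Bw] := pselect (B (V w)); last by rewrite [V w \in B]memNset// mul0r mul0e.
  have [Cw|Cw] := pselect (C (U2 w)).
    by exfalso; move/negP: wn; apply; apply/mem_set.
  by rewrite [U2 w \in C]memNset// mulr0 mul0e.
rewrite /W (cond_density_integral mU2 U2f mg g0).
rewrite integral_mkcond; apply: eq_integral => w _.
rewrite patchE.
have -> : (w \in V @^-1` B) = (V w \in B).
  by apply/idP/idP => /set_mem H; exact/mem_set.
case: ifPn => wB.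
  rewrite integral_mkcond -ge0_integralZl//; last 2 first.
  - have mC' : measurable (C : set (measurableTypeR R)) by exact: mC.
    apply: (measurable_restrictT _ mC').1; apply: measurable_funTS.
    apply: (@measurableT_comp _ _ _ _ _ _ (@EFin R)) => //; exact: mfv.
  - by move=> t _; rewrite patchE; case: ifPn => // _; rewrite lee_fin f0.
  apply: eq_integral => t _; rewrite patchE /g /= !indicE wB mul1r.
  by case: ifPn => _; rewrite ?mul1e ?mul0e ?mule0// muleC.
rewrite integral0_eq// => t _.
by rewrite /g /= !indicE (negbTE wB) mul0r mul0e mule0.
Qed.

Let K := kernel_fst (F := R) k.

(** The law of [((V, U2), U1)] when [U1] is drawn from [k V] regardless of [U2];
    [cond_indep_section] identifies it with the true law, the two being equal on rectangles. *)
Definition mixture_law (D : set (E * R * R)) :=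
  (\int[P]_w K (W w) (xsection D (W w)))%E.

Lemma measurable_kernel_section (D : set (E * R * R)) : measurable D ->
  measurable_fun setT (fun q : E * R => k q.1 (xsection D q)).
Proof.
move=> mD.
apply: (@measurable_fun_xsection_finite_kernel _ _ _ _ R (kernel_fst (F := R) k) D).
by rewrite inE.
Qed.

Let mixture0 : mixture_law set0 = 0%E.
Proof.
by rewrite /mixture_law integral0_eq// => w _; rewrite xsection0 measure0.
Qed.

Let mixture_ge0 D : (0 <= mixture_law D)%E.
Proof. exact: integral_ge0. Qed.

Let mixture_additive : semi_sigma_additive mixture_law.
Proof.
move=> F mF tF mUF; rewrite /mixture_law.
rewrite (_ : (\int[P]_w K (W w) (xsection (\bigcup_n F n) (W w)))%E =
    (\sum_(0 <= n <oo) \int[P]_w K (W w) (xsection (F n) (W w)))%E); last first.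
  rewrite -integral_nneseries//; last first.
    by move=> n; exact: (measurableT_comp (measurable_kernel_section (mF n)) mW).
  apply: eq_integral => w _; rewrite xsection_bigcup.
  rewrite measure_bigcup//=; last exact: trivIset_xsection.
    by apply: eq_eseriesl => n; rewrite in_setT.
  by move=> n _; exact: measurable_xsection.
apply: is_cvg_ereal_nneg_natsum_cond => n _ _.
exact: integral_ge0.
Qed.

HB.instance Definition _ := isMeasure.Build _ _ _ mixture_law
  mixture0 mixture_ge0 mixture_additive.

Lemma cond_indep_section (D : set (E * R * R)) : measurable D ->
  P ((fun w => (W w, U1 w)) @^-1` D) =
  (\int[P]_w k (V w) (xsection D (W w)))%E.
Proof.
move=> mD.
have mWU : measurable_fun setT (fun w => (W w, U1 w)) by exact: measurable_fun_pair.
have := @measure_unique _ R (E * R * R)%type (@rectangles _ _ (E * R)%type R) (fun=> setT) _ _ _ _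
   (pushforward P (fun w => (W w, U1 w))) mixture_law _ _ _ mD.
apply.
- exact: measurable_prod_measurableType.
- exact: rectanglesI.
- by move=> _; exact: rectanglesT.
- by apply/seteqP; split => // x _; exists 0%N.
- move=> _ [S mS [A mA <-]]; rewrite /pushforward /= /mixture_law.
  transitivity (P (U1 @^-1` A `&` W @^-1` S)).
    by congr (P _); apply/seteqP; split => w /= [].
  rewrite cond_indep_rectangle// integral_mkcond; apply: eq_integral => w _.
  rewrite patchE; case: ifPn => wS; first by rewrite in_xsectionX.
  by rewrite notin_xsectionX// measure0.
- move=> _; have PT : (P setT < +oo)%E by rewrite (le_lt_trans (probability_le1 _ _))// ltry.
  exact: PT.
Qed.

(** For [g] the indicator of [B] this is [cond_indep_section] on the part of [D] above [B]; equality
    of weighted laws extends it to functions. With [D] the event Y = -1, it replaces the sign of the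
    response by a conditional probability. *)
Lemma cond_indep_integral (D : set (E * R * R)) (g : E * R -> \bar R) :
  measurable D -> measurable_fun setT g -> (forall q, (0 <= g q)%E) ->
  (\int[P]_w ((\1_D (W w, U1 w) : R)%:E * g (W w)) =
   \int[P]_w (k (V w) (xsection D (W w)) * g (W w)))%E.
Proof.
move=> mD mg g0.
have mWU : measurable_fun setT (fun w => (W w, U1 w)) by exact: measurable_fun_pair.
pose Y1 w : R := \1_D (W w, U1 w).
pose Y2 w : R := fine (k (V w) (xsection D (W w))).
have mks : measurable_fun setT (fun w => k (V w) (xsection D (W w))).
  exact: (measurableT_comp (measurable_kernel_section mD) mW).
have fk w : k (V w) (xsection D (W w)) \is a fin_num.
  by apply: fin_k; exact: measurable_xsection.
have mY1 : measurable_fun setT Y1.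
  have mi : measurable_fun setT (\1_D : E * R * R -> R) by exact: measurable_indic.
  exact: (measurableT_comp mi mWU).
have mY2 : measurable_fun setT Y2 by exact: measurableT_comp.
transitivity (\int[P]_w ((Y2 w)%:E * g (W w)))%E; last first.
  by apply: eq_integral => w _; rewrite fineK.
apply: (@ge0_eq_integral_law _ _ _ _ _ (E * R)%type R P P Y1 Y2 W W) => //.
- by move=> w; exact: fine_ge0.
move=> B mB.
have mWB : measurable (W @^-1` B) by rewrite -[X in measurable X]setTI; exact: mW.
have mDB : measurable (D `&` (B `*` setT)).
  by apply: measurableI => //; exact: measurableX.
have mDW : measurable ((fun w => (W w, U1 w)) @^-1` D).
  by rewrite -[X in measurable X]setTI; exact: mWU.
rewrite (_ : (\int[P]_(w in W @^-1` B) (Y1 w)%:E)%E =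
    P ((fun w => (W w, U1 w)) @^-1` (D `&` (B `*` setT)))); last first.
  rewrite (_ : (fun w => (Y1 w)%:E) =
    (fun w => (\1_((fun w => (W w, U1 w)) @^-1` D) w)%:E)); last first.
    by apply/funext => w; rewrite /Y1 !indicE.
  rewrite integral_indic//; congr (P _); apply/seteqP.
  by split => w /=; [move=> [? ?] | move=> [? [? ?]]].
rewrite cond_indep_section// [RHS]integral_mkcond; apply: eq_integral => w _.
rewrite patchE xsectionI; case: ifPn => wB.
  by rewrite in_xsectionX// setIT fineK.
by rewrite notin_xsectionX// setI0 measure0.
Qed.

End independence.
End conditional_laws.

(** * Euclidean vectors *)

Section euclidean_vectors.
Context (R : realType) (p : nat).
Implicit Types (u v w : 'cV[R]_p) (A : 'M[R]_p).

Lemma dotvC u v : dotv u v = dotv v u.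
Proof. by apply: eq_bigr => i _; rewrite mulrC. Qed.

Lemma dotvDl u v w : dotv (u + v) w = dotv u w + dotv v w.
Proof. by rewrite /dotv -big_split; apply: eq_bigr => i _; rewrite mxE mulrDl. Qed.

Lemma dotvDr u v w : dotv w (u + v) = dotv w u + dotv w v.
Proof. by rewrite dotvC dotvDl !(dotvC _ w). Qed.

Lemma dotvZl a u v : dotv (a *: u) v = a * dotv u v.
Proof. by rewrite /dotv mulr_sumr; apply: eq_bigr => i _; rewrite mxE mulrA. Qed.

Lemma dotvZr a u v : dotv u (a *: v) = a * dotv u v.
Proof. by rewrite dotvC dotvZl dotvC. Qed.

Lemma dotvNl u v : dotv (- u) v = - dotv u v.
Proof. by rewrite -scaleN1r dotvZl mulN1r. Qed.

Lemma dotvNr u v : dotv u (- v) = - dotv u v.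
Proof. by rewrite dotvC dotvNl dotvC. Qed.

Lemma dotvBl u v w : dotv (u - v) w = dotv u w - dotv v w.
Proof. by rewrite dotvDl dotvNl. Qed.

Lemma dotvBr u v w : dotv w (u - v) = dotv w u - dotv w v.
Proof. by rewrite dotvDr dotvNr. Qed.

Lemma dotv0l v : dotv 0 v = 0.
Proof. by rewrite /dotv big1// => i _; rewrite mxE mul0r. Qed.

Lemma dotv0r v : dotv v 0 = 0.
Proof. by rewrite dotvC dotv0l. Qed.

Lemma dotv_suml (I : finType) (f : I -> 'cV[R]_p) v :
  dotv (\sum_i f i) v = \sum_i dotv (f i) v.
Proof.
by elim/big_rec2: _ => [|i a b _ <-]; [exact: dotv0l|exact: dotvDl].
Qed.

Lemma dotv_ge0 v : 0 <= dotv v v.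
Proof. by apply: sumr_ge0 => i _; rewrite -expr2 sqr_ge0. Qed.

Lemma dotv_eq0 v : (dotv v v == 0) = (v == 0).
Proof.
apply/idP/eqP => [|->]; last by rewrite dotv0l.
rewrite psumr_eq0; last by move=> i _; rewrite -expr2 sqr_ge0.
move=> /allP H; apply/colP => i; rewrite mxE.
by have := H i (mem_index_enum i); rewrite /= mulf_eq0 orbb => /eqP.
Qed.

Lemma dotv_mulmx A u v : dotv u (A *m v) = dotv (A^T *m u) v.
Proof.
rewrite /dotv.
under eq_bigr do rewrite mxE mulr_sumr.
rewrite exchange_big; apply: eq_bigr => j _.
by rewrite mxE mulr_suml; apply: eq_bigr => i _; rewrite mxE mulrA [u i 0 * _]mulrC.
Qed.

Lemma dotv_col_row u v w : (u *m v^T) *m w = dotv v w *: u.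
Proof.
apply/colP => i; rewrite -mulmxA mxE big_ord1 !mxE mulrC; congr (_ * _).
by apply: eq_bigr => j _; rewrite mxE.
Qed.

Lemma cauchy_schwarz u v : dotv u v ^+ 2 <= dotv u u * dotv v v.
Proof.
have [->|v0] := eqVneq v 0; first by rewrite !dotv0r expr0n mulr0.
have vv : 0 < dotv v v by rewrite lt_def dotv_eq0 v0 dotv_ge0.
have := dotv_ge0 (dotv v v *: u - dotv u v *: v).
rewrite dotvBl !dotvBr !dotvZl !dotvZr (dotvC v u) => H.
rewrite -subr_ge0 -(pmulr_rge0 _ vv).
move: H; congr (0 <= _); ring.
Qed.

Lemma norm2_ge0 v : 0 <= norm2 v. Proof. exact: sqrtr_ge0. Qed.

Lemma norm2_sqr v : norm2 v ^+ 2 = dotv v v.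
Proof. by rewrite sqr_sqrtr// dotv_ge0. Qed.

Lemma norm2_eq0 v : (norm2 v == 0) = (v == 0).
Proof. by rewrite -(sqrf_eq0 (norm2 v)) norm2_sqr dotv_eq0. Qed.

Lemma norm2_0 : norm2 (0 : 'cV[R]_p) = 0.
Proof. by apply/eqP; rewrite norm2_eq0. Qed.

Lemma norm2Z a v : norm2 (a *: v) = `|a| * norm2 v.
Proof.
by rewrite /norm2 dotvZl dotvZr mulrA -expr2 sqrtrM ?sqr_ge0// sqrtr_sqr.
Qed.

Lemma dotv_le_norm2 u v : `|dotv u v| <= norm2 u * norm2 v.
Proof.
rewrite -(@ler_pXn2r _ 2)// ?nnegrE ?mulr_ge0 ?norm2_ge0//.
by rewrite real_normK ?num_real// exprMn !norm2_sqr cauchy_schwarz.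
Qed.

Lemma norm2D u v : norm2 (u + v) <= norm2 u + norm2 v.
Proof.
rewrite -(@ler_pXn2r _ 2)// ?nnegrE ?addr_ge0 ?norm2_ge0//.
rewrite sqrrD !norm2_sqr dotvDl !dotvDr (dotvC v u).
have := dotv_le_norm2 u v; rewrite ler_norml => /andP[_].
lra.
Qed.

Lemma norm2_normalize v : v != 0 -> norm2 ((norm2 v)^-1 *: v) = 1.
Proof.
move=> v0; rewrite norm2Z ger0_norm ?invr_ge0 ?norm2_ge0//.
by rewrite mulVf// norm2_eq0.
Qed.

Lemma norm2_mulmx A : exists2 B : R, 0 < B &
  forall v, dotv (A *m v) (A *m v) <= B * dotv v v.
Proof.
exists (1 + \sum_i \sum_j A i j ^+ 2).
  by rewrite ltr_pwDl// sumr_ge0// => i _; rewrite sumr_ge0// => j _; rewrite sqr_ge0.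
move=> v; rewrite mulrDl mul1r -[leLHS]add0r lerD ?dotv_ge0//.
rewrite {1}/dotv mulr_suml ler_sum// => i _.
have := cauchy_schwarz ((row i A)^T) v.
have -> : dotv (row i A)^T v = (A *m v) i 0.
  by rewrite mxE; apply: eq_bigr => j _; rewrite !mxE.
rewrite -expr2; congr (_ <= _ * _).
by apply: eq_bigr => j _; rewrite !mxE -expr2.
Qed.

(** The discriminant argument for the nonnegative form s^2 a + 2 s t b + t^2 c. As the form may be
    degenerate, c = 0 is treated separately. *)
Lemma psd_cauchy_schwarz A : A^T = A -> (forall v, 0 <= dotv v (A *m v)) ->
  forall u v, dotv u (A *m v) ^+ 2 <= dotv u (A *m u) * dotv v (A *m v).
Proof.
move=> Asym Apsd u v.
set a := dotv u (A *m u); set b := dotv u (A *m v); set c := dotv v (A *m v).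
have ba : dotv v (A *m u) = b by rewrite dotv_mulmx Asym dotvC.
have q s t : 0 <= s ^+ 2 * a + 2 * s * t * b + t ^+ 2 * c.
  have := Apsd (s *: u + t *: v).
  rewrite mulmxDr -!scalemxAr dotvDl !dotvDr !dotvZl !dotvZr -/a -/c ba -/b.
  move=> H; move: H; congr (0 <= _); ring.
have a0 : 0 <= a := Apsd u; have c0 : 0 <= c := Apsd v.
have [cp|c_le0] := ltP 0 c.
  (* At s = c, t = - b the form equals c (a c - b^2). *)
  have H := q c (- b); rewrite -subr_ge0 -(pmulr_rge0 _ cp).
  by move: H; congr (0 <= _); ring.
have cE : c = 0 by apply/eqP; rewrite eq_le c_le0 c0.
have := q 1 (- (a + 1) * b); rewrite cE !mulr0 addr0 => H.
have b2 : 0 <= b ^+ 2 by exact: sqr_ge0.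
have b2a : 0 <= a * b ^+ 2 by exact: mulr_ge0.
have : b ^+ 2 <= 0.
  rewrite leNgt; apply/negP => bp.
  (* If b were nonzero, the form would take the negative value - a - 2 here. *)
  have := q 1 (- ((a + 1) / b)); rewrite cE mulr0 addr0.
  have bn : b != 0 by rewrite -sqrf_eq0 gt_eqF.
  have -> : 1 ^+ 2 * a + 2 * 1 * - ((a + 1) / b) * b = - a - 2 by field.
  lra.
done.
Qed.

Lemma sym_quadratic_lower_bound A (c : R) : A^T = A ->
  (forall a, eigenvalue A a -> c < a) ->
  forall v, c * dotv v v <= dotv v (A *m v).
Proof.
move=> Asym Aeig v0; have [->|v0n] := eqVneq v0 0.
  by rewrite dotv0l mulr0 dotv0l.
have scale v : v != 0 -> exists2 u, dotv u u = 1 &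
    dotv v (A *m v) = dotv v v * dotv u (A *m u).
  move=> vn; exists ((norm2 v)^-1 *: v).
    by rewrite -norm2_sqr norm2_normalize// expr1n.
  rewrite -scalemxAr dotvZl dotvZr -norm2_sqr.
  by field; rewrite norm2_eq0.
pose S := [set dotv u (A *m u) | u in [set u | dotv u u = 1]].
have [B B0 AB] := norm2_mulmx A.
have S0 : S !=set0 by have [u u1 _] := scale _ v0n; exists (dotv u (A *m u)), u.
(* From 0 <= |u + A u|^2 = 1 + 2 u.Au + |A u|^2. *)
have Slb : lbound S (- (1 + B)).
  move=> _ [u /= u1 <-].
  have := AB u; rewrite u1 mulr1 => AuB.
  have := dotv_ge0 (u + A *m u); rewrite dotvDl !dotvDr u1 (dotvC (A *m u)).
  move: AuB; set a := dotv (A *m u) _; set b := dotv u (A *m u) => AuB.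
  have := B0; lra.
have hS : has_inf S by split; [exact: S0|exists (- (1 + B))].
pose l := inf S; pose M := A - l%:M.
have Mv v : dotv v (M *m v) = dotv v (A *m v) - l * dotv v v.
  by rewrite mulmxBl dotvBr mul_scalar_mx dotvZr.
have Al v : l * dotv v v <= dotv v (A *m v).
  have [->|vn] := eqVneq v 0; first by rewrite dotv0l mulr0 dotv0l.
  have [u u1 ->] := scale v vn; rewrite mulrC ler_wpM2l ?dotv_ge0//.
  by apply: (ge_inf (proj2 hS)); exists u.
have Mpsd v : 0 <= dotv v (M *m v) by rewrite Mv subr_ge0.
have Msym : M^T = M by rewrite raddfB /= tr_scalar_mx Asym.
suff cl : c <= l by apply: le_trans (Al v0); rewrite ler_wpM2r ?dotv_ge0.
have [|nl] := boolP (eigenvalue A l); first by move/Aeig/ltW.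
exfalso.
have Mu : M \in unitmx.
  by rewrite -row_free_unit -kermx_eq0 -[_ == _]negbK; exact: nl.
have [B1 B10 MB] := norm2_mulmx M; have [B2 B20 NB] := norm2_mulmx (invmx M).
have lo v : dotv v v <= (1 + B1) * B2 * dotv v (M *m v).
  have h1 : dotv v v <= B2 * dotv (M *m v) (M *m v).
    by have := NB (M *m v); rewrite mulKmx.
  (* With w = M v, Cauchy-Schwarz for the form of [M] gives |w|^4 <= (w.Mw) (v.Mv), and w.Mw <= (1 +
     B1) |w|^2 follows from 0 <= |w - M w|^2. *)
  have h2 : dotv (M *m v) (M *m v) <= (1 + B1) * dotv v (M *m v).
    have [->|mv] := eqVneq (M *m v) 0; first by rewrite dotv0l dotv0r mulr0.
    have mp : 0 < dotv (M *m v) (M *m v) by rewrite lt_def dotv_eq0 mv dotv_ge0.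
    rewrite -(ler_pM2l mp) -expr2.
    apply: (le_trans (psd_cauchy_schwarz Msym Mpsd (M *m v) v)).
    rewrite mulrA ler_wpM2r// mulrC.
    set w := M *m v; have := MB w; have := dotv_ge0 (w - M *m w).
    rewrite dotvBl !dotvBr (dotvC (M *m w) w).
    have := dotv_ge0 w; have := dotv_ge0 (M *m w); clear; lra.
  apply: (le_trans h1); rewrite [(1 + B1) * B2]mulrC -mulrA.
  by rewrite ler_wpM2l// ltW.
have K0 : 0 < (1 + B1) * B2 by rewrite mulr_gt0// addr_gt0.
have : l + ((1 + B1) * B2)^-1 <= l.
  apply: lb_le_inf => // _ [u /= u1 <-].
  have := lo u; rewrite Mv u1 mulr1 -ler_pdivrMl// mulr1 => H.
  by rewrite -lerBrDl.
by rewrite gerDl leNgt invr_gt0 K0.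
Qed.

End euclidean_vectors.

(** * The law of the response *)

(** The assumptions at one sample size, with a single constant [C]: bounds expressed by [C], [eta]
    and [alpha] are then uniform in n. *)
Record regular_model (R : realType) (alpha : nat) (C eta : R)
    (d : measure_display) (T : measurableType d) (P : probability T R)
    (p : nat) (beta : 'cV[R]_p) (o : observation R T p)
    (rho : p.-tuple R -> R -> R) (k : R.-pker (p.-tuple R) ~> R) : Prop :=
  RegularModel {
  rm_median : median_zero P o ;
  rm_density_X : exists f, cond_density P (obsZ o) (obsX o) f ;
  rm_density : cond_density P (obsZ o) (zeta beta o) rho ;
  rm_density_bound : {ae P, forall w,
     (forall t, 0 < rho (obsZ o w) t <= C) /\
     bounded_derivs alpha C (rho (obsZ o w))} ;
  rm_indep : cond_indep P (obsZ o) (obsE o) (obsX o) ;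
  rm_kernel : cond_dist P (obsZ o) (obsE o) k ;
  rm_cdf_bound : {ae P, forall w,
     bounded_derivs alpha.+1 C (cond_cdf k (obsZ o w))} ;
  rm_subgauss : forall v : 'cV[R]_p, norm2 v = 1 ->
     (\int[P]_w (expR (eta * dotv v (zvec o w) ^+ 2))%:E <= C%:E)%E }.

Section cdf_facts.
Context d (E : measurableType d) (R : realType) (k : R.-pker E ~> R).
Implicit Types (v : E) (t : R).

Lemma pker_fin v A : measurable A -> k v A \is a fin_num.
Proof.
move=> mA; rewrite ge0_fin_numE// (@le_lt_trans _ _ 1%E) ?ltry//.
rewrite -(@prob_kernel _ _ _ _ _ k v).
by apply: le_measure; rewrite ?inE.
Qed.

Lemma pker_le1 v A : measurable A -> fine (k v A) <= 1.
Proof.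
move=> mA; rewrite -lee_fin fineK ?pker_fin//.
rewrite -(@prob_kernel _ _ _ _ _ k v).
by apply: le_measure; rewrite ?inE.
Qed.

Lemma cond_cdf_bound v t : `|cond_cdf k v t| <= 1.
Proof. by rewrite ger0_norm ?fine_ge0// pker_le1. Qed.

(** A Lipschitz c.d.f. has no atoms. The open half-line is the one that occurs, because Y = -1 means
    epsilon < - zeta strictly. *)
Lemma cond_cdf_open (K : R) v : (forall s t, `|cond_cdf k v s - cond_cdf k v t| <= K * `|s - t|) ->
  forall t, k v `]-oo, t[%classic = (cond_cdf k v t)%:E.
Proof.
move=> FK t; have mo : measurable (`]-oo, t[%classic : set R) by exact: measurable_itv.
rewrite -(fineK (pker_fin v mo)); congr EFin.
have le1 : fine (k v `]-oo, t[%classic) <= cond_cdf k v t.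
  rewrite /cond_cdf fine_le ?pker_fin//.
  apply: le_measure; rewrite ?inE//.
  by apply: subset_itvl; rewrite bnd_simp.
apply: (@eq_of_dist_le _ K) => e e0.
have le2 : cond_cdf k v (t - e) <= fine (k v `]-oo, t[%classic).
  rewrite /cond_cdf fine_le ?pker_fin//.
  apply: le_measure; rewrite ?inE//.
  by apply: subset_itvl; rewrite bnd_simp; lra.
rewrite distrC ger0_norm ?subr_ge0//.
apply: (@le_trans _ _ (cond_cdf k v t - cond_cdf k v (t - e))).
  by rewrite lerD2l lerN2.
rewrite (le_trans (ler_norm _))// (le_trans (FK _ _))//.
by rewrite opprB addrC subrK gtr0_norm.
Qed.

End cdf_facts.

(** A form of the tower property. On the set [B] of values of V where the bound fails, the mean of
    the deficit [g] is at most 0 by the bound given (X, V), yet [g] is positive there, so the set is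
    null. It transfers the median condition, stated given (X, Z), to the law of epsilon given Z. *)
Lemma cond_dist_lower_bound dE dC (d : measure_display) (T : measurableType d) (R : realType)
  (P : probability T R) (E : measurableType dE) (F : measurableType dC)
  (V : T -> E) (X : T -> F) (U : T -> R)
  (k : R.-pker E ~> R) (k' : R.-pker (F * E)%type ~> R) (A : set R) (c : R) :
  0 <= c -> measurable_fun setT V -> measurable_fun setT X ->
  measurable_fun setT U -> measurable A ->
  cond_dist P V U k -> cond_dist P (fun w => (X w, V w)) U k' ->
  {ae P, forall w, (c%:E <= k' (X w, V w) A)%E} ->
  {ae P, forall w, c <= fine (k (V w) A)}.
Proof.
move=> c0 mV mX mU mA kV kXV ck'.
pose B := [set v | fine (k v A) < c].
have mkA : measurable_fun setT (fun v => fine (k v A)).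
  by apply: measurableT_comp => //; exact: measurable_kernel.
have mB : measurable B by exact: measurable_set_ltr.
have mVB : measurable (V @^-1` B) by rewrite -[X in measurable X]setTI; exact: mV.
have [mkA1 _ /(_ B mB) E1] := kV A mA.
have [mk'A _ /(_ (setT `*` B))] := kXV A mA.
have -> : (fun w => (X w, V w)) @^-1` (setT `*` B) = V @^-1` B.
  by apply/seteqP; split => w /=; [case|].
move=> E2.
have mTB : measurable ([set: F] `*` B) by exact: measurableX.
have {}E2 := E2 mTB.
pose g w := \1_(V @^-1` B) w * (c - fine (k (V w) A)).
have mg : measurable_fun setT g.
  apply: measurable_funM; first exact: measurable_indic.
  by apply: measurable_funB => //; exact: (measurableT_comp mkA).
have g0 w : 0 <= g w.
  rewrite /g indicE; case: (boolP (w \in _)) => [/set_mem wB|_]; last by rewrite mul0r.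
  by rewrite mul1r subr_ge0 ltW.
have PVB : P (V @^-1` B) \is a fin_num by exact: fin_num_measure.
have intk : (\int[P]_(w in V @^-1` B) (fine (k (V w) A))%:E =
    \int[P]_(w in V @^-1` B) k (V w) A)%E.
  by apply: eq_integral => w _; rewrite fineK// pker_fin.
have le0 : (\int[P]_w (g w)%:E <= 0)%E.
  have -> : (\int[P]_w (g w)%:E =
      \int[P]_(w in V @^-1` B) ((cst c w)%:E - (fine (k (V w) A))%:E))%E.
    rewrite [RHS]integral_mkcond; apply: eq_integral => w _.
    by rewrite patchE /g indicE; case: ifPn => _; rewrite ?mul1r ?mul0r.
  rewrite integralB//; last 2 first.
  - exact: finite_measure_integrable_cst.
  - apply: (@le_integrable _ _ _ _ _ _ _ (cst 1%E)) => //.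
    + apply/measurable_EFinP; apply: measurable_funTS.
      exact: (measurableT_comp mkA).
    + move=> w _ /=; rewrite lee_fin normr1 ger0_norm ?fine_ge0//.
      exact: pker_le1.
    + exact: finite_measure_integrable_cst.
  rewrite (integral_cst P mVB c%:E) intk -E1 E2.
  rewrite leeBlDr ?add0e; last first.
    by rewrite -E2 fin_num_measure//; apply: measurableI => //;
      rewrite -[X in measurable X]setTI; exact: mU.
  rewrite -(integral_cst P mVB c%:E).
  have mXV : measurable_fun setT (fun w => (X w, V w)) by exact: measurable_fun_pair.
  apply: ae_ge0_le_integral => //.
  - apply: measurable_funTS; exact: (measurableT_comp mk'A mXV).
  - by apply: filterS ck' => w + _.
have : (\int[P]_w `|(g w)%:E| = 0)%E.
  apply/eqP; rewrite eq_le; apply/andP; split; last exact: integral_ge0.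
  by under eq_integral do rewrite gee0_abs ?lee_fin//.
have mEg : measurable_fun setT (EFin \o g) by exact/measurable_EFinP.
move=> /(ae_eq_integral_abs _ measurableT mEg).
apply: filterS => w /(_ I) /= [gw]; rewrite leNgt; apply/negP => kc.
move: gw; rewrite /g indicE mem_set// mul1r => /eqP; rewrite subr_eq0 => /eqP cE.
by move: kc; rewrite -cE ltxx.
Qed.

(** Both closed half-lines have conditional probability at least 1/2, and without an atom at 0 these
    probabilities add up to 1. *)
Lemma median_zero_cdf (R : realType) (d : measure_display) (T : measurableType d)
    (P : probability T R) (p : nat) (o : observation R T p)
    (k : R.-pker (p.-tuple R) ~> R) (K : R) :
  median_zero P o -> cond_dist P (obsZ o) (obsE o) k ->
  {ae P, forall w s t, `|cond_cdf k (obsZ o w) s - cond_cdf k (obsZ o w) t|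
                       <= K * `|s - t|} ->
  {ae P, forall w, cond_cdf k (obsZ o w) 0 = 2^-1}.
Proof.
move=> [k' [kk' med]] kE lipF.
have half0 : 0 <= 2^-1 :> R by rewrite invr_ge0.
have med1 : {ae P, forall w, (2^-1%:E <= k' (obsX o w, obsZ o w) `]-oo, 0%R]%classic)%E}.
  by apply: filterS med => w [].
have med2 : {ae P, forall w, (2^-1%:E <= k' (obsX o w, obsZ o w) `[0%R, +oo[%classic)%E}.
  by apply: filterS med => w [].
have mA1 : measurable (`]-oo, 0%R]%classic : set R) by exact: measurable_itv.
have mA2 : measurable (`[0%R, +oo[%classic : set R) by exact: measurable_itv.
have mZ : measurable_fun setT (obsZ o) by [].
have mX : measurable_fun setT (obsX o) by [].
have mE : measurable_fun setT (obsE o) by [].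
have l1 := cond_dist_lower_bound half0 mZ mX mE mA1 kE kk' med1.
have l2 := cond_dist_lower_bound half0 mZ mX mE mA2 kE kk' med2.
apply: filterS3 l1 l2 lipF => w l1 l2 lipw.
apply/eqP; rewrite eq_le; apply/andP; split; last exact: l1.
have mo : measurable (`]-oo, 0[%classic : set R) by exact: measurable_itv.
have e1 : k (obsZ o w) `]-oo, 0[%classic = (cond_cdf k (obsZ o w) 0)%:E.
  exact: (cond_cdf_open lipw).
have : (k (obsZ o w) `]-oo, 0%R[%classic + k (obsZ o w) `[0%R, +oo[%classic = 1)%E.
  rewrite -measureU//; last first.
    rewrite -subset0 => x /= []; rewrite !in_itv/= andbT => x0 x0'.
    by move: x0; rewrite ltNge x0'.
  rewrite -(@prob_kernel _ _ _ _ _ k (obsZ o w)); congr (k _ _).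
  apply/seteqP; split => // x _ /=; rewrite !in_itv/= andbT.
  by have [|] := ltP x 0; [left|right].
rewrite e1 -[X in (_ + X)%E](fineK (pker_fin _ _ mA2)) -EFinD => -[].
by move: l2; set a := cond_cdf _ _ _; set b := fine _; clear; lra.
Qed.

(** A nonnegative weight commutes with positive and negative parts, and the integral is by
    definition the difference of their integrals, finite or not. *)
Lemma eq_integral_signed d1 d2 dG (T1 : measurableType d1) (T2 : measurableType d2)
    (G : measurableType dG) (R : realType) (m1 : {measure set T1 -> \bar R})
    (m2 : {measure set T2 -> \bar R}) (Y1 : T1 -> R) (Y2 : T2 -> R)
    (W1 : T1 -> G) (W2 : T2 -> G) :
  (forall x, 0 <= Y1 x) -> (forall x, 0 <= Y2 x) ->
  (forall g : G -> \bar R, measurable_fun setT g -> (forall q, (0 <= g q)%E) ->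
    (\int[m1]_x ((Y1 x)%:E * g (W1 x)) = \int[m2]_x ((Y2 x)%:E * g (W2 x)))%E) ->
  forall f : G -> R, measurable_fun setT f ->
  (\int[m1]_x (Y1 x * f (W1 x))%:E = \int[m2]_x (Y2 x * f (W2 x))%:E)%E.
Proof.
move=> Y10 Y20 H f mf.
have mEf : measurable_fun setT (EFin \o f) by exact/measurable_EFinP.
have pE (T : Type) (Y : T -> R) (W : T -> G) : (forall x, 0 <= Y x) ->
    ((fun x => (Y x * f (W x))%:E)^\+ = (fun x => (Y x)%:E * (EFin \o f)^\+ (W x)))%E.
  move=> Y0; apply/funext => x; rewrite !funeposE /= -!EFin_max -EFinM.
  by rewrite maxr_pMr// mulr0.
have nE (T : Type) (Y : T -> R) (W : T -> G) : (forall x, 0 <= Y x) ->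
    ((fun x => (Y x * f (W x))%:E)^\- = (fun x => (Y x)%:E * (EFin \o f)^\- (W x)))%E.
  move=> Y0; apply/funext => x; rewrite !funenegE /= -!EFin_max -EFinM.
  by rewrite maxr_pMr// mulr0 mulrN.
rewrite integralE [RHS]integralE !pE// !nE//; congr (_ - _)%E; apply: H => //.
- exact: measurable_funepos.
- exact: measurable_funeneg.
Qed.

Lemma measurable_dotv_colv (R : realType) (p : nat) (u : 'cV[R]_p) :
  measurable_fun setT (fun z : p.-tuple R => dotv (colv z) u).
Proof.
apply: measurable_sum => i; apply: measurable_funM => //.
under eq_fun do rewrite mxE.
exact: measurable_tnth.
Qed.

Section response_law.
Context (R : realType) (alpha : nat) (C eta : R) (d : measure_display)
  (T : measurableType d) (P : probability T R) (p : nat) (beta : 'cV[R]_p)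
  (o : observation R T p) (rho : p.-tuple R -> R -> R)
  (k : R.-pker (p.-tuple R) ~> R).
Hypothesis M : regular_model alpha C eta P beta o rho k.

Local Notation Z := (obsZ o).
Local Notation ze := (zeta beta o).
Local Notation leb := (@lebesgue_measure R).

(** As Y = -1 exactly when epsilon < - zeta, the first factor is the conditional mean of - Y given Z
    = z and zeta = t. *)
Definition neg_response_density (z : p.-tuple R) (t : R) : R :=
  (2 * fine (k z `]-oo, - t[%classic) - 1) * rho z t.

Let negative : set (p.-tuple R * R * R) :=
  [set q | q.1.2 + dotv (colv q.1.1) beta + q.2 < 0].

Let mZ : measurable_fun setT Z. Proof. by []. Qed.

Lemma measurable_zeta : measurable_fun setT ze.
Proof.
apply: measurable_funD => //.
exact: (measurableT_comp (measurable_dotv_colv beta) mZ).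
Qed.

Let mnegative : measurable negative.
Proof.
apply: measurable_set_ltr => //.
apply: measurable_funD => //; apply: measurable_funD.
  exact: (measurableT_comp measurable_snd measurable_fst).
apply: (measurableT_comp (measurable_dotv_colv beta)).
exact: (measurableT_comp measurable_fst measurable_fst).
Qed.

Let s w : R := \1_negative (Z w, obsX o w, obsE o w).

Let responseE w : - response beta o w = 2 * s w - 1.
Proof.
rewrite /response /s indicE /zeta /zvec; case: (boolP (_ \in _)) => [/set_mem H|H].
  by rewrite leNgt H /= mulr1; ring.
have -> : 0 <= obsX o w + dotv (colv (Z w)) beta + obsE o w.
  by rewrite leNgt; apply: contraNN H => H; exact/mem_set.
by rewrite /=; ring.
Qed.

Let mWz : measurable_fun setT (fun w => (Z w, ze w)).
Proof. by apply: measurable_fun_pair => //; exact: measurable_zeta. Qed.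

Let mWx : measurable_fun setT (fun w => (Z w, obsX o w)).
Proof. exact: measurable_fun_pair. Qed.

Let kappa (q : p.-tuple R * R) : R := fine (k q.1 `]-oo, - q.2[%classic).

Let mkappa : measurable_fun setT kappa.
Proof.
pose D : set (p.-tuple R * R * R) := [set q | q.2 < - q.1.2].
have mD : measurable D.
  apply: measurable_set_ltr => //; apply: measurable_funN.
  exact: (measurableT_comp measurable_snd measurable_fst).
have := measurable_kernel_section k mD.
move=> /(measurableT_comp (fine_measurable measurableT)).
congr (measurable_fun _ _); apply/funext => q; rewrite /kappa /=.
congr (fine (k _ _)); apply/seteqP; split => x /=; rewrite in_itv/=.
  by move=> /set_mem.
by move=> H; exact/mem_set.
Qed.

Lemma kappa01 q : 0 <= kappa q <= 1.
Proof.
by rewrite fine_ge0//= pker_le1//; exact: measurable_itv.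
Qed.

Lemma response_sign_integral (g : p.-tuple R * R -> \bar R) :
  measurable_fun setT g -> (forall q, (0 <= g q)%E) ->
  (\int[P]_w ((s w)%:E * g (Z w, ze w)) =
   \int[P]_w ((kappa (Z w, ze w))%:E * g (Z w, ze w)))%E.
Proof.
move=> mg g0.
(* The independence assumption involves [X] and not zeta; [h] maps (Z, X) to (Z, zeta). *)
pose h (q : p.-tuple R * R) := (q.1, q.2 + dotv (colv q.1) beta).
have mh : measurable_fun setT h.
  apply: measurable_fun_pair => //; apply: measurable_funD => //.
  exact: (measurableT_comp (measurable_dotv_colv beta) measurable_fst).
have mgh : measurable_fun setT (g \o h) by exact: measurableT_comp.
have [fX fXd] := rm_density_X M.
have := cond_indep_integral mZ (measurable_funPT (obsE o)) (measurable_funPT (obsX o))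
  (rm_kernel M) fXd (rm_indep M) mnegative mgh (fun q => g0 (h q)).
rewrite /= => ->.
apply: eq_integral => w _; rewrite /kappa /=; congr (_ * _)%E.
rewrite fineK; last by apply: pker_fin; exact: measurable_itv.
congr (k _ _); apply/seteqP; split => e /=; rewrite in_itv/= /zeta /zvec.
  by move=> /set_mem; rewrite /negative /=; lra.
by move=> H; apply/mem_set; rewrite /negative /=; lra.
Qed.

Let Pleb := (P \x leb)%E.
Let fromleb (t : measurableTypeR R) : R := t.
Let mfromleb : measurable_fun setT fromleb.
Proof. by move=> _ B mB; rewrite setTI. Qed.
Let W2 (q : T * measurableTypeR R) : p.-tuple R * R := (Z q.1, fromleb q.2).
Let mW2 : measurable_fun setT W2.
Proof.
apply: measurable_fun_pair; first exact: measurableT_comp.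
exact: measurableT_comp.
Qed.
Let r2 (q : T * measurableTypeR R) : R := rho (Z q.1) (fromleb q.2).
Let mr2 : measurable_fun setT r2.
Proof. by have [mr _ _] := rm_density M; exact: (measurableT_comp mr mW2). Qed.
Let r20 q : 0 <= r2 q. Proof. by have [_ + _] := rm_density M; apply. Qed.

Let density_law (g : p.-tuple R * R -> \bar R) :
  measurable_fun setT g -> (forall q, (0 <= g q)%E) ->
  (\int[P]_w g (Z w, ze w) = \int[Pleb]_q ((r2 q)%:E * g (W2 q)))%E.
Proof.
move=> mg g0; rewrite (cond_density_integral mZ measurable_zeta (rm_density M) mg g0).
rewrite fubini_tonelli1//.
- apply: emeasurable_funM; last exact: (measurableT_comp mg mW2).
  exact: (measurableT_comp (@EFin_measurable R setT) mr2).
- by move=> q; rewrite mule_ge0// lee_fin.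
Qed.

Section signed.
Variable f : p.-tuple R * R -> R.
Hypothesis mf : measurable_fun setT f.
Hypothesis fi : P.-integrable setT (fun w => (f (Z w, ze w))%:E).

Let mrf : measurable_fun setT (fun q => r2 q * f (W2 q)).
Proof. by apply: measurable_funM => //; exact: (measurableT_comp mf mW2). Qed.

Let irf : Pleb.-integrable setT (fun q => (r2 q * f (W2 q))%:E).
Proof.
apply/integrableP; split; first exact: (measurableT_comp (@EFin_measurable R setT) mrf).
have mnf : measurable_fun setT (fun q => `|f q|%:E).
  by apply/measurable_EFinP; exact: measurableT_comp.
rewrite (_ : (\int[Pleb]_q `|(r2 q * f (W2 q))%:E|)%E =
   (\int[Pleb]_q ((r2 q)%:E * `|f (W2 q)|%:E))%E); last first.
  by apply: eq_integral => q _; rewrite /= normrM ger0_norm.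
rewrite -(density_law mnf); last by move=> q; rewrite lee_fin.
by have /integrableP[_] := fi.
Qed.

Let mk2 : measurable_fun setT (fun q => kappa (W2 q)).
Proof. exact: (measurableT_comp mkappa mW2). Qed.

Let dominated (c : T * measurableTypeR R -> R) : measurable_fun setT c ->
  (forall q, `|c q| <= 1) ->
  Pleb.-integrable setT (fun q => (c q * (r2 q * f (W2 q)))%:E).
Proof.
move=> mc c1; apply: le_integrable irf => //.
  by apply: (measurableT_comp (@EFin_measurable R setT)); exact: measurable_funM.
by move=> q _; rewrite /= lee_fin normrM ler_piMl.
Qed.

Let ikrf : Pleb.-integrable setT (fun q => (kappa (W2 q) * (r2 q * f (W2 q)))%:E).
Proof.
apply: dominated => // q.
by have /andP[k0 k1] := kappa01 (W2 q); rewrite ger0_norm.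
Qed.

Let iqrf : Pleb.-integrable setT
  (fun q => ((2 * kappa (W2 q) - 1) * (r2 q * f (W2 q)))%:E).
Proof.
apply: dominated => [|q].
  by apply: measurable_funB => //; exact: measurable_funM.
by have /andP[k0 k1] := kappa01 (W2 q); rewrite ler_norml; apply/andP; split; lra.
Qed.

Let s01 w : `|s w| <= 1.
Proof. by rewrite /s indicE; case: (_ \in _); rewrite ?normr1 ?normr0. Qed.


Let ms : measurable_fun setT s.
Proof.
have mi : measurable_fun setT (\1_negative : p.-tuple R * R * R -> R).
  exact: measurable_indic.
have mt : measurable_fun setT (fun w => (Z w, obsX o w, obsE o w)).
  exact: measurable_fun_pair.
exact: (measurableT_comp mi mt).
Qed.

Let isf : P.-integrable setT (fun w => (s w * f (Z w, ze w))%:E).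
Proof.
apply: le_integrable fi => //.
  apply/measurable_EFinP; apply: measurable_funM => //.
  exact: (measurableT_comp mf mWz).
by move=> w _; rewrite /= lee_fin normrM ler_piMl.
Qed.

Let sE : (\int[P]_w (s w * f (Z w, ze w))%:E =
  \int[Pleb]_q (kappa (W2 q) * (r2 q * f (W2 q)))%:E)%E.
Proof.
rewrite (_ : (fun q => _) = (fun q => (kappa (W2 q) * r2 q * f (W2 q))%:E)); last first.
  by apply/funext => q; rewrite mulrA.
apply: (@eq_integral_signed _ _ _ _ _ (p.-tuple R * R)%type R P Pleb s
  (fun q => kappa (W2 q) * r2 q) (fun w => (Z w, ze w)) W2) => //.
  by move=> q; rewrite mulr_ge0//; case/andP: (kappa01 (W2 q)).
move=> g mg g0; rewrite response_sign_integral//.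
have mkg : measurable_fun setT (fun q => (kappa q)%:E * g q)%E.
  by apply: emeasurable_funM => //; exact/measurable_EFinP.
rewrite (density_law mkg); last first.
  by move=> q; rewrite mule_ge0// lee_fin; case/andP: (kappa01 q).
by apply: eq_integral => q _; rewrite EFinM muleA [((r2 q)%:E * _)%E]muleC.
Qed.

Let fE : (\int[P]_w (f (Z w, ze w))%:E = \int[Pleb]_q (r2 q * f (W2 q))%:E)%E.
Proof.
rewrite (_ : (fun w => (f (Z w, ze w))%:E) = (fun w => (cst 1 w * f (Z w, ze w))%:E)); last first.
  by apply/funext => w; rewrite mul1r.
apply: (@eq_integral_signed _ _ _ _ _ (p.-tuple R * R)%type R P Pleb (cst 1)
  r2 (fun w => (Z w, ze w)) W2) => // g mg g0.
by rewrite -(density_law mg g0); apply: eq_integral => w _; rewrite mul1e.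
Qed.

Lemma response_mean :
  \int[P]_w (- response beta o w * f (Z w, ze w)) =
  \int[Pleb]_q ((2 * kappa (W2 q) - 1) * (r2 q * f (W2 q))).
Proof.
transitivity (\int[P]_w (2 * (s w * f (Z w, ze w)) - f (Z w, ze w))).
  by apply: eq_Rintegral => w _; rewrite responseE; ring.
rewrite (RintegralB measurableT (@integrableZl _ _ _ _ _ measurableT 2 _ isf) fi).
rewrite (RintegralZl _ measurableT isf).
transitivity (\int[Pleb]_q (2 * (kappa (W2 q) * (r2 q * f (W2 q))) - r2 q * f (W2 q))).
  rewrite (RintegralB measurableT (@integrableZl _ _ _ _ _ measurableT 2 _ ikrf) irf).
  rewrite (RintegralZl _ measurableT ikrf).
  by rewrite /Rintegral sE fE.
by apply: eq_Rintegral => q _; ring.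
Qed.

(** Fubini's theorem leaves an inner integral in t for fixed Z, to which the smoothing estimates
    apply for almost every Z. [main] is its leading term and [bound] the error, both integrated
    afterwards. *)
Lemma response_mean_approx (main bound : T -> R) (B : R) :
  P.-integrable setT (EFin \o main) ->
  measurable_fun setT bound -> (forall w, 0 <= bound w) ->
  {ae P, forall w,
    `|\int[leb]_t (neg_response_density (Z w) t * f (Z w, t)) - main w| <= bound w} ->
  (\int[P]_w (bound w)%:E <= B%:E)%E ->
  `|\int[P]_w (- response beta o w * f (Z w, ze w)) - \int[P]_w main w| <= B.
Proof.
move=> imain mbound bound0 ae_bound intbound.
pose F := fubini_F leb (fun q => ((2 * kappa (W2 q) - 1) * (r2 q * f (W2 q)))%:E).
have iF : P.-integrable setT F := integrable_fubini_F iqrf.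
have FE : (\int[P]_w F w)%E = (\int[P]_w (- response beta o w * f (Z w, ze w)))%:E.
  rewrite response_mean EFin_Rintegral//.
  exact: (integral12_prod_meas1 iqrf).
have mF : measurable_fun setT F by exact: measurable_int iF.
have EM : ((\int[P]_w (- response beta o w * f (Z w, ze w)) - \int[P]_w main w)%:E =
    \int[P]_w (F w - (main w)%:E))%E.
  by rewrite (integralB measurableT iF imain) FE EFinB (EFin_Rintegral imain).
have mFm : measurable_fun setT (fun w => F w - (main w)%:E)%E.
  exact: (emeasurable_funB mF (measurable_int _ imain)).
rewrite -lee_fin -abse_EFin EM.
apply: (le_trans (le_abse_integral _ measurableT mFm)).
apply: le_trans intbound; apply: ae_ge0_le_integral => //.
- exact: measurableT_comp.
- by move=> w _; rewrite lee_fin.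
- exact/measurable_EFinP.
have Ffin := integrable_ae measurableT iF.
apply: filterS2 ae_bound Ffin => w wbound /(_ I) Fw _.
rewrite -(fineK Fw) -EFinB abse_EFin lee_fin; apply: le_trans wbound.
rewrite le_eqVlt; apply/orP; left; apply/eqP; congr (`|_ - _|).
rewrite /F /fubini_F /Rintegral; congr fine; apply: eq_integral => t _.
by rewrite /neg_response_density /kappa /r2 /W2 /= mulrA.
Qed.

End signed.
End response_law.

Section response_density_facts.
Context (R : realType) (alpha : nat) (C eta : R) (d : measure_display)
  (T : measurableType d) (P : probability T R) (p : nat) (beta : 'cV[R]_p)
  (o : observation R T p) (rho : p.-tuple R -> R -> R)
  (k : R.-pker (p.-tuple R) ~> R).
Hypothesis M : regular_model alpha C eta P beta o rho k.
Hypothesis C1 : 1 <= C.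
Hypothesis alpha2 : (2 <= alpha)%N.

Local Notation Z := (obsZ o).
Local Notation F := (fun w => cond_cdf k (Z w)).

Let C0 : 0 <= C. Proof. exact: le_trans C1. Qed.

Lemma ae_smooth_cdf : {ae P, forall w, smooth_bounded alpha.+1 C (F w)}.
Proof.
apply: filterS (rm_cdf_bound M) => w H; split => // t.
by apply: le_trans C1; exact: cond_cdf_bound.
Qed.

Lemma ae_median : {ae P, forall w, F w 0 = 2^-1}.
Proof.
apply: (@median_zero_cdf _ _ _ _ _ _ _ C (rm_median M) (rm_kernel M)).
apply: filterS ae_smooth_cdf => w /smooth_boundedS[_ dF [F'C _]] s t.
exact: lipschitz_of_derive.
Qed.

(** The constant of [smooth_boundedM] for 2 F(- t) - 1, bounded by C + C + 1, times the density,
    bounded by C. *)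
Definition response_density_bound := 2 ^+ alpha * ((C + C + 1) * C).

Lemma response_density_bound_ge0 : 0 <= response_density_bound.
Proof. by rewrite /response_density_bound !mulr_ge0 ?exprn_ge0 ?addr_ge0. Qed.

(** The factor 2 F(- t) - 1 vanishes at 0 by the median condition, so only its own derivative - 2
    F'(0) contributes to q'(0). *)
Lemma ae_neg_response_density : {ae P, forall w,
  let q := neg_response_density rho k (Z w) in
  [/\ smooth_bounded alpha response_density_bound q, q 0 = 0 &
      q^`()%classic 0 = - (2 * (rho (Z w) 0 * (F w)^`()%classic 0))]}.
Proof.
apply: filterS3 ae_smooth_cdf ae_median (rm_density_bound M).
move=> w Fs med [rhoC rhos] q.
have rs : smooth_bounded alpha C (rho (Z w)).
  by split=> // t; have /andP[r0 rC] := rhoC t; rewrite gtr0_norm.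
have [_ dF [F'C _]] := (smooth_boundedS _ _ _).1 Fs.
have lipF s t : `|F w s - F w t| <= C * `|s - t| by exact: lipschitz_of_derive.
pose a t := F w (- t) + F w (- t) + cst (-1) t.
have qE : q = fun t => a t * rho (Z w) t.
  apply/funext => t; rewrite /q /neg_response_density (cond_cdf_open lipF) /a /=.
  by congr (_ * _); ring.
have Fs' : smooth_bounded alpha C (F w) by exact: smooth_bounded_leq Fs.
have Fo := smooth_bounded_comp_opp Fs'.
have as_ : smooth_bounded alpha (C + C + 1) a.
  apply: smooth_boundedD; first exact: smooth_boundedD.
  by have := smooth_bounded_cst alpha (-1 : R); rewrite normrN1.
have a0 : a 0 = 0.
  by rewrite /a oppr0 med /=; field.
split.
- by rewrite qE; exact: smooth_boundedM.
- by rewrite qE a0 mul0r.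
have dFo (t : R) : is_derive t 1 (fun t => F w (- t)) (- (F w)^`()%classic (- t)).
  by apply: is_derive_comp_opp; exact: dF.
have da : is_derive (0 : R) 1 a (- (F w)^`()%classic 0 - (F w)^`()%classic 0).
  have H := dFo 0; rewrite oppr0 in H.
  have H2 := @is_deriveD _ _ _ _ _ (0 : R) 1 _ _ H H.
  have := @is_deriveD _ _ _ _ _ (0 : R) 1 _ _ H2 (is_derive_cst (-1 : R) (0 : R) 1).
  by move=> /is_derive_eq; apply; rewrite addr0.
have dr : is_derive (0 : R) 1 (rho (Z w)) ((rho (Z w))^`()%classic 0).
  apply: derivable_is_derive1.
  by case: rs => _ /(_ 0%N (ltnW alpha2) 0) [].
have := @is_deriveM _ _ _ _ (0 : R) 1 _ _ da dr.
rewrite qE => H; rewrite (is_derive1_derive1 H) a0 /GRing.scale /=; ring.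
Qed.

(* A measurable version of rho(0|Z) F'(0|Z): the derivative of the random
   c.d.f. is a pointwise limit only almost everywhere. *)
Lemma ex_measurable_density_at0 : exists D0 : T -> R,
  [/\ measurable_fun setT D0, forall w, `|D0 w| <= C * C &
   {ae P, forall w, D0 w = rho (Z w) 0 * (F w)^`()%classic 0}].
Proof.
have [N2 [mN2 PN2 HN2]] := filterI ae_smooth_cdf (rm_density_bound M).
have good w : ~ N2 w -> smooth_bounded alpha.+1 C (F w) /\ 0 <= rho (Z w) 0 <= C.
  move=> nN.
  have [? [H _]] : smooth_bounded alpha.+1 C (F w) /\
      ((forall t, 0 < rho (Z w) t <= C) /\ bounded_derivs alpha C (rho (Z w))).
    by apply: contrapT => H; apply: nN; exact: HN2.
  by split => //; have /andP[r0 ->] := H 0; rewrite ltW.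
pose ind w : R := \1_(~` N2) w.
have indE w : ~ N2 w -> ind w = 1 by move=> nN; rewrite /ind indicE mem_set.
have indN w : N2 w -> ind w = 0.
  by move=> H; rewrite /ind indicE memNset//=; apply.
(* Difference quotients of step 1 / (n + 1) are measurable in w. Cutting by [ind] makes them
   converge everywhere, to [D0]; off the null set [N2] the convergence is the second-order Taylor
   bound. *)
pose G n w := ind w * (rho (Z w) 0 * (n.+1%:R * (F w n.+1%:R^-1 - F w 0))).
pose D0 w := ind w * (rho (Z w) 0 * (F w)^`()%classic 0).
have mind : measurable_fun setT ind by apply: measurable_indic; exact: measurableC.
have mrho : measurable_fun setT (fun w => rho (Z w) 0).
  have [mr _ _] := rm_density M.
  have mp : measurable_fun setT (fun w => (Z w, 0 : R)) by exact: measurable_fun_pair.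
  exact: (measurableT_comp mr mp).
have mF t : measurable_fun setT (fun w => F w t).
  have mk : measurable_fun setT (fun v => fine (k v `]-oo, t]%classic)).
    by apply: measurableT_comp => //; apply: measurable_kernel; exact: measurable_itv.
  exact: (measurableT_comp mk (measurable_funPT Z)).
have mG n : measurable_fun setT (G n).
  apply: measurable_funM => //; apply: measurable_funM => //.
  by apply: measurable_funM => //; apply: measurable_funB.
exists D0; split.
- apply: (measurable_fun_cvg mG) => w _.
  have [Nw|nN] := pselect (N2 w).
    rewrite /D0 indN// mul0r.
    rewrite (_ : G ^~ w = cst 0); first exact: cvg_cst.
    by apply/funext => n; rewrite /G indN// mul0r.
  rewrite /D0 indE// mul1r.
  have [Fs _] := good w nN.
  rewrite (_ : G ^~ w = fun n => rho (Z w) 0 * (n.+1%:R * (F w n.+1%:R^-1 - F w 0))); last first.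
    by apply/funext => n; rewrite /G indE// mul1r.
  apply: cvgMr.
  have Fs1 : smooth_bounded 2 C (F w) by apply: smooth_bounded_leq Fs; exact: leq_trans alpha2 _.
  have [_ dF _] := (smooth_boundedS _ _ _).1 Fs.
  have [_ _ /smooth_boundedS[_ ddF [ddFC _]]] := (smooth_boundedS _ _ _).1 Fs1.
  have E1 (c m a b : R) : 0 < m -> m * (a - b) - c = m * (a - b - c * m^-1).
    by move=> m0; field; rewrite gt_eqF.
  have E2 (m c : R) : 0 < m -> m * (c * m^-1 ^+ 2) = c * m^-1.
    by move=> m0; field; rewrite gt_eqF.
  have C0' : 0 < C by exact: lt_le_trans C1.
  apply/cvgrPdist_lt => e e0; have eC0 : 0 < e / C by exact: divr_gt0.
  near=> n.
  have n0 : 0 < n.+1%:R :> R by rewrite ltr0n.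
  have := taylor2 dF ddF ddFC n.+1%:R^-1 0; rewrite subr0 => H.
  rewrite distrC.
  rewrite (E1 _ n.+1%:R)// normrM gtr0_norm//.
  apply: (@le_lt_trans _ _ (n.+1%:R * (C * n.+1%:R^-1 ^+ 2))).
    by rewrite ler_wpM2l// ltW.
  rewrite E2//.
  rewrite mulrC -ltr_pdivlMr//.
  near: n; exact: (near_infty_natSinv_lt (PosNum eC0)).
- move=> w; rewrite /D0; have [Nw|nN] := pselect (N2 w).
    by rewrite indN// mul0r normr0 mulr_ge0.
  rewrite indE// mul1r; have [Fs /andP[r0 rC]] := good w nN.
  have [_ _ [F'C _]] := (smooth_boundedS _ _ _).1 Fs.
  by rewrite normrM ger0_norm// ler_pM.
- exists N2; split=> // w /= H; apply: contrapT => nN; apply: H.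
  by rewrite /D0 indE// mul1r.
Unshelve. all: by end_near. Qed.

End response_density_facts.

(** * Expectations of the gradient and Hessian terms *)

Section exponential_weights.
Context (R : realType) (eta : R).
Hypothesis eta0 : 0 < eta.

(** With s = x^2 + y^2: (1 + s)^2 <= 2 + 2 s^2, and s^2 <= (64 / eta^2) exp(eta s / 4). *)
Definition moment_const := 2 + 128 / eta ^+ 2.

Lemma moment_const_ge0 : 0 <= moment_const.
Proof. by rewrite addr_ge0// divr_ge0// sqr_ge0. Qed.

(** The left side is the geometric mean of the two exponentials, hence at most the larger one.
    Written as a square, it offers two factors to spend separately. *)
Let half_exp (x y : R) : expR (eta * (x ^+ 2 + y ^+ 2) / 4) ^+ 2 <=
  expR (eta * x ^+ 2) + expR (eta * y ^+ 2).
Proof.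
rewrite -expRM_natl.
have -> : 2 * (eta * (x ^+ 2 + y ^+ 2) / 4) = (eta * x ^+ 2 + eta * y ^+ 2) / 2.
  by field.
wlog xy : x y / x ^+ 2 <= y ^+ 2.
  move=> H; have [|/ltW yx] := leP (x ^+ 2) (y ^+ 2); first exact: H.
  by rewrite addrC [leRHS]addrC; exact: H.
apply: (@le_trans _ _ (expR (eta * y ^+ 2))); last by rewrite lerDr expR_ge0.
rewrite ler_expR ler_pdivrMr// mulr2n mulrDr mulr1 lerD2r ler_wpM2l//.
exact: ltW.
Qed.

Let sqr_le_exp (s : R) : 0 <= s -> s ^+ 2 <= 64 / eta ^+ 2 * expR (eta * s / 4).
Proof.
move=> s0.
have -> : eta * s / 4 = 2 * (eta * s / 8) by field.
rewrite expRM_natl.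
have h : eta * s / 8 <= expR (eta * s / 8).
  by have := expR_ge1Dx (eta * s / 8); lra.
have p0 : 0 <= eta * s / 8 by rewrite divr_ge0// mulr_ge0// ltW.
have : (eta * s / 8) ^+ 2 <= expR (eta * s / 8) ^+ 2.
  by rewrite lerXn2r ?nnegrE ?expR_ge0.
set e := expR _ ^+ 2 => H.
have -> : s ^+ 2 = 64 / eta ^+ 2 * (eta * s / 8) ^+ 2 by field; rewrite gt_eqF.
by rewrite ler_wpM2l// divr_ge0// sqr_ge0.
Qed.

Lemma poly_le_weight (x y : R) : (1 + x ^+ 2 + y ^+ 2) ^+ 2 <=
  moment_const * (expR (eta * x ^+ 2) + expR (eta * y ^+ 2)).
Proof.
have alg (e z s : R) : 1 <= e -> s ^+ 2 <= z -> 0 <= (s - 1) ^+ 2 ->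
    (1 + s) ^+ 2 <= 2 * e + 2 * z by rewrite !expr2; nra.
set s := x ^+ 2 + y ^+ 2.
have s0 : 0 <= s by rewrite addr_ge0 ?sqr_ge0.
set e := expR (eta * s / 4).
have e1 : 1 <= e.
  by rewrite /e -[X in X <= _]expR0 ler_expR divr_ge0// mulr_ge0// ltW.
have e2 : e <= e ^+ 2 by rewrite expr2 ler_peMl// (le_trans ler01).
have h := half_exp x y; rewrite -/s -/e in h.
apply: (@le_trans _ _ (moment_const * e)); last first.
  by rewrite ler_wpM2l ?moment_const_ge0// (le_trans e2).
have sq := sqr_le_exp s0; rewrite -/e in sq.
have -> : moment_const * e = 2 * e + 2 * (64 / eta ^+ 2 * e).
  by rewrite /moment_const; ring.
have -> : 1 + x ^+ 2 + y ^+ 2 = 1 + s by rewrite /s; ring.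
exact: (alg _ _ _ e1 sq (sqr_ge0 (s - 1))).
Qed.

(** One factor exp(eta s / 4) absorbs the square and the other the exponential. Since |x| |y| <= s /
    2, the latter requires L <= eta / 2, the origin of this threshold in the deviation bounds. *)
Lemma product_exp_le_weight (L x y : R) : 0 <= L <= eta / 2 ->
  (`|x| * `|y|) ^+ 2 * expR (L * (`|x| * `|y|)) <=
  moment_const * (expR (eta * x ^+ 2) + expR (eta * y ^+ 2)).
Proof.
move=> /andP[L0 L1].
set s := x ^+ 2 + y ^+ 2.
have s0 : 0 <= s by rewrite addr_ge0 ?sqr_ge0.
set e := expR (eta * s / 4).
have e0 : 0 <= e by exact: expR_ge0.
have h := half_exp x y; rewrite -/s -/e in h.
have ag : `|x| * `|y| <= s / 2.
  have := sqr_ge0 (`|x| - `|y|).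
  by rewrite sqrrB !real_normK ?num_real// /s; lra.
have ab0 : 0 <= `|x| * `|y| by rewrite mulr_ge0.
have h1 : (`|x| * `|y|) ^+ 2 <= 16 / eta ^+ 2 * e.
  apply: (@le_trans _ _ ((s / 2) ^+ 2)).
    by rewrite lerXn2r ?nnegrE// divr_ge0.
  have := sqr_le_exp s0; rewrite -/e.
  have -> : 64 / eta ^+ 2 * e = 4 * (16 / eta ^+ 2 * e) by ring.
  by set z := _ * e; lra.
have h2 : expR (L * (`|x| * `|y|)) <= e.
  rewrite ler_expR (_ : eta * s / 4 = (eta / 2) * (s / 2)); last by field.
  exact: ler_pM.
apply: (@le_trans _ _ (16 / eta ^+ 2 * e * e)).
  by rewrite ler_pM// ?sqr_ge0 ?expR_ge0.
rewrite -mulrA -expr2; apply: ler_pM => //.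
- by rewrite divr_ge0// sqr_ge0.
- exact: sqr_ge0.
rewrite /moment_const.
have : 0 <= (eta ^+ 2)^-1 by rewrite invr_ge0 sqr_ge0.
by lra.
Qed.

End exponential_weights.

Section moments.
Context (R : realType) (alpha : nat) (C eta : R) (d : measure_display)
  (T : measurableType d) (P : probability T R) (p : nat) (beta : 'cV[R]_p)
  (o : observation R T p) (rho : p.-tuple R -> R -> R)
  (k : R.-pker (p.-tuple R) ~> R).
Hypothesis M : regular_model alpha C eta P beta o rho k.
Hypothesis C1 : 1 <= C.
Hypothesis eta0 : 0 < eta.

Local Notation Z := (obsZ o).
Local Notation ze := (zeta beta o).
Local Notation ip z u := (dotv (colv z) u).

Let C0 : 0 <= C. Proof. exact: le_trans C1. Qed.
Let mZ : measurable_fun setT Z. Proof. by []. Qed.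

Lemma measurable_ip u : measurable_fun setT (fun w => ip (Z w) u).
Proof. exact: (measurableT_comp (measurable_dotv_colv u) mZ). Qed.

Lemma subgauss_ball (v : 'cV[R]_p) : norm2 v <= 1 ->
  (\int[P]_w (expR (eta * ip (Z w) v ^+ 2))%:E <= C%:E)%E.
Proof.
move=> v1.
have [->|v0] := eqVneq v 0.
  under eq_integral do rewrite dotv0r expr0n /= mulr0 expR0.
  apply: (@le_trans _ _ 1%E); last by rewrite lee_fin.
  by rewrite (integral_cst P measurableT 1%E) mul1e; exact: probability_le1.
apply: le_trans (rm_subgauss M (norm2_normalize v0)).
have me (u : 'cV[R]_p) : measurable_fun setT (fun w => (expR (eta * ip (Z w) u ^+ 2))%:E).
  apply/measurable_EFinP; apply: measurableT_comp => //.
  by apply: measurable_funM => //; apply: measurable_funX; exact: measurable_ip.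
apply: ge0_le_integral => //.
- have := me ((norm2 v)^-1 *: v).
  by under eq_fun do rewrite dotvC.
move=> w _; rewrite lee_fin ler_expR ler_wpM2l ?(ltW eta0)//.
rewrite dotvZl exprMn (dotvC v) -/(zvec o w).
have n0 : 0 < norm2 v by rewrite lt_def norm2_eq0 v0 norm2_ge0.
rewrite ler_peMl ?sqr_ge0// exprn_ege1//.
by rewrite invf_ge1.
Qed.

Definition weight (a b : 'cV[R]_p) (z : p.-tuple R) : R :=
  expR (eta * ip z a ^+ 2) + expR (eta * ip z b ^+ 2).

Lemma measurable_weight a b : measurable_fun setT (weight a b).
Proof.
apply: measurable_funD; apply: measurableT_comp => //; apply: measurable_funM => //;
  by apply: measurable_funX; exact: measurable_dotv_colv.
Qed.

Lemma weight_ge0 a b z : 0 <= weight a b z.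
Proof. by rewrite addr_ge0 ?expR_ge0. Qed.

Lemma integral_weight a b : norm2 a <= 1 -> norm2 b <= 1 ->
  (\int[P]_w (weight a b (Z w))%:E <= (2 * C)%:E)%E.
Proof.
move=> a1 b1; under eq_integral do rewrite EFinD.
have me (u : 'cV[R]_p) : measurable_fun setT (fun w => (expR (eta * ip (Z w) u ^+ 2))%:E).
  apply/measurable_EFinP; apply: measurableT_comp => //.
  by apply: measurable_funM => //; apply: measurable_funX; exact: measurable_ip.
rewrite ge0_integralD//; try by move=> w _; rewrite lee_fin expR_ge0.
have -> : (2 * C)%:E = (C%:E + C%:E)%E by rewrite -EFinD; congr EFin; ring.
by apply: leeD; exact: subgauss_ball.
Qed.

(** One majorant for all the products of Z.a and Z.b, of degree at most 3, that appear in the mean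
    estimates. *)
Definition poly_weight (a b : 'cV[R]_p) (z : p.-tuple R) : R :=
  (1 + ip z a ^+ 2 + ip z b ^+ 2) ^+ 2.

Lemma measurable_poly_weight a b : measurable_fun setT (fun w => poly_weight a b (Z w)).
Proof.
apply: measurable_funX; apply: measurable_funD.
  by apply: measurable_funD => //; apply: measurable_funX; exact: measurable_ip.
by apply: measurable_funX; exact: measurable_ip.
Qed.

Lemma poly_weight_ge0 a b z : 0 <= poly_weight a b z.
Proof. exact: sqr_ge0. Qed.

Definition moment_bound := moment_const eta * (2 * C).

Lemma moment_bound_gt0 : 0 < moment_bound.
Proof.
have Cp : 0 < C by exact: lt_le_trans C1.
by rewrite !mulr_gt0// /moment_const ltr_pwDl// divr_ge0// sqr_ge0.
Qed.

Lemma integral_scaled_weight (c : R) a b : 0 <= c -> norm2 a <= 1 -> norm2 b <= 1 ->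
  (\int[P]_w (c * (moment_const eta * weight a b (Z w)))%:E <= (c * moment_bound)%:E)%E.
Proof.
move=> c0 a1 b1.
under eq_integral do rewrite mulrA EFinM.
rewrite ge0_integralZl_EFin//.
- rewrite /moment_bound mulrA [X in (_ <= X)%E]EFinM.
  apply: lee_wpmul2l; last exact: integral_weight.
  by rewrite lee_fin mulr_ge0// moment_const_ge0.
- by move=> w _; rewrite lee_fin weight_ge0.
- by apply/measurable_EFinP; exact: (measurableT_comp (measurable_weight a b) mZ).
- by rewrite mulr_ge0// moment_const_ge0.
Qed.

Lemma integral_poly_weight (c : R) a b : 0 <= c -> norm2 a <= 1 -> norm2 b <= 1 ->
  (\int[P]_w (c * poly_weight a b (Z w))%:E <= (c * moment_bound)%:E)%E.
Proof.
move=> c0 a1 b1; apply: le_trans (integral_scaled_weight c0 a1 b1).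
apply: ge0_le_integral => //.
- by move=> w _; rewrite lee_fin mulr_ge0// poly_weight_ge0.
- apply/measurable_EFinP; apply: measurable_funM => //.
  exact: measurable_poly_weight.
- apply/measurable_EFinP; apply: measurable_funM => //; apply: measurable_funM => //.
  exact: (measurableT_comp (measurable_weight a b) mZ).
by move=> w _; rewrite lee_fin ler_wpM2l// poly_le_weight.
Qed.

Lemma integrable_poly_weight (c : R) a b : 0 <= c -> norm2 a <= 1 -> norm2 b <= 1 ->
  P.-integrable setT (EFin \o (fun w => c * poly_weight a b (Z w))).
Proof.
move=> c0 a1 b1; apply: ge0_integrable_EFin (integral_poly_weight c0 a1 b1).
  by apply: measurable_funM => //; exact: measurable_poly_weight.
by move=> w; rewrite mulr_ge0// poly_weight_ge0.
Qed.

(** Given Z, the window is an interval of length 2 h whose centre depends on Z only, and the density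
    of zeta is at most C. *)
Lemma integral_window (f c : p.-tuple R -> R) (h : R) : 0 < h ->
  measurable_fun setT f -> measurable_fun setT c -> (forall z, 0 <= f z) ->
  (\int[P]_w (f (Z w) * (`|ze w + c (Z w)| <= h)%R%:R)%:E <=
   (2 * h * C)%:E * \int[P]_w (f (Z w))%:E)%E.
Proof.
move=> h0 mf mc f0.
pose g (q : p.-tuple R * R) := (f q.1 * (`|q.2 + c q.1| <= h)%R%:R)%:E.
have mg : measurable_fun setT g.
  apply/measurable_EFinP; apply: measurable_funM.
    exact: (measurableT_comp mf measurable_fst).
  pose A : set (p.-tuple R * R) := [set q | `|q.2 + c q.1| <= h].
  have mA : measurable A.
    apply: measurable_set_ler => //; apply: measurableT_comp => //.
    by apply: measurable_funD => //; exact: (measurableT_comp mc measurable_fst).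
  rewrite (_ : (fun _ => _) = \1_A); first exact: measurable_indic.
  apply/funext => q; rewrite indicE; congr (_%:R); congr nat_of_bool.
  by apply/idP/idP => [H|/set_mem//]; exact/mem_set.
have g0 q : (0 <= g q)%E by rewrite lee_fin mulr_ge0.
rewrite -[leLHS]/(\int[P]_w g (Z w, ze w))%E.
rewrite (cond_density_integral mZ (measurable_zeta beta o) (rm_density M) mg g0).
have c20 : 0 <= 2 * h * C by rewrite mulr_ge0// mulr_ge0// ltW.
rewrite -ge0_integralZl//; last 2 first.
- by apply/measurable_EFinP; exact: (measurableT_comp mf mZ).
- by move=> w _; rewrite lee_fin.
have [mr r0 _] := rm_density M.
pose fromleb (t : measurableTypeR R) : R := t.
have mW2 : measurable_fun setT (fun q : T * measurableTypeR R => (Z q.1, fromleb q.2)).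
  apply: measurable_fun_pair; first exact: measurableT_comp.
  have mfl : measurable_fun setT fromleb by move=> _ B mB; rewrite setTI.
  exact: measurableT_comp.
apply: ae_ge0_le_integral => //.
- move=> w _; apply: integral_ge0 => t _; rewrite mule_ge0// lee_fin r0//.
- apply: (@measurable_fun_fubini_tonelli_F _ _ _ _ _ (@lebesgue_measure R)
    (fun q => ((rho (Z q.1) q.2)%:E * g (Z q.1, q.2))%E)).
    apply: emeasurable_funM; last exact: (measurableT_comp mg mW2).
    exact: (measurableT_comp (@EFin_measurable R setT) (measurableT_comp mr mW2)).
  by move=> q; rewrite mule_ge0// lee_fin r0.
- by move=> w _; rewrite mule_ge0// lee_fin.
- apply: emeasurable_funM => //.
  by apply/measurable_EFinP; exact: (measurableT_comp mf mZ).
apply: filterS (rm_density_bound M) => w [rC _] _.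
pose a := - h - c (Z w); pose b := h - c (Z w).
pose I := `[a, b]%classic : set (measurableTypeR R).
have mI : measurable I by exact: measurable_itv.
apply: (@le_trans _ _ (\int[lebesgue_measure]_t ((C * f (Z w))%:E * (\1_I t)%:E))%E).
  apply: ge0_le_integral => //.
  - by move=> t _; rewrite mule_ge0// lee_fin r0.
  - have mt : measurable_fun setT (fun t : measurableTypeR R => (Z w, fromleb t)).
      apply: measurable_fun_pair => //.
      by move=> _ B mB; rewrite setTI.
    apply: emeasurable_funM; last exact: (measurableT_comp mg mt).
    exact: (measurableT_comp (@EFin_measurable R setT) (measurableT_comp mr mt)).
  - apply: emeasurable_funM => //.
    by apply: (measurableT_comp (@EFin_measurable R setT)); exact: measurable_indic.
  move=> t _; rewrite /g /= -!EFinM lee_fin mulrA ler_pM ?mulr_ge0//.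
    by rewrite ler_pM//; have /andP[_] := rC t.
  rewrite indicE ler_nat; case: (boolP (_ <= h)) => // H.
  rewrite mem_set// /I /= in_itv/= /a /b.
  by move: H; rewrite ler_norml => /andP[? ?]; apply/andP; split; lra.
rewrite ge0_integralZl//; last 2 first.
- by apply: (measurableT_comp (@EFin_measurable R setT)); exact: measurable_indic.
- by rewrite lee_fin mulr_ge0.
have lebI : lebesgue_measure I = (2 * h)%:E.
  rewrite /I lebesgue_measure_itv /= lte_fin.
  have -> : a < b by rewrite /a /b; lra.
  by rewrite -EFinB; congr EFin; rewrite /a /b; ring.
rewrite integral_indic// setIT.
apply: (@le_trans _ _ ((C * f (Z w))%:E * (2 * h)%:E)%E); first by rewrite -lebI.
by rewrite -!EFinM lee_fin le_eqVlt; apply/orP; left; apply/eqP; ring.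
Qed.

End moments.

(** * Summands of the Hessian and gradient averages: size and mean *)

Section score_terms.
Context (R : realType) (p : nat) (H : R -> R) (h : R).
Local Notation ip z u := (dotv (colv z) u).
Local Notation K1 := (H^`()%classic).
Local Notation K2 := (H^`(2)%classic).
Implicit Types (u v : 'cV[R]_p) (q : p.-tuple R * R).

(** This and the next two definitions are, with q = (Z, zeta) and up to the factor - Y, the summands
    of v.Gv, of v.(G u - g(beta + u) + g(beta)) and of v.g(beta), where G is the Hessian at beta +
    u. *)
Definition hess_term u v q : R :=
  h ^- 2 * K2 ((q.2 + ip q.1 u) / h) * ip q.1 v ^+ 2.

Definition newton_term u v q : R :=
  h ^- 2 * (K2 ((q.2 + ip q.1 u) / h) * ip q.1 u - h * K1 ((q.2 + ip q.1 u) / h)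
            + h * K1 (q.2 / h)) * ip q.1 v.

Definition grad_term v q : R := h^-1 * K1 (q.2 / h) * ip q.1 v.

Hypotheses (mK1 : measurable_fun setT K1) (mK2 : measurable_fun setT K2).

Let mip u : measurable_fun setT (fun q : p.-tuple R * R => ip q.1 u).
Proof. exact: (measurableT_comp (measurable_dotv_colv u) measurable_fst). Qed.

Let marg u : measurable_fun setT (fun q : p.-tuple R * R => (q.2 + ip q.1 u) / h).
Proof. by apply: measurable_funM => //; apply: measurable_funD. Qed.

Let marg0 : measurable_fun setT (fun q : p.-tuple R * R => q.2 / h).
Proof. exact: measurable_funM. Qed.

Lemma measurable_hess_term u v : measurable_fun setT (hess_term u v).
Proof.
apply: measurable_funM; last exact: measurable_funX.
by apply: measurable_funM => //; exact: (measurableT_comp mK2 (marg u)).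
Qed.

Lemma measurable_newton_term u v : measurable_fun setT (newton_term u v).
Proof.
apply: measurable_funM => //; apply: measurable_funM => //.
apply: measurable_funD.
  apply: measurable_funB.
    by apply: measurable_funM => //; exact: (measurableT_comp mK2 (marg u)).
  by apply: measurable_funM => //; exact: (measurableT_comp mK1 (marg u)).
by apply: measurable_funM => //; exact: (measurableT_comp mK1 marg0).
Qed.

Lemma measurable_grad_term v : measurable_fun setT (grad_term v).
Proof.
apply: measurable_funM => //; apply: measurable_funM => //.
exact: (measurableT_comp mK1 marg0).
Qed.

End score_terms.

Section score_bounds.
Context (R : realType) (p : nat) (alpha : nat) (H : R -> R) (C h r : R).
Hypotheses (kf : kernel_facts alpha H C) (h0 : 0 < h) (r0 : 0 <= r) (C0 : 0 <= C).
Local Notation ip z u := (dotv (colv z) u).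
Local Notation K1 := (H^`()%classic).
Local Notation K2 := (H^`(2)%classic).
Implicit Types (u v : 'cV[R]_p) (q : p.-tuple R * R).

Lemma kernel_window (f : R -> R) (x : R) : (forall x, 1 <= `|x| -> f x = 0) ->
  `|f (x / h)| = `|f (x / h)| * (`|x| <= h)%R%:R.
Proof.
move=> f0; have [xh|xh] := leP `|x| h; first by rewrite mulr1.
rewrite f0 ?normr0 ?mul0r// normrM [`|h^-1|]gtr0_norm ?invr_gt0//.
by rewrite ler_pdivlMr// mul1r ltW.
Qed.

Lemma hess_term_bound u v q : `|hess_term H h u v q| <=
  h ^- 2 * C * (`|ip q.1 v| * `|ip q.1 v|) * (`|q.2 + ip q.1 u| <= h)%R%:R.
Proof.
have hh : 0 <= h ^- 2 by rewrite invr_ge0 sqr_ge0.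
rewrite /hess_term !normrM (ger0_norm hh) (kernel_window _ (kf_supp2 kf)).
set a := `|ip q.1 v|; set b := (_ <= h)%R%:R.
have -> : h ^- 2 * (`|K2 ((q.2 + ip q.1 u) / h)| * b) * (a * a) =
  h ^- 2 * `|K2 ((q.2 + ip q.1 u) / h)| * (a * a) * b by ring.
apply: ler_wpM2r => //; apply: ler_wpM2r; first exact: (mulr_ge0 (normr_ge0 _) (normr_ge0 _)).
by apply: ler_wpM2l => //; exact: (kf_bound2 kf).
Qed.

(** Since H' is Lipschitz, the bracket is at most 2 C |Z.(r u)|, and r cancels. It vanishes unless
    zeta or zeta + Z.(r u) is in the window. For r = 0 the inverse is 0 by convention and the bound
    is trivial. *)
Lemma newton_term_bound u v q : `|r^-1 * newton_term H h (r *: u) v q| <=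
  h ^- 2 * (2 * C) * (`|ip q.1 u| * `|ip q.1 v|) *
  ((`|q.2 + ip q.1 (r *: u)| <= h)%R || (`|q.2 + 0| <= h)%R)%:R.
Proof.
have hh : 0 <= h ^- 2 by rewrite invr_ge0 sqr_ge0.
rewrite addr0 /newton_term; set c := ip q.1 (r *: u).
have cE : c = r * ip q.1 u by rewrite /c dotvZr.
set X := K2 _ * c - _ + _.
have X1 : `|X| <= 2 * C * `|c|.
  have -> : X = K2 ((q.2 + c) / h) * c - h * (K1 ((q.2 + c) / h) - K1 (q.2 / h)).
    by rewrite /X; ring.
  rewrite (le_trans (ler_normB _ _))//.
  have -> : 2 * C * `|c| = C * `|c| + h * (C * (`|c| / h)).
    by field; rewrite gt_eqF.
  rewrite lerD//; first by rewrite normrM ler_wpM2r// (kf_bound2 kf).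
  rewrite normrM gtr0_norm// ler_wpM2l ?(ltW h0)//.
  rewrite (le_trans (kf_lip1 kf _ _))// ler_wpM2l//.
  rewrite -mulrBl addrAC subrr add0r normrM [`|h^-1|]gtr0_norm ?invr_gt0//.
have X2 : ~~ ((`|q.2 + c| <= h) || (`|q.2| <= h)) -> X = 0.
  rewrite negb_or -!ltNge => /andP[c1 c2].
  have far (x : R) : h < `|x| -> 1 <= `|x / h|.
    move=> xh; rewrite normrM [`|h^-1|]gtr0_norm ?invr_gt0//.
    by rewrite ler_pdivlMr// mul1r ltW.
  rewrite /X (kf_supp2 kf (far _ c1)) (kf_supp1 kf (far _ c1)).
  by rewrite (kf_supp1 kf (far _ c2)) mul0r !mulr0 subr0 addr0.
case: (boolP ((`|q.2 + c| <= h) || (`|q.2| <= h))) => [_|/X2 ->]; last first.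
  by rewrite !mulr0 !mul0r !mulr0 normr0.
rewrite mulr1 !normrM (ger0_norm hh) ger0_norm ?invr_ge0//.
have -> : r^-1 * (h ^- 2 * `|X| * `|ip q.1 v|) =
  h ^- 2 * (r^-1 * `|X|) * `|ip q.1 v| by ring.
have -> : h ^- 2 * (2 * C) * (`|ip q.1 u| * `|ip q.1 v|) =
  h ^- 2 * (2 * C * `|ip q.1 u|) * `|ip q.1 v| by ring.
rewrite ler_wpM2r// ler_wpM2l//.
apply: (@le_trans _ _ (r^-1 * (2 * C * `|c|))).
  by rewrite ler_wpM2l ?invr_ge0.
rewrite cE normrM (ger0_norm r0).
have [->|rn] := eqVneq r 0.
  by rewrite invr0 mul0r mulr_ge0// mulr_ge0.
by rewrite le_eqVlt; apply/orP; left; apply/eqP; field.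
Qed.

Lemma grad_term_bound v q : `|grad_term H h v q| <=
  h^-1 * C * `|ip q.1 v| * (`|q.2 + 0| <= h)%R%:R.
Proof.
have hh : 0 <= h^-1 by rewrite invr_ge0 ltW.
rewrite addr0 /grad_term !normrM (ger0_norm hh) (kernel_window _ (kf_supp1 kf)).
rewrite -!mulrA ler_wpM2l// [(_%:R * _)]mulrC.
by rewrite ler_wpM2r ?mulr_ge0// (kf_bound1 kf).
Qed.

End score_bounds.

Section score_expectations.
Context (R : realType) (alpha : nat) (H : R -> R) (C eta : R) (d : measure_display)
  (T : measurableType d) (P : probability T R) (p : nat) (beta : 'cV[R]_p)
  (o : observation R T p) (rho : p.-tuple R -> R -> R)
  (k : R.-pker (p.-tuple R) ~> R).
Hypothesis kf : kernel_facts alpha H C.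
Hypothesis M : regular_model alpha C eta P beta o rho k.
Hypothesis C1 : 1 <= C.
Hypothesis eta0 : 0 < eta.
Hypothesis alpha2 : (2 <= alpha)%N.
Variables (h : R).
Hypothesis h0 : 0 < h.

Local Notation Z := (obsZ o).
Local Notation ze := (zeta beta o).
Local Notation ip z u := (dotv (colv z) u).
Local Notation leb := (@lebesgue_measure R).
Local Notation K1 := (H^`()%classic).
Local Notation K2 := (H^`(2)%classic).
Local Notation pw a b w := (poly_weight a b (Z w)).
Local Notation Cm := (moment_bound C eta).
Local Notation D := (response_density_bound alpha C).
Implicit Types u v : 'cV[R]_p.

Let C0 : 0 <= C. Proof. exact: le_trans C1. Qed.
Let D0 : 0 <= D. Proof. exact: response_density_bound_ge0. Qed.
Let CD0 : 0 <= 2 * (C * D).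
Proof. exact: (mulr_ge0 (ler0n _ 2) (mulr_ge0 C0 D0)). Qed.
Let cK1 : continuous K1. Proof. exact: derivable_continuous (kf_deriv1 kf). Qed.
Let cK2 : continuous K2. Proof. exact: lipschitz_continuous (kf_lip2 kf). Qed.
Lemma measurable_K1 : measurable_fun setT K1.
Proof. exact: continuous_measurable_fun. Qed.
Lemma measurable_K2 : measurable_fun setT K2.
Proof. exact: continuous_measurable_fun. Qed.
Let mK1 := measurable_K1.
Let mK2 := measurable_K2.

Let mWz : measurable_fun setT (fun w => (Z w, ze w)).
Proof. by apply: measurable_fun_pair => //; exact: measurable_zeta. Qed.

Let win_le1 (b : bool) : b%:R <= 1 :> R.
Proof. by case: b. Qed.

Let pw_xy (x y : R) : `|x| * `|y| <= (1 + x ^+ 2 + y ^+ 2) ^+ 2.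
Proof.
have := sqr_ge0 (`|x| - `|y|); rewrite sqrrB !real_normK ?num_real// => Q.
have X := sqr_ge0 x; have Y := sqr_ge0 y.
have := sqr_ge0 (x ^+ 2 + y ^+ 2).
have -> : (1 + x ^+ 2 + y ^+ 2) ^+ 2 =
  1 + 2 * x ^+ 2 + 2 * y ^+ 2 + (x ^+ 2 + y ^+ 2) ^+ 2 by ring.
have := mulr_ge0 (normr_ge0 x) (normr_ge0 y).
lra.
Qed.

Let pw_y (x y : R) : `|y| <= (1 + x ^+ 2 + y ^+ 2) ^+ 2.
Proof.
have X := sqr_ge0 x; have Y := sqr_ge0 y.
have := sqr_ge0 (`|y| - 1); rewrite sqrrB !real_normK ?num_real// => Q.
have := sqr_ge0 (x ^+ 2 + y ^+ 2).
have -> : (1 + x ^+ 2 + y ^+ 2) ^+ 2 =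
  1 + 2 * x ^+ 2 + 2 * y ^+ 2 + (x ^+ 2 + y ^+ 2) ^+ 2 by ring.
lra.
Qed.

Let pw_y2 (x y : R) : y ^+ 2 <= (1 + x ^+ 2 + y ^+ 2) ^+ 2.
Proof.
have X := sqr_ge0 x; have Y := sqr_ge0 y.
have := sqr_ge0 (x ^+ 2 + y ^+ 2).
have -> : (1 + x ^+ 2 + y ^+ 2) ^+ 2 =
  1 + 2 * x ^+ 2 + 2 * y ^+ 2 + (x ^+ 2 + y ^+ 2) ^+ 2 by ring.
lra.
Qed.

Let pw_xy2 (x y : R) : `|x| * y ^+ 2 <= (1 + x ^+ 2 + y ^+ 2) ^+ 2.
Proof.
have X := sqr_ge0 x; have Y := sqr_ge0 y.
have := sqr_ge0 (`|x| - 1); rewrite sqrrB !real_normK ?num_real// => Q.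
have a1 : `|x| <= 1 + x ^+ 2 by lra.
apply: (@le_trans _ _ ((1 + x ^+ 2) * y ^+ 2)); first by rewrite ler_wpM2r.
rewrite [leRHS]expr2; apply: ler_pM; lra.
Qed.

Let pw_x2y (x y : R) : x ^+ 2 * `|y| <= (1 + x ^+ 2 + y ^+ 2) ^+ 2.
Proof.
by have := pw_xy2 y x; rewrite mulrC -addrA [y ^+ 2 + _]addrC addrA.
Qed.

Lemma integrable_hess_term u v : norm2 v <= 1 ->
  P.-integrable setT (fun w => (hess_term H h u v (Z w, ze w))%:E).
Proof.
move=> v1.
have hC : 0 <= h ^- 2 * C by rewrite mulr_ge0// invr_ge0 sqr_ge0.
apply: (le_integrable_EFin _ _ (integrable_poly_weight M C1 eta0 hC v1 v1)).
  exact: (measurableT_comp (measurable_hess_term h mK2 u v) mWz).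
move=> w; rewrite (le_trans (hess_term_bound kf h0 u v (Z w, ze w)))// -mulrA ler_wpM2l//.
by rewrite -[leRHS]mulr1 ler_pM ?mulr_ge0 ?ler0n ?pw_xy.
Qed.

Lemma integrable_newton_term r u v : 0 <= r -> norm2 u <= 1 -> norm2 v <= 1 ->
  P.-integrable setT (fun w => (r^-1 * newton_term H h (r *: u) v (Z w, ze w))%:E).
Proof.
move=> r0 u1 v1.
have hC : 0 <= h ^- 2 * (2 * C) by rewrite mulr_ge0 ?mulr_ge0// invr_ge0 sqr_ge0.
apply: (le_integrable_EFin _ _ (integrable_poly_weight M C1 eta0 hC u1 v1)).
  apply: measurable_funM => //.
  exact: (measurableT_comp (measurable_newton_term h mK1 mK2 (r *: u) v) mWz).
move=> w; rewrite (le_trans (newton_term_bound kf h0 r0 C0 u v (Z w, ze w)))// -mulrA ler_wpM2l//.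
by rewrite -[leRHS]mulr1 ler_pM ?mulr_ge0 ?ler0n ?pw_xy.
Qed.

Lemma integrable_grad_term v : norm2 v <= 1 ->
  P.-integrable setT (fun w => (grad_term H h v (Z w, ze w))%:E).
Proof.
move=> v1.
have hC : 0 <= h^-1 * C by rewrite mulr_ge0// invr_ge0 ltW.
apply: (le_integrable_EFin _ _ (integrable_poly_weight M C1 eta0 hC v1 v1)).
  exact: (measurableT_comp (measurable_grad_term h mK1 v) mWz).
move=> w; rewrite (le_trans (grad_term_bound kf h0 v (Z w, ze w)))// -mulrA ler_wpM2l//.
by rewrite -[leRHS]mulr1 ler_pM ?ler0n ?pw_y.
Qed.

Local Notation mean f := (\int[P]_w (- response beta o w * f (Z w, ze w))).

(** The smoothed density tends to - q'(0) = 2 rho(0|Z) F'(0|Z), so the integrand on the right is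
    that of v.Vv, with the measurable version [Z0]. *)
Lemma mean_hess_term (Z0 : T -> R) r u v : 0 <= r -> norm2 u <= 1 -> norm2 v <= 1 ->
  measurable_fun setT Z0 -> (forall w, `|Z0 w| <= C * C) ->
  {ae P, forall w, Z0 w = rho (Z w) 0 * (cond_cdf k (Z w))^`()%classic 0} ->
  `|mean (hess_term H h (r *: u) v) - \int[P]_w (2 * (Z0 w * ip (Z w) v ^+ 2))|
   <= 2 * (C * D) * (h + r) * Cm.
Proof.
move=> r0 u1 v1 mZ0 Z0C Z0E.
have CDhr : 0 <= 2 * (C * D) * (h + r).
  exact: (mulr_ge0 CD0 (addr_ge0 (ltW h0) r0)).
apply: (response_mean_approx M (measurable_hess_term h mK2 (r *: u) v)
  (integrable_hess_term (r *: u) v1) (bound := fun w => 2 * (C * D) * (h + r) * pw u v w)).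
- have C20 : 0 <= 2 * (C * C) by rewrite !mulr_ge0.
  apply: (le_integrable_EFin _ _ (integrable_poly_weight M C1 eta0 C20 u1 v1)).
    apply: measurable_funM => //; apply: measurable_funM => //.
    by apply: measurable_funX; exact: measurable_ip.
  move=> w; rewrite normrM ger0_norm// -mulrA ler_wpM2l// normrM.
  by rewrite ler_pM// ger0_norm ?sqr_ge0// pw_y2.
- by apply: measurable_funM => //; exact: measurable_poly_weight.
- by move=> w; rewrite mulr_ge0// poly_weight_ge0.
- apply: filterS2 (ae_neg_response_density M C1 alpha2) Z0E => w [qs q0 q1] Z0w.
  set q := neg_response_density _ _ _ in qs q0 q1 *.
  set c := ip (Z w) (r *: u); set y := ip (Z w) v.
  have cq : continuous q.
    apply: derivable_continuous => x.
    by case: qs => _ /(_ 0%N (ltnW alpha2) x) [].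
  have iq := integrable_scale_comp c h0 cq cK2 (kf_supp2 kf).
  have -> : \int[leb]_t (q t * hess_term H h (r *: u) v (Z w, t)) =
      y ^+ 2 * (h ^- 2 * \int[leb]_t (q t * K2 ((t + c) / h))).
    rewrite mulrA -(RintegralZl _ measurableT iq).
    by apply: eq_Rintegral => t _; rewrite /hess_term /= -/c -/y; ring.
  have -> : 2 * (Z0 w * y ^+ 2) = - (y ^+ 2 * q^`()%classic 0).
    by rewrite q1 Z0w; ring.
  rewrite opprK -mulrDr normrM ger0_norm ?sqr_ge0//.
  apply: (@le_trans _ _ (y ^+ 2 * (2 * (C * D) * (h + `|c|)))).
    rewrite ler_wpM2l ?sqr_ge0//.
    exact: (smoothing_hessian alpha2 kf qs c h0).
  have -> : y ^+ 2 * (2 * (C * D) * (h + `|c|)) = 2 * (C * D) * (y ^+ 2 * (h + `|c|)) by ring.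
  rewrite -[leRHS]mulrA; apply: (ler_wpM2l CD0).
  rewrite /c dotvZr normrM (ger0_norm r0) mulrDr mulrDl lerD//.
    by rewrite mulrC ler_wpM2l ?(ltW h0)// pw_y2.
  by rewrite mulrCA ler_wpM2l// mulrC pw_xy2.
- exact: (integral_poly_weight M C1 eta0 CDhr u1 v1).
Qed.

Let int0 : \int[P]_w (cst 0 w : R) = 0.
Proof. by rewrite /Rintegral integral0. Qed.

(** [smoothing_newton] with c = Z.(r u) supplies r^2. The mean is that of the term divided by r, for
    which the deviations are controlled, multiplied back by r. *)
Lemma mean_newton_term r u v : 0 <= r -> norm2 u <= 1 -> norm2 v <= 1 ->
  `|r * mean (fun q => r^-1 * newton_term H h (r *: u) v q)| <=
  2 * (C * D) * r ^+ 2 * Cm.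
Proof.
move=> r0 u1 v1.
have CDr : 0 <= 2 * (C * D) * r ^+ 2 by exact: (mulr_ge0 CD0 (sqr_ge0 r)).
have [r00|rn] := eqVneq r 0.
  by rewrite r00 mul0r normr0 expr0n/= mulr0 mul0r.
have rp : 0 < r by rewrite lt_def rn.
have CDr1 : 0 <= 2 * (C * D) * r by exact: (mulr_ge0 CD0 r0).
rewrite normrM (ger0_norm r0).
have -> : 2 * (C * D) * r ^+ 2 * Cm = r * (2 * (C * D) * r * Cm) by ring.
apply: ler_wpM2l => //.
have mnt : measurable_fun setT (fun q => r^-1 * newton_term H h (r *: u) v q).
  by apply: measurable_funM => //; exact: (measurable_newton_term h mK1 mK2 (r *: u) v).
rewrite -[X in `|X|]subr0 -int0.
apply: (response_mean_approx M mnt (integrable_newton_term r0 u1 v1)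
  (bound := fun w => 2 * (C * D) * r * pw u v w)).
- exact: finite_measure_integrable_cst.
- by apply: measurable_funM => //; exact: measurable_poly_weight.
- by move=> w; rewrite mulr_ge0// poly_weight_ge0.
- apply: filterS (ae_neg_response_density M C1 alpha2) => w [qs q0 q1].
  rewrite subr0.
  set q := neg_response_density _ _ _ in qs q0 q1 *.
  set c := ip (Z w) (r *: u); set y := ip (Z w) v.
  have iq := smoothing_newton_integrable alpha2 kf qs c h0.
  have -> : \int[leb]_t (q t * (r^-1 * newton_term H h (r *: u) v (Z w, t))) =
      r^-1 * y * (h ^- 2 * \int[leb]_t (q t * (K2 ((t + c) / h) * c
         - h * K1 ((t + c) / h) + h * K1 (t / h)))).
    rewrite mulrA -(RintegralZl _ measurableT iq).
    by apply: eq_Rintegral => t _; rewrite /newton_term /= -/c -/y; ring.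
  rewrite normrM.
  apply: (@le_trans _ _ (`|r^-1 * y| * (2 * (C * D) * c ^+ 2))).
    by rewrite ler_wpM2l//; exact: (smoothing_newton alpha2 kf qs c h0).
  rewrite normrM ger0_norm ?invr_ge0// /c dotvZr -/y.
  have -> : r^-1 * `|y| * (2 * (C * D) * (r * ip (Z w) u) ^+ 2) =
     2 * (C * D) * r * (ip (Z w) u ^+ 2 * `|y|) by field.
  by rewrite ler_wpM2l// pw_x2y.
- exact: (integral_poly_weight M C1 eta0 CDr1 u1 v1).
Qed.

Lemma mean_grad_term v : norm2 v <= 1 ->
  `|mean (grad_term H h v)| <= 2 * (C * D) * h ^+ alpha * Cm.
Proof.
move=> v1.
have CDh : 0 <= 2 * (C * D) * h ^+ alpha by exact: (mulr_ge0 CD0 (exprn_ge0 _ (ltW h0))).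
rewrite -[X in `|X|]subr0 -int0.
apply: (response_mean_approx M (measurable_grad_term h mK1 v) (integrable_grad_term v1)
  (bound := fun w => 2 * (C * D) * h ^+ alpha * pw v v w)).
- exact: finite_measure_integrable_cst.
- by apply: measurable_funM => //; exact: measurable_poly_weight.
- by move=> w; rewrite mulr_ge0// poly_weight_ge0.
- apply: filterS (ae_neg_response_density M C1 alpha2) => w [qs q0 q1].
  rewrite subr0.
  set q := neg_response_density _ _ _ in qs q0 q1 *.
  set y := ip (Z w) v.
  have cq : continuous q.
    apply: derivable_continuous => x.
    by case: qs => _ /(_ 0%N (ltnW alpha2) x) [].
  have := integrable_scale_comp 0 h0 cq cK1 (kf_supp1 kf).
  under [X in _.-integrable _ (_ \o X) -> _]eq_fun do rewrite addr0.
  move=> iq.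
  have -> : \int[leb]_t (q t * grad_term H h v (Z w, t)) =
      y * (h^-1 * \int[leb]_t (q t * K1 (t / h))).
    rewrite mulrA -(RintegralZl _ measurableT iq).
    by apply: eq_Rintegral => t _; rewrite /grad_term /= -/y; ring.
  rewrite normrM.
  apply: (@le_trans _ _ (`|y| * (2 * (C * D) * h ^+ alpha))).
    by rewrite ler_wpM2l//; exact: (smoothing_gradient alpha2 kf qs h0 q0).
  by rewrite mulrC ler_wpM2l// pw_y.
- exact: (integral_poly_weight M C1 eta0 CDh v1 v1).
Qed.

(* Exponential moments: the window of width h around the decision boundary has
   conditional probability O(h) because the density of zeta is bounded. *)
Lemma exp_moment_window (f : p.-tuple R * R -> R) (u1 u2 a b : 'cV[R]_p) (A l : R) :
  measurable_fun setT f -> 0 <= A -> 0 <= l -> l * A <= eta / 2 ->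
  norm2 a <= 1 -> norm2 b <= 1 ->
  (forall q, `|f q| <= A * (`|ip q.1 a| * `|ip q.1 b|) *
     ((`|q.2 + ip q.1 u1| <= h)%R || (`|q.2 + ip q.1 u2| <= h)%R)%:R) ->
  (\int[P]_w (f (Z w, ze w) ^+ 2 * expR (l * `|f (Z w, ze w)|))%:E <=
    (4 * h * C * A ^+ 2 * Cm)%:E)%E.
Proof.
move=> mf A0 l0 lA a1 b1 fA.
pose V z := A ^+ 2 * (moment_const eta * weight eta a b z).
have mV : measurable_fun setT V.
  by apply: measurable_funM => //; apply: measurable_funM => //; exact: measurable_weight.
have V0 z : 0 <= V z.
  by rewrite mulr_ge0 ?sqr_ge0// mulr_ge0 ?moment_const_ge0 ?weight_ge0.
have iV : (\int[P]_w (V (Z w))%:E <= (A ^+ 2 * Cm)%:E)%E.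
  by apply: (integral_scaled_weight M C1 eta0 _ a1 b1); exact: sqr_ge0.
have win u : (\int[P]_w (V (Z w) * (`|ze w + ip (Z w) u| <= h)%R%:R)%:E <=
    (2 * h * C * (A ^+ 2 * Cm))%:E)%E.
  apply: (le_trans (integral_window M C1 h0 mV (measurable_dotv_colv u) V0)).
  rewrite [leRHS]EFinM; apply: lee_wpmul2l => //.
  by rewrite lee_fin mulr_ge0// mulr_ge0// ltW.
have mwin u : measurable_fun setT
    (fun w => (V (Z w) * (`|ze w + ip (Z w) u| <= h)%R%:R)%:E).
  apply/measurable_EFinP; apply: measurable_funM.
    exact: (measurableT_comp mV (measurable_funPT Z)).
  pose S : set T := [set w | `|ze w + ip (Z w) u| <= h].
  have mS : measurable S.
    apply: measurable_set_ler => //; apply: measurableT_comp => //.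
    by apply: measurable_funD; [exact: measurable_zeta|exact: measurable_ip].
  rewrite (_ : (fun _ => _) = \1_S); first exact: measurable_indic.
  apply/funext => w; rewrite indicE; congr (_%:R); congr nat_of_bool.
  by apply/idP/idP => [HS|/set_mem//]; exact/mem_set.
(* One share for each of the two windows. *)
have -> : 4 * h * C * A ^+ 2 * Cm = 2 * h * C * (A ^+ 2 * Cm) + 2 * h * C * (A ^+ 2 * Cm).
  by ring.
rewrite EFinD; apply: le_trans (leeD (win u1) (win u2)).
rewrite -ge0_integralD//; last 2 first.
- by move=> w _; rewrite lee_fin mulr_ge0.
- by move=> w _; rewrite lee_fin mulr_ge0.
have mfW : measurable_fun setT (fun w => f (Z w, ze w)) by exact: (measurableT_comp mf mWz).
apply: ge0_le_integral => //.
- by move=> w _; rewrite lee_fin mulr_ge0 ?sqr_ge0 ?expR_ge0.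
- apply/measurable_EFinP; apply: measurable_funM; first exact: measurable_funX.
  by apply: measurableT_comp => //; apply: measurable_funM => //; exact: measurableT_comp.
- exact: emeasurable_funD.
move=> w _; rewrite -EFinD lee_fin -mulrDr.
have := fA (Z w, ze w) => /=.
set b1' := (`|_ + ip (Z w) u1| <= h)%R; set b2 := (`|_ + ip (Z w) u2| <= h)%R.
set x := ip (Z w) a; set y := ip (Z w) b; set g := f _ => gA.
have [bb|/negbTE bb] := boolP (b1' || b2); last first.
  move: gA; rewrite bb mulr0 normr_le0 => /eqP ->.
  by rewrite expr0n mul0r mulr_ge0// addr_ge0.
move: gA; rewrite bb mulr1 => gA.
have bbR : 1 <= b1'%:R + b2%:R :> R.
  by move: bb; case: b1'; case: b2 => //= _; rewrite ?addr0 ?add0r ?lerDl.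
apply: (@le_trans _ _ (V (Z w))); last by rewrite ler_peMr.
have lAx : 0 <= l * A <= eta / 2 by rewrite mulr_ge0.
have := product_exp_le_weight eta0 x y lAx => pe.
have xy0 : 0 <= `|x| * `|y| by rewrite mulr_ge0.
rewrite /V -/(weight eta a b (Z w)) in pe *.
apply: (@le_trans _ _ ((A * (`|x| * `|y|)) ^+ 2 * expR (l * A * (`|x| * `|y|)))).
  apply: ler_pM => //; rewrite ?sqr_ge0 ?expR_ge0//.
    by rewrite -[g ^+ 2]real_normK ?num_real// lerXn2r ?nnegrE ?mulr_ge0.
  by rewrite ler_expR -[leRHS]mulrA ler_wpM2l.
rewrite [(A * _) ^+ 2]exprMn -[leLHS]mulrA.
by apply: ler_wpM2l; [exact: sqr_ge0|exact: pe].
Qed.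

(** A squared size of order h^-2 on a window of probability O(h). *)
Lemma second_moment_grad v : norm2 v <= 1 ->
  (\int[P]_w ((grad_term H h v (Z w, ze w)) ^+ 2)%:E <=
    (2 * C ^+ 3 * Cm / h)%:E)%E.
Proof.
move=> v1.
pose V z := (h^-1 * C) ^+ 2 * poly_weight v v z.
have mV : measurable_fun setT V.
  apply: measurable_funM => //; apply: measurable_funX; apply: measurable_funD.
    by apply: measurable_funD => //; apply: measurable_funX; exact: measurable_dotv_colv.
  by apply: measurable_funX; exact: measurable_dotv_colv.
have V0 z : 0 <= V z by rewrite mulr_ge0 ?sqr_ge0// poly_weight_ge0.
have m0 : measurable_fun setT (fun z : p.-tuple R => 0 : R) by [].
have iV : (\int[P]_w (V (Z w))%:E <= ((h^-1 * C) ^+ 2 * Cm)%:E)%E.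
  by apply: (integral_poly_weight M C1 eta0 _ v1 v1); exact: sqr_ge0.
have win := integral_window M C1 h0 mV m0 V0.
apply: (@le_trans _ _ ((2 * h * C)%:E * ((h^-1 * C) ^+ 2 * Cm)%:E)%E); last first.
  rewrite -EFinM lee_fin le_eqVlt; apply/orP; left; apply/eqP.
  by field; rewrite gt_eqF.
apply: (@le_trans _ _ ((2 * h * C)%:E * \int[P]_w (V (Z w))%:E)%E); last first.
  by apply: lee_wpmul2l => //; rewrite lee_fin mulr_ge0// mulr_ge0// ltW.
apply: le_trans win.
have mg : measurable_fun setT (fun w => grad_term H h v (Z w, ze w)).
  exact: (measurableT_comp (measurable_grad_term h mK1 v) mWz).
apply: ge0_le_integral => //.
- by move=> w _; rewrite lee_fin sqr_ge0.
- by apply/measurable_EFinP; exact: measurable_funX.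
- apply/measurable_EFinP; apply: measurable_funM.
    exact: (measurableT_comp mV (measurable_funPT Z)).
  pose S : set T := [set w | `|ze w + 0| <= h].
  have mS : measurable S.
    apply: measurable_set_ler => //; apply: measurableT_comp => //.
    by apply: measurable_funD; [exact: measurable_zeta|].
  rewrite (_ : (fun _ => _) = \1_S); first exact: measurable_indic.
  apply/funext => w; rewrite indicE; congr (_%:R); congr nat_of_bool.
  by apply/idP/idP => [HS|/set_mem//]; exact/mem_set.
move=> w _; rewrite lee_fin.
have := grad_term_bound kf h0 v (Z w, ze w) => /=.
set g := grad_term _ _ _ _; set bb := (_ <= h)%R; set x := ip (Z w) v => gB.
have xV : x ^+ 2 <= poly_weight v v (Z w) by exact: pw_y2.
have hC : 0 <= h^-1 * C * `|x| by rewrite !mulr_ge0// invr_ge0 ltW.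
rewrite -[g ^+ 2]real_normK ?num_real//.
apply: (@le_trans _ _ ((h^-1 * C * `|x| * bb%:R) ^+ 2)).
  by rewrite lerXn2r ?nnegrE// mulr_ge0.
have -> : (h^-1 * C * `|x| * bb%:R) ^+ 2 = (h^-1 * C) ^+ 2 * `|x| ^+ 2 * bb%:R.
  by rewrite !exprMn; congr (_ * _); case: (bb); rewrite /= ?expr1n ?expr0n.
by rewrite real_normK ?num_real// ler_wpM2r// ler_wpM2l// sqr_ge0.
Qed.

End score_expectations.

(** * One Newton step on a sample *)

Section unit_ball_grid.
Context (R : realType) (p N : nat).
Hypothesis N0 : (0 < N)%N.

Definition grid_vec (f : {ffun 'I_p -> 'I_(N.*2.+1)}) : 'cV[R]_p :=
  \col_i (((f i)%:R - N%:R) / N%:R).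

Let NR0 : 0 < N%:R :> R. Proof. by rewrite ltr0n. Qed.

Lemma coord_le_norm2 (u : 'cV[R]_p) i : `|u i 0| <= norm2 u.
Proof.
rewrite -(@ler_pXn2r _ 2)// ?nnegrE ?norm2_ge0// real_normK ?num_real//.
rewrite norm2_sqr /dotv (bigD1 i)//= -expr2 lerDl.
by apply: sumr_ge0 => j _; rewrite -expr2 sqr_ge0.
Qed.

(** Coordinates are rounded towards 0, so the norm does not increase and the grid point stays in the
    ball where the moment bounds hold. Each coordinate moves by at most 1 / N, and sqrt(p) <= p. *)
Lemma grid_rounding (u : 'cV[R]_p) : norm2 u <= 1 ->
  exists f, norm2 (grid_vec f) <= 1 /\ norm2 (u - grid_vec f) <= p%:R / N%:R.
Proof.
move=> u1.
have cell i : exists k : 'I_(N.*2.+1),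
    `|(k%:R - N%:R) / N%:R| <= `|u i 0| /\
    `|u i 0 - (k%:R - N%:R) / N%:R| <= N%:R^-1.
  set x := u i 0.
  have x1 : `|x| <= 1 by exact: le_trans (coord_le_norm2 u i) u1.
  have xN0 : 0 <= `|x| * N%:R by rewrite mulr_ge0.
  pose m := Num.trunc (`|x| * N%:R).
  have /andP[m1 m2] : m%:R <= `|x| * N%:R < m.+1%:R by exact: truncn_itv.
  have mN : (m <= N)%N.
    by rewrite -(ler_nat R) (le_trans m1)// ler_piMl.
  have mx : m%:R / N%:R <= `|x| by rewrite ler_pdivrMr.
  have xm : `|x| - m%:R / N%:R <= N%:R^-1.
    rewrite lerBlDr -(ler_pM2r NR0) mulrDl mulVf ?gt_eqF// divfK ?gt_eqF//.
    by rewrite addrC natr1 ltW.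
  have [x0|x0] := leP 0 x.
    have kN : (N + m < N.*2.+1)%N by rewrite ltnS -addnn leq_add2l.
    exists (Ordinal kN) => /=; rewrite natrD addrAC subrr add0r.
    rewrite (ger0_norm x0) in mx xm *.
    by rewrite !ger0_norm ?subr_ge0 ?divr_ge0.
  have kN : (N - m < N.*2.+1)%N by rewrite ltnS -addnn leq_subLR; lia.
  exists (Ordinal kN) => /=; rewrite natrB// addrAC subrr add0r.
  rewrite (ltr0_norm x0) in mx xm *.
  rewrite mulNr normrN opprK ger0_norm ?divr_ge0//; split => //.
  by rewrite ler0_norm; lra.
have /choice[k Hk] := cell.
exists [ffun i => k i]; split.
  rewrite -(@ler_pXn2r _ 2)// ?nnegrE ?norm2_ge0// norm2_sqr.
  apply: (@le_trans _ _ (norm2 u ^+ 2)); last by rewrite lerXn2r ?nnegrE ?norm2_ge0.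
  rewrite norm2_sqr; apply: ler_sum => i _; rewrite !mxE ffunE -!expr2.
  rewrite -[leLHS]real_normK ?num_real// -[leRHS]real_normK ?num_real//.
  by rewrite lerXn2r ?nnegrE//; case: (Hk i).
rewrite -(@ler_pXn2r _ 2)// ?nnegrE ?norm2_ge0 ?divr_ge0// norm2_sqr.
apply: (@le_trans _ _ (\sum_(i < p) N%:R^-1 ^+ 2)).
  apply: ler_sum => i _; rewrite !mxE ffunE -expr2.
  rewrite -[leLHS]real_normK ?num_real// lerXn2r ?nnegrE ?invr_ge0//.
  by case: (Hk i).
rewrite sumr_const card_ord -[leLHS]mulr_natl exprMn ler_wpM2r ?sqr_ge0//.
rewrite -natrX ler_nat; case: (p) => // q; by rewrite -mulnn leq_pmulr.
Qed.

Lemma card_grid : #|{: {ffun 'I_p -> 'I_(N.*2.+1)}}| = (N.*2.+1 ^ p)%N.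
Proof. by rewrite card_ffun !card_ord. Qed.

End unit_ball_grid.

(** * Lipschitz dependence of the summands on the directions u and v *)

Section score_lipschitz.
Context (R : realType) (p : nat) (alpha : nat) (H : R -> R) (C h r e : R).
Hypotheses (kf : kernel_facts alpha H C) (h0 : 0 < h) (h1 : h <= 1).
Hypotheses (r0 : 0 <= r) (r1 : r <= 1) (C0 : 0 <= C) (e0 : 0 <= e).
Local Notation ip z u := (dotv (colv z) u).
Local Notation K1 := (H^`()%classic).
Local Notation K2 := (H^`(2)%classic).
Variables (u u' v v' : 'cV[R]_p).
Hypotheses (nu : norm2 u <= 1) (nu' : norm2 u' <= 1).
Hypotheses (nv : norm2 v <= 1) (nv' : norm2 v' <= 1).
Hypotheses (du : norm2 (u - u') <= e) (dv : norm2 (v - v') <= e).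

Let ip_le z (w : 'cV[R]_p) (K : R) : norm2 w <= K -> `|ip z w| <= norm2 (colv z) * K.
Proof. by move=> wK; rewrite (le_trans (dotv_le_norm2 _ _))// ler_wpM2l// norm2_ge0. Qed.

Let arg_lip (f : R -> R) (t c c' : R) : (forall x y : R, `|f x - f y| <= C * `|x - y|) ->
  `|f ((t + c) / h) - f ((t + c') / h)| <= C * (`|c - c'| / h).
Proof.
move=> fC; rewrite (le_trans (fC _ _))// ler_wpM2l//.
have -> : (t + c) / h - (t + c') / h = (c - c') / h by field; rewrite gt_eqF.
by rewrite normrM [`|h^-1|]gtr0_norm ?invr_gt0.
Qed.

Let S_poly (S : R) : 0 <= S -> S ^+ 3 + 4 * S ^+ 2 <= 8 * (1 + S ^+ 2) ^+ 2.
Proof.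
move=> S0.
have s2 := sqr_ge0 S; have s4 := sqr_ge0 (S ^+ 2).
have : 0 <= S ^+ 2 * (S - 1) ^+ 2 by rewrite mulr_ge0 ?sqr_ge0.
have -> : 8 * (1 + S ^+ 2) ^+ 2 = 8 + 16 * S ^+ 2 + 8 * (S ^+ 2) ^+ 2 by ring.
have -> : S ^+ 2 * (S - 1) ^+ 2 = (S ^+ 2) ^+ 2 - 2 * S ^+ 3 + S ^+ 2 by ring.
lra.
Qed.

Let hV1 : 1 <= h^-1. Proof. by rewrite invf_ge1. Qed.
Let hV0 : 0 <= h^-1. Proof. exact: le_trans hV1. Qed.

(** The prefactor gives h^-2 and the rescaled argument of H'' one more h^-1. The powers of S = |Z|
    that appear, S^2 and S^3, are absorbed by [S_poly]. *)
Lemma hess_term_lipschitz q :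
  `|hess_term H h (r *: u) v q - hess_term H h (r *: u') v' q| <=
  8 * C * h ^- 3 * e * (1 + norm2 (colv q.1) ^+ 2) ^+ 2.
Proof.
set z := q.1; set S := norm2 (colv z).
have S0 : 0 <= S by exact: norm2_ge0.
rewrite /hess_term -/z; set c := ip z (r *: u); set c' := ip z (r *: u').
set y := ip z v; set y' := ip z v'.
have cc : `|c - c'| <= S * e.
  rewrite /c /c' -dotvBr -scalerBr dotvZr normrM (ger0_norm r0).
  apply: (@le_trans _ _ (1 * (S * e))); last by rewrite mul1r.
  by apply: ler_pM => //; exact: ip_le.
have yS : `|y| <= S by have := ip_le z nv; rewrite mulr1.
have yS' : `|y'| <= S by have := ip_le z nv'; rewrite mulr1.
have yy : `|y - y'| <= S * e by rewrite /y /y' -dotvBr; exact: ip_le.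
set k := K2 _; set k' := K2 _.
have kk : `|k - k'| <= C * (S * e / h).
  rewrite (le_trans (arg_lip _ _ _ (kf_lip2 kf)))// ler_wpM2l//.
  by rewrite ler_wpM2r.
have kC : `|k'| <= C by exact: (kf_bound2 kf).
have -> : h ^- 2 * k * y ^+ 2 - h ^- 2 * k' * y' ^+ 2 =
  h ^- 2 * ((k - k') * y ^+ 2 + k' * ((y - y') * (y + y'))) by ring.
rewrite normrM ger0_norm ?invr_ge0 ?sqr_ge0//.
have -> : 8 * C * h ^- 3 * e * (1 + S ^+ 2) ^+ 2 =
  h ^- 2 * (h^-1 * (C * e) * (8 * (1 + S ^+ 2) ^+ 2)) by field; rewrite gt_eqF.
rewrite ler_wpM2l ?invr_ge0 ?sqr_ge0//.
apply: (@le_trans _ _ (h^-1 * (C * e) * (S ^+ 3 + 4 * S ^+ 2))); last first.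
  by apply: ler_wpM2l; [rewrite !mulr_ge0|exact: S_poly].
rewrite (le_trans (ler_normD _ _))//.
have t1 : `|(k - k') * y ^+ 2| <= h^-1 * (C * e) * S ^+ 3.
  rewrite normrM normrX.
  have -> : h^-1 * (C * e) * S ^+ 3 = C * (S * e / h) * S ^+ 2 by ring.
  by apply: ler_pM => //; rewrite lerXn2r ?nnegrE.
have t2 : `|k' * ((y - y') * (y + y'))| <= h^-1 * (C * e) * (4 * S ^+ 2).
  rewrite !normrM.
  apply: (@le_trans _ _ (C * (S * e * (S + S)))).
    apply: ler_pM => //.
    apply: ler_pM => //; rewrite (le_trans (ler_normD _ _))// lerD//.
  have -> : C * (S * e * (S + S)) = 1 * (C * e) * (2 * S ^+ 2) by ring.
  apply: ler_pM.
  - by rewrite mul1r mulr_ge0.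
  - by rewrite mulr_ge0// sqr_ge0.
  - by rewrite ler_wpM2r// mulr_ge0.
  - by rewrite ler_wpM2r ?sqr_ge0// ler_nat.
by rewrite [leRHS]mulrDr lerD.
Qed.

(** Every part of the difference contains c' or c - c', both proportional to r, which cancels r^-1.
    Hence the same constant as for the Hessian. *)
Lemma newton_term_lipschitz q :
  `|r^-1 * newton_term H h (r *: u) v q - r^-1 * newton_term H h (r *: u') v' q| <=
  8 * C * h ^- 3 * e * (1 + norm2 (colv q.1) ^+ 2) ^+ 2.
Proof.
have rhs0 : 0 <= 8 * C * h ^- 3 * e * (1 + norm2 (colv q.1) ^+ 2) ^+ 2.
  by apply: mulr_ge0; rewrite ?sqr_ge0//; do ![apply: mulr_ge0 => //]; rewrite invr_ge0 exprn_ge0// ltW.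
have [r00|rn] := eqVneq r 0; first by rewrite r00 invr0 !mul0r subr0 normr0.
have rp : 0 < r by rewrite lt_def rn.
have rV0 : 0 <= r^-1 by rewrite invr_ge0.
rewrite -mulrBr normrM (ger0_norm rV0).
move: rhs0 => _; set z := q.1; set S := norm2 (colv z).
have S0 : 0 <= S by exact: norm2_ge0.
rewrite /newton_term -/z; set c := ip z (r *: u); set c' := ip z (r *: u').
set y := ip z v; set y' := ip z v'.
have cc : `|c - c'| <= r * (S * e).
  rewrite /c /c' -dotvBr -scalerBr dotvZr normrM (ger0_norm r0).
  by apply: ler_wpM2l => //; exact: ip_le.
have cS : `|c| <= S.
  rewrite /c dotvZr normrM (ger0_norm r0).
  apply: (@le_trans _ _ (1 * S)); last by rewrite mul1r.
  by apply: ler_pM => //; have := ip_le z nu; rewrite mulr1.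
have cS' : `|c'| <= r * S.
  rewrite /c' dotvZr normrM (ger0_norm r0) ler_wpM2l//.
  by have := ip_le z nu'; rewrite mulr1.
have yS : `|y| <= S by have := ip_le z nv; rewrite mulr1.
have yy : `|y - y'| <= S * e by rewrite /y /y' -dotvBr; exact: ip_le.
set k := K2 _; set k1 := K1 _; set k' := K2 ((_ + c') / h); set k1' := K1 ((_ + c') / h).
set k0 := K1 (q.2 / h).
have kk : `|k - k'| <= C * (`|c - c'| / h) by exact: arg_lip (kf_lip2 kf).
have kk1 : `|k1 - k1'| <= C * (`|c - c'| / h) by exact: arg_lip (kf_lip1 kf).
have kC : `|k'| <= C by exact: (kf_bound2 kf).
have k01 : `|k1' - k0| <= C * (`|c'| / h).
  have := arg_lip q.2 c' 0 (kf_lip1 kf); rewrite addr0 subr0; exact.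
set X := k * c - h * k1 + h * k0; set X' := k' * c' - h * k1' + h * k0.
have XX : `|X - X'| <= r * (C * (S * e) * (S / h + 2)).
  have -> : X - X' = (k - k') * c + (k' * (c - c') - h * (k1 - k1')) by rewrite /X /X'; ring.
  apply: (@le_trans _ _ (C * (`|c - c'| / h) * S + (C * `|c - c'| + h * (C * (`|c - c'| / h))))).
    rewrite (le_trans (ler_normD _ _))// lerD//; first by rewrite normrM ler_pM.
    rewrite (le_trans (ler_normB _ _))// lerD//; first by rewrite normrM ler_wpM2r.
    by rewrite normrM gtr0_norm// ler_wpM2l// ltW.
  have -> : C * (`|c - c'| / h) * S + (C * `|c - c'| + h * (C * (`|c - c'| / h))) =
     `|c - c'| * (C * (S / h + 2)) by field; rewrite gt_eqF.
  have -> : r * (C * (S * e) * (S / h + 2)) = r * (S * e) * (C * (S / h + 2)) by ring.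
  by rewrite ler_wpM2r// mulr_ge0// addr_ge0// mulr_ge0.
have X'S : `|X'| <= r * (2 * C * S).
  have -> : X' = k' * c' - h * (k1' - k0) by rewrite /X'; ring.
  apply: (@le_trans _ _ (C * `|c'| + h * (C * (`|c'| / h)))).
    rewrite (le_trans (ler_normB _ _))// lerD//; first by rewrite normrM ler_wpM2r.
    by rewrite normrM gtr0_norm// ler_wpM2l// ltW.
  have -> : C * `|c'| + h * (C * (`|c'| / h)) = 2 * C * `|c'| by field; rewrite gt_eqF.
  have -> : r * (2 * C * S) = 2 * C * (r * S) by ring.
  by rewrite ler_wpM2l// mulr_ge0.
have -> : h ^- 2 * X * y - h ^- 2 * X' * y' =
  h ^- 2 * ((X - X') * y + X' * (y - y')) by ring.
rewrite normrM ger0_norm ?invr_ge0 ?sqr_ge0//.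
have -> : 8 * C * h ^- 3 * e * (1 + S ^+ 2) ^+ 2 =
  r^-1 * (h ^- 2 * (r * (h^-1 * (C * e) * (8 * (1 + S ^+ 2) ^+ 2)))).
  by field; rewrite rn gt_eqF.
rewrite ler_wpM2l// ler_wpM2l ?invr_ge0 ?sqr_ge0//.
apply: (@le_trans _ _ (r * (h^-1 * (C * e) * (S ^+ 3 + 4 * S ^+ 2)))); last first.
  by rewrite ler_wpM2l//; apply: ler_wpM2l; [rewrite !mulr_ge0|exact: S_poly].
rewrite (le_trans (ler_normD _ _))//.
apply: (@le_trans _ _ (r * (C * (S * e) * (S / h + 2)) * S + r * (2 * C * S) * (S * e))).
  by rewrite lerD// normrM ler_pM.
have -> : r * (C * (S * e) * (S / h + 2)) * S + r * (2 * C * S) * (S * e) =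
  r * (h^-1 * (C * e) * S ^+ 3 + 1 * (C * e) * (4 * S ^+ 2)) by ring.
rewrite ler_wpM2l// mulrDr lerD2l.
apply: ler_wpM2r; first by rewrite mulr_ge0// sqr_ge0.
by apply: ler_wpM2r => //; rewrite mulr_ge0.
Qed.

End score_lipschitz.

Section signed_terms.
Context (R : realType) (p : nat) (beta : 'cV[R]_p).
Implicit Types (f : p.-tuple R * R -> R) (g : R * p.-tuple R * R).

Definition obs_zeta g : R := g.1.1 + dotv (colv g.1.2) beta.

(* The summand - Y f(Z, zeta) as a function of (X, Z, epsilon). *)
Definition signed f g : R :=
  - (if 0 <= obs_zeta g + g.2 then 1 else -1) * f (g.1.2, obs_zeta g).

Lemma norm_signed f g : `|signed f g| = `|f (g.1.2, obs_zeta g)|.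
Proof.
by rewrite /signed; case: ifP => _; rewrite ?opprK ?mulN1r ?mul1r ?normrN.
Qed.

Lemma signed_sqr f g : signed f g ^+ 2 = f (g.1.2, obs_zeta g) ^+ 2.
Proof. by rewrite -[LHS]real_normK ?num_real// norm_signed real_normK ?num_real. Qed.

Lemma signedB f1 f2 g : signed f1 g - signed f2 g = signed (fun q => f1 q - f2 q) g.
Proof. by rewrite /signed mulrBr. Qed.

Lemma measurable_obs_zeta : measurable_fun setT obs_zeta.
Proof.
have m1 : measurable_fun setT (fun g : R * p.-tuple R * R => g.1.1).
  exact: measurableT_comp.
have m2 : measurable_fun setT (fun g : R * p.-tuple R * R => g.1.2).
  exact: measurableT_comp.
by apply: measurable_funD => //; exact: (measurableT_comp (measurable_dotv_colv beta) m2).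
Qed.

Lemma measurable_signed f : measurable_fun setT f -> measurable_fun setT (signed f).
Proof.
move=> mf; apply: measurable_funM.
  apply: measurableT_comp => //.
  apply: measurable_fun_ifT => //; apply: measurable_fun_ler => //.
  by apply: measurable_funD => //; exact: measurable_obs_zeta.
apply: (measurableT_comp mf); apply: measurable_fun_pair; last exact: measurable_obs_zeta.
exact: measurableT_comp.
Qed.

End signed_terms.

Section sample_means.
Context (R : realType) (d : measure_display) (T : measurableType d) (n p : nat)
  (beta : 'cV[R]_p) (s : 'I_n -> observation R T p) (H : R -> R) (h : R).
Hypothesis h0 : 0 < h.
Implicit Types (u v x : 'cV[R]_p) (w : T).
Local Notation ip z u := (dotv (colv z) u).
Local Notation K1 := (H^`()%classic).
Local Notation K2 := (H^`(2)%classic).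
Local Notation ze i w := (zeta beta (s i) w).
Local Notation Z i w := (obsZ (s i) w).
Local Notation y i w := (response beta (s i) w).
Local Notation hess w b := (hess_loss beta s H h w b).
Local Notation grad w b := (grad_loss beta s H h w b).
Local Notation mean f w := (n%:R^-1 * \sum_(i < n) signed beta f (obs_triple (s i) w)).

Let argE i w u : obsX (s i) w + dotv (zvec (s i) w) (beta + u) =
  ze i w + ip (Z i w) u.
Proof. by rewrite dotvDr addrA. Qed.

Let dotv_hess w u v x : dotv v (hess w (beta + u) *m x) =
  n%:R^-1 * \sum_(i < n) (- y i w * (h ^- 2 * K2 ((ze i w + ip (Z i w) u) / h) *
    ip (Z i w) x * ip (Z i w) v)).
Proof.
rewrite /hess_loss -scalemxAl dotvZr invfM -mulrA; congr (_ * _).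
rewrite mulmx_suml dotvC dotv_suml mulr_sumr; apply: eq_bigr => i _.
by rewrite argE -scalemxAl dotv_col_row !dotvZl /zvec; ring.
Qed.

Let dotv_grad w u v : dotv v (grad w (beta + u)) =
  n%:R^-1 * \sum_(i < n) (- y i w * (h^-1 * K1 ((ze i w + ip (Z i w) u) / h) *
    ip (Z i w) v)).
Proof.
rewrite /grad_loss dotvZr invfM -mulrA; congr (_ * _).
rewrite dotvC dotv_suml mulr_sumr; apply: eq_bigr => i _.
by rewrite argE dotvZl /zvec; ring.
Qed.

Lemma mean_hess w u v : mean (hess_term H h u v) w = dotv v (hess w (beta + u) *m v).
Proof.
rewrite dotv_hess; congr (_ * _); apply: eq_bigr => i _.
by rewrite /signed /hess_term /obs_zeta /= -/(zeta beta (s i) w) -/(response beta (s i) w); ring.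
Qed.

Lemma mean_grad w v : mean (grad_term H h v) w = dotv v (grad w beta).
Proof.
rewrite -[X in grad w X]addr0 dotv_grad; congr (_ * _); apply: eq_bigr => i _.
by rewrite /signed /grad_term /obs_zeta /= dotv0r addr0.
Qed.

Lemma mean_newton w u v : mean (newton_term H h u v) w =
  dotv v (hess w (beta + u) *m u - grad w (beta + u) + grad w beta).
Proof.
have g0 := dotv_grad w 0 v; rewrite addr0 in g0.
rewrite dotvDr dotvBr g0 dotv_hess dotv_grad -mulrBr -mulrDr -sumrB -big_split /=.
congr (_ * _); apply: eq_bigr => i _.
rewrite /signed /newton_term /obs_zeta /= -/(zeta beta (s i) w) -/(response beta (s i) w).
by rewrite dotv0r addr0; field; rewrite gt_eqF.
Qed.

End sample_means.

(** Coercivity excludes a kernel, so [invmx G] is a true inverse on the good event and the equation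
    for the error may be tested against the error's own direction. *)
Lemma newton_error (R : realType) (p : nat) (G : 'M[R]_p) (g b beta : 'cV[R]_p) (c e : R) :
  0 < c -> (forall v, norm2 v = 1 -> c <= dotv v (G *m v)) ->
  (forall v, norm2 v = 1 -> `|dotv v (G *m (b - beta) - g)| <= e) -> 0 <= e ->
  norm2 (b - invmx G *m g - beta) <= c^-1 * e.
Proof.
move=> c0 Gc Ge e0.
have nrm (v : 'cV[R]_p) : v != 0 -> c * norm2 v <= (norm2 v)^-1 * dotv v (G *m v).
  move=> v0; have n0 : 0 < norm2 v by rewrite lt_def norm2_eq0 v0 norm2_ge0.
  have := Gc _ (norm2_normalize v0).
  rewrite dotvZl -scalemxAr dotvZr mulrA => cv.
  rewrite -ler_pdivlMr//; apply: le_trans cv _.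
  by rewrite mulrAC.
have uG : G \in unitmx.
  rewrite unitmxE unitfE; apply/negP => /det0P[v v0 vG].
  have := nrm v^T; rewrite dotv_mulmx -trmx_mul vG trmx0 dotv0l mulr0.
  have vT0 : v^T != 0 by rewrite -[v]trmxK in v0; apply: contra v0 => /eqP ->; rewrite trmx0.
  move=> /(_ vT0); rewrite leNgt mulr_gt0//.
  by rewrite lt_def norm2_eq0 vT0 norm2_ge0.
set x := (X in norm2 X).
have Gx : G *m x = G *m (b - beta) - g.
  by rewrite /x addrAC mulmxBr mulKVmx.
have [->|x0] := eqVneq x 0; first by rewrite norm2_0 mulr_ge0// invr_ge0 ltW.
rewrite -(ler_pM2l c0) mulrA divff ?gt_eqF// mul1r.
apply: (le_trans (nrm x x0)); apply: le_trans (Ge _ (norm2_normalize x0)).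
by rewrite -Gx dotvZl ler_norm.
Qed.

(** Meant for the entries of V: their integrand contains a derivative of the random c.d.f., which is
    controlled only almost everywhere. *)
Lemma ae_eq_integral_any d (T : measurableType d) (R : realType)
    (m : {measure set T -> \bar R}) (f g : T -> \bar R) :
  {ae m, forall x, f x = g x} -> (\int[m]_x f x = \int[m]_x g x)%E.
Proof.
move=> fg; rewrite integralE [RHS]integralE; congr (_ - _)%E;
  apply: ae_eq_ge0_lower_integral => //; apply: filterS fg => x fgx.
  by rewrite !funeposE fgx.
by rewrite !funenegE fgx.
Qed.

Lemma Rintegral_sum d (T : measurableType d) (R : realType)
    (m : {measure set T -> \bar R}) (I : Type) (r : seq I) (f : I -> T -> R) :
  (forall i, m.-integrable setT (EFin \o f i)) ->
  \int[m]_x (\sum_(i <- r) f i x) = \sum_(i <- r) \int[m]_x f i x.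
Proof.
move=> fi; have si (t : seq I) : m.-integrable setT (EFin \o (fun x => \sum_(i <- t) f i x)).
  rewrite (_ : EFin \o _ = (fun x => \sum_(i <- t) (f i x)%:E)%E).
    by apply: integrable_sum => // i _; exact: fi.
  by apply/funext => x /=; rewrite sumEFin.
elim: r => [|i r IH].
  under eq_Rintegral do rewrite big_nil.
  by rewrite big_nil /Rintegral integral0.
under eq_Rintegral do rewrite big_cons.
by rewrite big_cons -IH -(RintegralD measurableT (fi i) (si r)).
Qed.

Lemma dotv_delta (R : realType) (p : nat) (u : 'cV[R]_p) i : dotv u (delta_mx i 0) = u i 0.
Proof.
rewrite /dotv (bigD1 i)//= big1 ?addr0; first by rewrite mxE !eqxx mulr1.
by move=> j ji; rewrite mxE (negbTE ji) mulr0.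
Qed.

Lemma norm2_delta (R : realType) (p : nat) i : norm2 (delta_mx i 0 : 'cV[R]_p) = 1.
Proof. by rewrite /norm2 dotv_delta mxE !eqxx sqrtr1. Qed.

(** * The population curvature V as a quadratic form *)

Section curvature.
Context (R : realType) (alpha : nat) (C eta : R) (d : measure_display)
  (T : measurableType d) (P : probability T R) (p : nat) (beta : 'cV[R]_p)
  (o : observation R T p) (rho : p.-tuple R -> R -> R)
  (k : R.-pker (p.-tuple R) ~> R).
Hypothesis M : regular_model alpha C eta P beta o rho k.
Hypothesis C1 : 1 <= C.
Hypothesis eta0 : 0 < eta.
Local Notation Z := (obsZ o).
Local Notation ip z u := (dotv (colv z) u).
Local Notation Cm := (moment_bound C eta).
Let C0 : 0 <= C. Proof. exact: le_trans C1. Qed.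

Lemma Vmx_sym : (Vmx P o rho k)^T = Vmx P o rho k.
Proof.
apply/matrixP => i j; rewrite !mxE; congr (_ * _).
by apply: eq_Rintegral => w _; congr (_ * _); rewrite mulrC.
Qed.

Variable Z0 : T -> R.
Hypothesis mZ0 : measurable_fun setT Z0.
Hypothesis Z0C : forall w, `|Z0 w| <= C * C.
Hypothesis Z0E : {ae P, forall w, Z0 w = rho (Z w) 0 * (cond_cdf k (Z w))^`()%classic 0}.

Let e_ (i : 'I_p) : 'cV[R]_p := delta_mx i 0.
Let ip_e z i : ip z (e_ i) = colv z i 0. Proof. exact: dotv_delta. Qed.
Let norm_e i : norm2 (e_ i) <= 1. Proof. by rewrite norm2_delta. Qed.

Let int_entry i j : P.-integrable setT
  (EFin \o (fun w => Z0 w * (zvec o w i 0 * zvec o w j 0))).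
Proof.
have CC : 0 <= C * C by exact: mulr_ge0.
apply: (le_integrable_EFin _ _ (integrable_poly_weight M C1 eta0 CC (norm_e i) (norm_e j))).
  apply: measurable_funM => //; rewrite /zvec; under eq_fun do rewrite -!ip_e.
  by apply: measurable_funM; exact: measurable_ip.
move=> w; rewrite normrM ler_pM// /zvec -!ip_e /poly_weight normrM.
set x := ip _ (e_ i); set y := ip _ (e_ j).
have X := sqr_ge0 x; have Y := sqr_ge0 y.
have := sqr_ge0 (`|x| - `|y|); rewrite sqrrB !real_normK ?num_real// => Q.
have xy : 0 <= `|x| * `|y| by rewrite mulr_ge0.
apply: (@le_trans _ _ ((1 + x ^+ 2 + y ^+ 2) * 1)); first by lra.
by rewrite expr2 ler_pM//; lra.
Qed.

(** Replacing rho(0|Z) F'(0|Z) by [Z0] leaves the entries unchanged and makes them integrals of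
    integrable functions, so the double sum goes under the integral. *)
Lemma Vmx_quadratic v : dotv v (Vmx P o rho k *m v) =
  \int[P]_w (2 * (Z0 w * ip (Z w) v ^+ 2)).
Proof.
have VE i j : Vmx P o rho k i j = 2 * \int[P]_w (Z0 w * (zvec o w i 0 * zvec o w j 0)).
  rewrite mxE; congr (_ * _); congr fine; apply: ae_eq_integral_any.
  by apply: filterS Z0E => w ->.
transitivity (\sum_(i < p) \sum_(j < p)
    \int[P]_w (2 * (v i 0 * v j 0) * (Z0 w * (zvec o w i 0 * zvec o w j 0)))).
  apply: eq_bigr => i _; rewrite mxE mulr_sumr; apply: eq_bigr => j _.
  by rewrite VE RintegralZl//; ring.
have iZ i j : P.-integrable setT
   (EFin \o (fun w => 2 * (v i 0 * v j 0) * (Z0 w * (zvec o w i 0 * zvec o w j 0)))).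
  apply: (eq_integrable measurableT); last exact: (integrableZl measurableT
    (2 * (v i 0 * v j 0)) (int_entry i j)).
  by move=> w _; rewrite /= EFinM.
rewrite pair_bigA -Rintegral_sum/=; last by move=> ij; exact: iZ.
apply: eq_Rintegral => w _; rewrite -(pair_bigA _ (fun i j =>
   2 * (v i 0 * v j 0) * (Z0 w * (zvec o w i 0 * zvec o w j 0))))/=.
rewrite expr2 {1}/dotv mulr_suml !mulr_sumr; apply: eq_bigr => i _.
rewrite {1}/dotv !mulr_sumr; apply: eq_bigr => j _.
by rewrite /zvec; ring.
Qed.

End curvature.

Lemma finite_union_bound d (T : measurableType d) (R : realType)
    (m : {measure set T -> \bar R}) (J : finType) (B : J -> set T) (e : R) :
  (forall j, measurable (B j)) -> (forall j, (m (B j) <= e%:E)%E) ->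
  measurable (\big[setU/set0]_j B j) /\
  (m (\big[setU/set0]_j B j) <= (#|J|%:R * e)%:E)%E.
Proof.
have -> : #|J|%:R * e = \sum_(j : J) e by rewrite sumr_const mulr_natl.
move=> mB Be.
elim: (index_enum J) => [|j r [mr IH]]; first by rewrite !big_nil measure0.
rewrite !big_cons; split; first exact: measurableU.
by rewrite (le_trans (measureU2 m (mB j) mr))// EFinD; exact: leeD (Be j) IH.
Qed.

(** For n >= 2, each coordinate takes 2 n^6 + 1 <= 4 n^6 <= n^8 values, and a pair of vectors has 2
    p coordinates. *)
Lemma grid_pairs_le n p : (2 <= n)%N -> (0 < p)%N ->
  (((n ^ 6).*2.+1) ^ p * ((n ^ 6).*2.+1) ^ p <= n ^ (16 * p))%N.
Proof.
move=> n2 p0; rewrite -expnMn expnM leq_exp2r//.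
have -> : 16%N = (8 + 8)%N by [].
rewrite expnD; have N0 : (0 < n ^ 6)%N by rewrite expn_gt0 (leq_trans _ n2).
suff le1 : ((n ^ 6).*2.+1 <= n ^ 8)%N by rewrite leq_mul.
have -> : (n ^ 8 = n ^ 6 * (n * n))%N by rewrite !expnSr !mulnA.
have n4 : (4 <= n * n)%N by rewrite (@leq_mul 2 2).
apply: (@leq_trans (n ^ 6 * 4)%N); last by rewrite leq_mul2l n4 orbT.
by move: N0; clear; case: (n ^ 6)%N => //; lia.
Qed.

Lemma ln_nat_ge_half (R : realType) (n : nat) : (2 <= n)%N -> 2^-1 <= ln n%:R :> R.
Proof.
move=> n2; have n0 : 0 < n%:R :> R by rewrite ltr0n (leq_trans _ n2).
have := expR_ge1Dx (- ln n%:R : R); rewrite expRN lnK ?posrE// => H.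
have : n%:R^-1 <= 2^-1 :> R by rewrite lef_pV2 ?posrE// ler_nat.
by lra.
Qed.

Lemma le_of_close (R : realType) (S m V a b c : R) :
  `|S - m| <= a -> `|m - V| <= b -> c <= V -> c - b - a <= S.
Proof. by rewrite !ler_norml => /andP[? ?] /andP[? ?] ?; lra. Qed.

Lemma sum_products_le (R : realType) (A L K x1 x2 x3 r q : R) :
  0 <= A -> 0 <= L -> 0 <= K -> 0 <= x1 -> 0 <= x2 -> 0 <= x3 -> 0 <= r * q ->
  A * x1 + r * (L * q) + (A * x2 + K * x3) <= (A + L + K) * (x1 + x2 + x3 + r * q).
Proof.
move=> A0 L0 K0 x10 x20 x30; have -> : r * (L * q) = L * (r * q) by ring.
set x4 := r * q => x40.
have := mulr_ge0 A0 x30; have := mulr_ge0 A0 x40.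
have := mulr_ge0 L0 x10; have := mulr_ge0 L0 x20; have := mulr_ge0 L0 x30.
have := mulr_ge0 K0 x10; have := mulr_ge0 K0 x20; have := mulr_ge0 K0 x40.
by rewrite !mulrDl !mulrDr; lra.
Qed.

(** * Uniform deviations and the Newton step at a fixed sample size *)

Section one_step.
Context (R : realType) (alpha : nat) (H : R -> R) (C eta : R) (d : measure_display)
  (T : measurableType d) (P : probability T R) (p n : nat) (beta : 'cV[R]_p)
  (o : observation R T p) (s : 'I_n -> observation R T p) (rho : p.-tuple R -> R -> R)
  (k : R.-pker (p.-tuple R) ~> R).
Hypothesis kf : kernel_facts alpha H C.
Hypothesis M : regular_model alpha C eta P beta o rho k.
Hypothesis C1 : 1 <= C.
Hypothesis eta0 : 0 < eta.
Hypothesis alpha2 : (2 <= alpha)%N.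
Hypothesis iid : iid_copies P o s.
Hypothesis n2 : (2 <= n)%N.
Hypothesis pn : (p <= n)%N.
Hypothesis p0 : (0 < p)%N.
Variables (h : R).
Hypothesis h0 : 0 < h.

Local Notation Z := (obsZ o).
Local Notation ze := (zeta beta o).
Local Notation ip z u := (dotv (colv z) u).
Local Notation Cm := (moment_bound C eta).
Local Notation D := (response_density_bound alpha C).
Local Notation W i := (obs_triple (s i)).
Local Notation W0 := (obs_triple o).
Local Notation mean f := (\int[P]_w (- response beta o w * f (Z w, ze w))).
(** With A = 2 C h^-2, the bound 4 h C A^2 Cm of [exp_moment_window] is K0 / h^3. *)
Local Notation K0 := (16 * C ^+ 3 * Cm).
Implicit Types u v : 'cV[R]_p.

Let C0 : 0 <= C. Proof. exact: le_trans C1. Qed.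
Let Cp : 0 < C. Proof. exact: lt_le_trans C1. Qed.
Let n0 : (0 < n)%N. Proof. exact: leq_trans n2. Qed.
Let nR0 : 0 < n%:R :> R. Proof. by rewrite ltr0n. Qed.
Let pR0 : 0 < p%:R :> R. Proof. by rewrite ltr0n. Qed.

Let mtriple (o' : observation R T p) : measurable_fun setT (obs_triple o').
Proof. by apply: measurable_fun_pair => //; exact: measurable_fun_pair. Qed.
Let mW i : measurable_fun setT (W i). Proof. exact: mtriple. Qed.
Let mW0 : measurable_fun setT W0. Proof. exact: mtriple. Qed.

Let Cmp : 0 < Cm. Proof. exact: moment_bound_gt0. Qed.

Let K0p : 0 < K0.
Proof. by apply: mulr_gt0 => //; apply: mulr_gt0 => //; exact: exprn_gt0. Qed.


(** The two-sided Chernoff bound with B = K0 / h^3. Its parameter l = t / (2 B) times A = 2 C h^-2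
    equals t h C / K0, which has to be at most eta / 2. *)
Lemma mean_deviation (f : p.-tuple R * R -> R) (u1 u2 a b : 'cV[R]_p) (t : R) :
  measurable_fun setT f -> 0 <= t -> t * h * C / K0 <= eta / 2 ->
  norm2 a <= 1 -> norm2 b <= 1 ->
  (forall q, `|f q| <= 2 * C * h ^- 2 * (`|ip q.1 a| * `|ip q.1 b|) *
     ((`|q.2 + ip q.1 u1| <= h)%R || (`|q.2 + ip q.1 u2| <= h)%R)%:R) ->
  (P [set w | n%:R * t <=
       `|\sum_(i < n) signed beta f (W i w) - n%:R * mean f| ]%R <=
   (2 * expR (- (n%:R * (t ^+ 2 * h ^+ 3 / (4 * K0)))))%:E)%E.
Proof.
move=> mf t0 tK a1 b1 fA.
have hn : h != 0 by rewrite gt_eqF.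
have Cn : C != 0 by rewrite gt_eqF.
have Cmn : Cm != 0 by rewrite gt_eqF.
pose B := K0 / h ^+ 3.
have B0 : 0 < B by rewrite divr_gt0// exprn_gt0.
have -> : t ^+ 2 * h ^+ 3 / (4 * K0) = t ^+ 2 / (4 * B).
  by rewrite /B; field; rewrite hn Cn Cmn.
apply: (chernoff_two_sided mW mW0 iid.2 iid.1 (measurable_signed beta mf) B0 t0).
under eq_integral do rewrite signed_sqr norm_signed.
have A0 : 0 <= 2 * C * h ^- 2 by rewrite !mulr_ge0// invr_ge0 sqr_ge0.
have l0 : 0 <= t / (2 * B) by rewrite divr_ge0// mulr_ge0// ltW.
have lA : t / (2 * B) * (2 * C * h ^- 2) <= eta / 2.
  apply: le_trans tK; rewrite le_eqVlt; apply/orP; left; apply/eqP.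
  by rewrite /B; field; rewrite hn Cn Cmn.
apply: (le_trans (exp_moment_window M C1 eta0 h0 mf A0 l0 lA a1 b1 fA)).
rewrite lee_fin le_eqVlt; apply/orP; left; apply/eqP.
by rewrite /B; field.
Qed.

Definition norm_weight (z : p.-tuple R) : R := (1 + norm2 (colv z) ^+ 2) ^+ 2.

(** Cauchy-Schwarz against the vector of ones, as 1 + |z|^2 is at most the sum of the 1 + z_j^2 when
    p >= 1. It reduces the norm of Z to the coordinate directions, where the moments are known. *)
Lemma norm_weight_le z : norm_weight z <=
  p%:R * \sum_(j < p) poly_weight (delta_mx j 0) (delta_mx j 0) z.
Proof.
pose a : 'cV[R]_p := \col_j (1 + colv z j 0 ^+ 2).
have cs := cauchy_schwarz (const_mx 1) a.
have e1 : dotv (const_mx 1 : 'cV[R]_p) (const_mx 1) = p%:R.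
  rewrite /dotv; under eq_bigr do rewrite mxE mulr1.
  by rewrite sumr_const card_ord.
rewrite e1 in cs.
have sz : 0 <= norm2 (colv z) ^+ 2 by exact: sqr_ge0.
have le1 : 1 + norm2 (colv z) ^+ 2 <= dotv (const_mx 1) a.
  rewrite /dotv; under eq_bigr do rewrite mxE mul1r mxE.
  rewrite big_split/= sumr_const card_ord norm2_sqr /dotv lerD//.
  by rewrite ler1n.
apply: (@le_trans _ _ (dotv (const_mx 1) a ^+ 2)).
  by rewrite lerXn2r ?nnegrE// ?(le_trans _ le1) ?addr_ge0.
apply: (le_trans cs); apply: ler_wpM2l; first exact: ltW.
apply: ler_sum => j _; rewrite /poly_weight dotv_delta !mxE -expr2.
by rewrite lerXn2r ?nnegrE ?addr_ge0 ?sqr_ge0// lerDl sqr_ge0.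
Qed.

Lemma measurable_norm_weight : measurable_fun setT norm_weight.
Proof.
apply: measurable_funX; apply: measurable_funD => //.
have E : (fun z : p.-tuple R => norm2 (colv z) ^+ 2) =
    (fun z => \sum_(j < p) ip z (delta_mx j 0) ^+ 2).
  apply/funext => z; rewrite norm2_sqr; apply: eq_bigr => j _.
  by rewrite dotv_delta expr2.
rewrite E; apply: measurable_sum => j.
by apply: measurable_funX; exact: measurable_dotv_colv.
Qed.

Lemma integral_norm_weight :
  (\int[P]_w (norm_weight (Z w))%:E <= (p%:R ^+ 2 * Cm)%:E)%E.
Proof.
pose e (j : 'I_p) : 'cV[R]_p := delta_mx j 0.
have e1 j : norm2 (e j) <= 1 by rewrite norm2_delta.
have mpw j : measurable_fun setT (fun w => (1 * poly_weight (e j) (e j) (Z w))%:E).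
  by apply/measurable_EFinP; apply: measurable_funM => //; exact: measurable_poly_weight.
apply: (@le_trans _ _ (\int[P]_w (p%:R%:E * \sum_(j < p) (1 * poly_weight (e j) (e j) (Z w))%:E))%E).
  apply: ge0_le_integral => //.
  - by move=> w _; rewrite lee_fin sqr_ge0.
  - apply/measurable_EFinP.
    exact: (measurableT_comp measurable_norm_weight (measurable_funPT Z)).
  - by apply: emeasurable_funM => //; exact: emeasurable_sum.
  move=> w _; rewrite sumEFin -EFinM lee_fin (le_trans (norm_weight_le _))//.
  rewrite [in leRHS](eq_bigr (fun j => poly_weight (e j) (e j) (Z w)))// => j _; exact: mul1r.
rewrite ge0_integralZl//; last 2 first.
- exact: emeasurable_sum.
- by move=> w _; rewrite sume_ge0// => j _; rewrite lee_fin mul1r poly_weight_ge0.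
rewrite ge0_integral_sum//; last by move=> j w _; rewrite lee_fin mul1r poly_weight_ge0.
have -> : (p%:R ^+ 2 * Cm)%:E = (p%:R%:E * \sum_(j < p) Cm%:E)%E.
  by rewrite sumEFin sumr_const card_ord -EFinM; congr EFin; rewrite -[Cm *+ p]mulr_natl; ring.
apply: lee_wpmul2l; first by rewrite lee_fin ltW.
apply: lee_sum => j _; rewrite -[X in (_ <= X%:E)%E]mul1r.
exact: (integral_poly_weight M C1 eta0).
Qed.

(* Outside of this event the sample averages are Lipschitz with a polynomial
   constant. *)
Definition large_norms : set T :=
  [set w | n%:R ^+ 4 <= \sum_(i < n) norm_weight (obsZ (s i) w)].

Let m_norms : measurable_fun setT (fun w => \sum_(i < n) norm_weight (obsZ (s i) w)).
Proof.
apply: measurable_sum => i.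
exact: (measurableT_comp measurable_norm_weight (measurable_funPT (obsZ (s i)))).
Qed.

Lemma measurable_large_norms : measurable large_norms.
Proof. exact: measurable_set_ler. Qed.

(** The sum has mean at most n p^2 Cm <= n^3 Cm, so Markov's inequality at level n^4 leaves 1 /
    n. *)
Lemma large_norms_le : (P large_norms <= (Cm / n%:R)%:E)%E.
Proof.
have n4 : 0 < n%:R ^+ 4 :> R by rewrite exprn_gt0.
apply: (le_trans (ge0_markov P m_norms _ n4)).
  by move=> w; apply: sumr_ge0 => i _; exact: sqr_ge0.
have mm : measurable_fun setT (fun g : R * p.-tuple R * R => (norm_weight g.1.2)%:E).
  apply/measurable_EFinP; apply: (measurableT_comp measurable_norm_weight).
  exact: measurableT_comp.
have Ei i : (\int[P]_w (norm_weight (obsZ (s i) w))%:E <= (p%:R ^+ 2 * Cm)%:E)%E.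
  rewrite (ge0_integral_eqlaw mW mW0 iid.1 i mm)//; last by move=> g; rewrite lee_fin sqr_ge0.
  exact: integral_norm_weight.
under eq_integral do rewrite -sumEFin.
rewrite ge0_integral_sum//; last 2 first.
- move=> i; apply/measurable_EFinP.
  exact: (measurableT_comp measurable_norm_weight (measurable_funPT (obsZ (s i)))).
- by move=> i w _; rewrite lee_fin sqr_ge0.
apply: (@le_trans _ _ ((n%:R ^- 4)%:E * \sum_(i < n) (p%:R ^+ 2 * Cm)%:E)%E).
  apply: lee_wpmul2l; first by rewrite lee_fin invr_ge0 ltW.
  by apply: lee_sum => i _; exact: Ei.
rewrite sumEFin sumr_const card_ord -EFinM lee_fin -[(_ * Cm) *+ n]mulr_natl.
have -> : n%:R ^- 4 * (n%:R * (p%:R ^+ 2 * Cm)) = (p%:R / n%:R) ^+ 2 * (Cm / n%:R).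
  by field; rewrite gt_eqF.
apply: ler_piMl; first by rewrite divr_ge0// ltW.
rewrite exprn_ile1 ?divr_ge0// ler_pdivrMr// mul1r ler_nat//.
Qed.

Section grid_union.
Variables (t : R) (phi : 'cV[R]_p -> 'cV[R]_p -> p.-tuple R * R -> R).
Hypothesis t0 : 0 <= t.
Hypothesis tK : t * h * C / K0 <= eta / 2.
Hypothesis tn : n%:R ^+ (16 * p) * expR (- (n%:R * (t ^+ 2 * h ^+ 3 / (4 * K0)))) <= n%:R^-1.
Hypothesis mphi : forall u v, measurable_fun setT (phi u v).
Hypothesis phi_window : forall u v, norm2 u <= 1 -> norm2 v <= 1 ->
  exists u1 u2 a b : 'cV[R]_p, [/\ norm2 a <= 1, norm2 b <= 1 & forall q,
    `|phi u v q| <= 2 * C * h ^- 2 * (`|ip q.1 a| * `|ip q.1 b|) *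
     ((`|q.2 + ip q.1 u1| <= h)%R || (`|q.2 + ip q.1 u2| <= h)%R)%:R].
Hypothesis phi_lipschitz : forall u v u' v' (e : R) q, 0 <= e ->
  norm2 u <= 1 -> norm2 u' <= 1 -> norm2 v <= 1 -> norm2 v' <= 1 ->
  norm2 (u - u') <= e -> norm2 (v - v') <= e ->
  `|phi u v q - phi u' v' q| <= 8 * C * h ^- 3 * e * norm_weight q.1.

Let N := (n ^ 6)%N.
Let N0 : (0 < N)%N. Proof. by rewrite expn_gt0 n0. Qed.
Local Notation grid := {ffun 'I_p -> 'I_(N.*2.+1)}.

Let card_pairs : #|{: grid * grid}|%:R <= n%:R ^+ (16 * p) :> R.
Proof. by rewrite card_prod !card_grid -natrX ler_nat grid_pairs_le. Qed.

(** The sample average at (u, v) is compared with the mean at a nearby grid pair (u', v'), not at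
    (u, v). Means are estimated uniformly on the ball, so their continuity never enters. [phi]
    stands for the Hessian term or for the bracket divided by r. *)
Lemma uniform_deviation : exists B, [/\ measurable B, (P B <= (2 / n%:R)%:E)%E &
  forall w, ~ B w -> ~ large_norms w -> forall u v, norm2 u <= 1 -> norm2 v <= 1 ->
  exists u' v', [/\ norm2 u' <= 1, norm2 v' <= 1, norm2 (v - v') <= p%:R / N%:R &
    `|n%:R^-1 * \sum_(i < n) signed beta (phi u v) (W i w) - mean (phi u' v')| <=
    t + 8 * C * h ^- 3 * (p%:R / N%:R) * n%:R ^+ 3]].
Proof.
pose dev (u v : 'cV[R]_p) := [set w | n%:R * t <=
  `|\sum_(i < n) signed beta (phi u v) (W i w) - n%:R * mean (phi u v)| ]%R.
pose g (f : grid) : 'cV[R]_p := grid_vec R f.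
(* The grid fills a cube; pairs with a vector outside the unit ball are discarded, as the tail bound
   holds inside it. *)
pose bad (j : grid * grid) : set T :=
  if (norm2 (g j.1) <= 1) && (norm2 (g j.2) <= 1) then dev (g j.1) (g j.2) else set0.
have mdev u v : measurable (dev u v).
  apply: measurable_set_ler => //; apply: measurableT_comp => //.
  apply: measurable_funB => //; apply: measurable_sum => i.
  exact: (measurableT_comp (measurable_signed beta (mphi u v)) (mW i)).
have mbad j : measurable (bad j) by rewrite /bad; case: ifP.
pose e := 2 * expR (- (n%:R * (t ^+ 2 * h ^+ 3 / (4 * K0)))).
have e0 : 0 <= e by rewrite mulr_ge0 ?expR_ge0.
have Pbad j : (P (bad j) <= e%:E)%E.
  rewrite /bad; case: ifP => [/andP[u1 v1]|_]; last by rewrite measure0 lee_fin.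
  have [w1 [w2 [a [b [a1 b1 Hq]]]]] := phi_window u1 v1.
  exact: (mean_deviation (mphi _ _) t0 tK a1 b1 Hq).
have [mB PB] := finite_union_bound mbad Pbad.
exists (\big[setU/set0]_j bad j); split => //.
  apply: (le_trans PB); rewrite lee_fin /e mulrCA ler_wpM2l//.
  by apply: le_trans tn; rewrite ler_wpM2r ?expR_ge0.
move=> w nB nL u v u1 v1.
have [f1 [g1 d1]] := grid_rounding N0 u1.
have [f2 [g2 d2]] := grid_rounding N0 v1.
exists (g f1), (g f2); split => //.
have nbad : ~ bad (f1, f2) w.
  by move=> bw; apply: nB; rewrite -bigcup_seq; exists (f1, f2) => //=; rewrite mem_index_enum.
move: nbad; rewrite /bad /= g1 g2 /dev /= => /negP; rewrite -ltNge => devw.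
have pN : 0 <= p%:R / N%:R :> R by rewrite divr_ge0.
set S := \sum_(i < n) _; set S' := \sum_(i < n) _ in devw.
have SS : `|S - S'| <= 8 * C * h ^- 3 * (p%:R / N%:R) * n%:R ^+ 4.
  rewrite /S /S' -sumrB (le_trans (ler_norm_sum _ _ _))//.
  apply: (@le_trans _ _ (\sum_(i < n) 8 * C * h ^- 3 * (p%:R / N%:R) * norm_weight (obsZ (s i) w))).
    apply: ler_sum => i _; rewrite signedB norm_signed.
    exact: phi_lipschitz.
  rewrite -mulr_sumr; apply: ler_wpM2l.
    apply: mulr_ge0 => //; apply: mulr_ge0; first exact: mulr_ge0.
    by rewrite invr_ge0 exprn_ge0// ltW.
  by move/negP: nL; rewrite -ltNge => /ltW.
have -> : n%:R^-1 * S - mean (phi (g f1) (g f2)) =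
    n%:R^-1 * ((S' - n%:R * mean (phi (g f1) (g f2))) + (S - S')).
  by field; rewrite gt_eqF.
rewrite normrM gtr0_norm ?invr_gt0// -(ler_pM2l nR0) mulrA divff ?gt_eqF// mul1r.
rewrite (le_trans (ler_normD _ _))// mulrDr lerD ?(ltW devw)//.
by apply: (le_trans SS); rewrite le_eqVlt; apply/orP; left; apply/eqP; ring.
Qed.

End grid_union.

(* Chebyshev coordinate by coordinate. *)
Lemma gradient_deviation (K : R) : 0 < K -> exists B, [/\ measurable B,
  (P B <= (2 * C ^+ 3 * Cm / K ^+ 2)%:E)%E &
  forall w, ~ B w -> forall v, norm2 v = 1 ->
  `|dotv v (grad_loss beta s H h w beta)| <=
   2 * (C * D) * h ^+ alpha * Cm + K * Num.sqrt (p%:R / (n%:R * h))].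
Proof.
move=> Kp.
pose e (j : 'I_p) : 'cV[R]_p := delta_mx j 0.
have e1 j : norm2 (e j) <= 1 by rewrite norm2_delta.
pose mu j := mean (grad_term H h (e j)).
pose S j w := \sum_(i < n) signed beta (grad_term H h (e j)) (W i w).
pose Q w := \sum_(j < p) (S j w - n%:R * mu j) ^+ 2.
have mg v : measurable_fun setT (grad_term H h v).
  exact: (measurable_grad_term h (measurable_K1 kf)).
have mS j : measurable_fun setT (S j).
  apply: measurable_sum => i.
  exact: (measurableT_comp (measurable_signed beta (mg (e j))) (mW i)).
have mQ : measurable_fun setT Q.
  by apply: measurable_sum => j; apply: measurable_funX; exact: measurable_funB.
have Q0 w : 0 <= Q w by apply: sumr_ge0 => j _; exact: sqr_ge0.
(* The mean of [Q] is at most p n (2 C^3 Cm / h), and [Q w < c] says that the fluctuation vector has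
   squared norm below K^2 p / (n h). *)
pose c := K ^+ 2 * (n%:R * p%:R / h).
have K2 : 0 < K ^+ 2 by exact: exprn_gt0.
have c0 : 0 < c by rewrite mulr_gt0// divr_gt0// mulr_gt0.
exists [set w | c <= Q w]; split.
- exact: measurable_set_ler.
- apply: (le_trans (ge0_markov P mQ Q0 c0)).
  rewrite /Q; under eq_integral do rewrite -sumEFin.
  rewrite ge0_integral_sum//; last 2 first.
  + move=> j; apply/measurable_EFinP; apply: measurable_funX; exact: measurable_funB.
  + by move=> j w _; rewrite lee_fin sqr_ge0.
  apply: (@le_trans _ _ (c^-1%:E * \sum_(j < p) (n%:R * (2 * C ^+ 3 * Cm / h))%:E)%E).
    apply: lee_wpmul2l; first by rewrite lee_fin invr_ge0 ltW.
    apply: lee_sum => j _.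
    apply: (sum_sqr_dev_le mW mW0 iid.2 iid.1 (measurable_signed beta (mg (e j)))).
    under eq_integral do rewrite signed_sqr.
    exact: (second_moment_grad kf M C1 eta0 h0).
  rewrite sumEFin sumr_const card_ord -EFinM lee_fin -[(_ * _) *+ p]mulr_natl.
  rewrite le_eqVlt; apply/orP; left; apply/eqP; rewrite /c; field.
  by rewrite !gt_eqF.
move=> w /negP; rewrite -ltNge => Qc v v1.
pose x : 'cV[R]_p := \col_j (n%:R^-1 * S j w - mu j).
have gE j : grad_loss beta s H h w beta j 0 = n%:R^-1 * S j w.
  by rewrite /S (mean_grad beta s H h w) dotvC dotv_delta.
(* By linearity the coordinate means recombine into the single mean in direction v, so the bias does
   not pick up a factor sqrt(p). *)
have muE : \sum_(j < p) v j 0 * mu j = mean (grad_term H h v).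
  have ig j : P.-integrable setT
      (EFin \o (fun w => - response beta o w * grad_term H h (e j) (Z w, ze w))).
    apply: (le_integrable measurableT _ _ (integrable_grad_term kf M C1 eta0 h0 (e1 j))).
      apply/measurable_EFinP.
      exact: (measurableT_comp (measurable_signed beta (mg (e j))) mW0).
    move=> w' _; rewrite lee_fin le_eqVlt; apply/orP; left; apply/eqP.
    exact: (norm_signed beta (grad_term H h (e j)) (W0 w')).
  transitivity (\sum_(j < p) \int[P]_w (v j 0 * (- response beta o w * grad_term H h (e j) (Z w, ze w)))).
    by apply: eq_bigr => j _; rewrite RintegralZl.
  rewrite -Rintegral_sum.
    apply: eq_Rintegral => w' _; rewrite /grad_term {2}/dotv !mulr_sumr.
    by apply: eq_bigr => j _; rewrite dotv_delta; ring.
  move=> j; apply: (eq_integrable measurableT); last exact: (integrableZl measurableT (v j 0) (ig j)).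
  by move=> w' _; rewrite /= EFinM.
have -> : dotv v (grad_loss beta s H h w beta) = mean (grad_term H h v) + dotv v x.
  rewrite -muE /dotv -big_split/=; apply: eq_bigr => j _.
  by rewrite gE mxE; ring.
rewrite (le_trans (ler_normD _ _))// lerD//.
  by apply: (mean_grad_term kf M C1 eta0 alpha2 h0); rewrite v1.
rewrite (le_trans (dotv_le_norm2 _ _))// v1 mul1r.
rewrite -(@ler_pXn2r _ 2)// ?nnegrE ?norm2_ge0 ?mulr_ge0 ?sqrtr_ge0 ?(ltW Kp)//.
rewrite exprMn [Num.sqrt (p%:R / _) ^+ 2]sqr_sqrtr; last by rewrite divr_ge0// mulr_ge0// ltW.
have -> : norm2 x ^+ 2 = n%:R ^- 2 * Q w.
  rewrite norm2_sqr /dotv /Q mulr_sumr; apply: eq_bigr => j _.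
  by rewrite mxE; field; rewrite gt_eqF.
have -> : K ^+ 2 * (p%:R / (n%:R * h)) = n%:R ^- 2 * c.
  by rewrite /c; field; rewrite !gt_eqF.
by rewrite ler_wpM2l ?(ltW Qc)// invr_ge0 sqr_ge0.
Qed.

Let n2R : 2 <= n%:R :> R. Proof. by rewrite ler_nat. Qed.

Definition rate : R := Num.sqrt (p%:R * ln n%:R / (n%:R * h ^+ 3)).
(* With this constant the Chernoff exponent of the deviation [dev_const * rate]
   is 17 p ln n, which beats the n^(16 p) pairs of grid points. *)
Definition dev_const : R := Num.sqrt (68 * K0).

Hypothesis h1 : h <= 1.
Hypothesis hn : h ^- 3 <= n%:R.

Let ln0 : 0 <= ln n%:R :> R.
Proof. by rewrite (le_trans _ (ln_nat_ge_half R n2)). Qed.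

Let rate_arg0 : 0 <= p%:R * ln n%:R / (n%:R * h ^+ 3).
Proof. by apply: divr_ge0; apply: mulr_ge0 => //; apply: exprn_ge0; exact: ltW. Qed.

Let rate_sqr : rate ^+ 2 = p%:R * ln n%:R / (n%:R * h ^+ 3).
Proof. by rewrite sqr_sqrtr. Qed.

Let dev_sqr : dev_const ^+ 2 = 68 * K0.
Proof. by rewrite sqr_sqrtr// mulr_ge0// ltW. Qed.

(** Uses ln n >= 1/2 >= 1/n together with h <= 1 and p >= 1. It lets the rounding error, of order 1
    / n, be absorbed into the deviation. *)
Let rate_ge : n%:R^-1 <= rate.
Proof.
rewrite -(@ler_pXn2r _ 2)// ?nnegrE ?sqrtr_ge0 ?invr_ge0 ?(ltW nR0)// rate_sqr.
have -> : p%:R * ln n%:R / (n%:R * h ^+ 3) = n%:R^-1 * ((p%:R * ln n%:R) * h ^- 3).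
  by field; rewrite !gt_eqF.
rewrite expr2 ler_wpM2l ?invr_ge0 ?(ltW nR0)//.
apply: (@le_trans _ _ (ln n%:R)).
  by rewrite (le_trans _ (ln_nat_ge_half R n2))// lef_pV2 ?posrE.
have hV : 1 <= h ^- 3 by rewrite invf_ge1 ?exprn_gt0// exprn_ile1// ltW.
have p1 : 1 <= p%:R :> R by rewrite ler1n.
apply: (@le_trans _ _ (p%:R * ln n%:R)); first by rewrite ler_peMl.
by rewrite ler_peMr// mulr_ge0// ltW.
Qed.

Let tail : n%:R ^+ (16 * p) *
  expR (- (n%:R * ((dev_const * rate) ^+ 2 * h ^+ 3 / (4 * K0)))) <= n%:R^-1.
Proof.
have -> : n%:R * ((dev_const * rate) ^+ 2 * h ^+ 3 / (4 * K0)) =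
    (17 * p)%:R * ln n%:R.
  have Cn : C != 0 by rewrite gt_eqF.
  have Cmn : Cm != 0 by rewrite gt_eqF.
  rewrite exprMn dev_sqr rate_sqr natrM; field.
  by rewrite Cn Cmn !gt_eqF.
have -> : (17 * p = 16 * p + p)%N by rewrite mulSnr.
rewrite expRN expRM_natl lnK ?posrE// mulrC.
have e0 : 0 < n%:R ^+ (16 * p) :> R by rewrite exprn_gt0.
rewrite exprD invfM mulrAC mulVf ?gt_eqF// mul1r.
rewrite lef_pV2 ?posrE ?exprn_gt0// -[leLHS]expr1 ler_weXn2l//.
by rewrite (le_trans _ n2R)// ler1n.
Qed.

(** This fixes the mesh: h^-3 and p are at most n and the averaged norm weights are at most n^3, so
    n^-6 leaves 1 / n. *)
Let lip_small : 8 * C * h ^- 3 * (p%:R / (n ^ 6)%:R) * n%:R ^+ 3 <= 8 * C * rate.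
Proof.
apply: (@le_trans _ _ (8 * C * n%:R^-1)); last by rewrite ler_wpM2l// mulr_ge0.
rewrite -!mulrA ler_wpM2l// ler_wpM2l//.
apply: (@le_trans _ _ (n%:R * (n%:R * ((n ^ 6)%:R^-1 * n%:R ^+ 3)))).
  apply: ler_pM => //.
  - by rewrite invr_ge0 exprn_ge0// ltW.
  - by rewrite ler_wpM2r ?ler_nat// mulr_ge0 ?invr_ge0 ?exprn_ge0.
by rewrite natrX le_eqVlt; apply/orP; left; apply/eqP; field; rewrite gt_eqF.
Qed.

Let mesh_small : p%:R / (n ^ 6)%:R <= 2^-1 :> R.
Proof.
rewrite natrX ler_pdivrMr ?exprn_gt0//.
apply: (@le_trans _ _ n%:R); first by rewrite ler_nat.
rewrite exprS mulrCA ler_peMr ?(ltW nR0)//.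
rewrite -ler_pdivrMl ?invr_gt0// invrK mulr1.
apply: (le_trans n2R); rewrite -[leLHS]expr1 ler_weXn2l//.
by rewrite (le_trans _ n2R)// ler1n.
Qed.

Local Notation KK := (2 * (C * D) * Cm).
Local Notation LL := (dev_const + 8 * C).

Let D0 : 0 <= D. Proof. exact: response_density_bound_ge0. Qed.

Let KK0 : 0 <= KK.
Proof. by apply: mulr_ge0; [apply: mulr_ge0 => //; exact: mulr_ge0 | exact: ltW]. Qed.

Let LL0 : 0 <= LL.
Proof. by rewrite addr_ge0 ?sqrtr_ge0// mulr_ge0. Qed.

Variables (c0 r K : R).
Hypothesis c00 : 0 < c0.
Hypothesis Veig : forall a, eigenvalue (Vmx P o rho k) a -> c0 < a.
Hypothesis r0 : 0 <= r.
Hypothesis r1 : r <= 1.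
Hypothesis K1 : 0 < K.
Hypothesis small_dev : dev_const * rate * h * C / K0 <= eta / 2.
Hypothesis small_bias : KK * (h + r) + LL * rate <= c0 / 8.

(** The form of V is at least c0 / 4 at the rounded direction, and bias and deviation together cost
    at most c0 / 8. *)
Let hess_event : exists B, [/\ measurable B, (P B <= (2 / n%:R)%:E)%E &
  forall w, ~ B w -> ~ large_norms w -> forall u v, norm2 u <= 1 -> norm2 v = 1 ->
  c0 / 8 <= dotv v (hess_loss beta s H h w (beta + r *: u) *m v)].
Proof.
have t0 : 0 <= dev_const * rate by rewrite mulr_ge0 ?sqrtr_ge0.
pose phi u v := hess_term H h (r *: u) v.
have mphi u v : measurable_fun setT (phi u v).
  exact: (measurable_hess_term h (measurable_K2 kf)).
have phi_win u v : norm2 u <= 1 -> norm2 v <= 1 ->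
    exists u1 u2 a b : 'cV[R]_p, [/\ norm2 a <= 1, norm2 b <= 1 & forall q,
    `|phi u v q| <= 2 * C * h ^- 2 * (`|ip q.1 a| * `|ip q.1 b|) *
     ((`|q.2 + ip q.1 u1| <= h)%R || (`|q.2 + ip q.1 u2| <= h)%R)%:R].
  move=> u1 v1; exists (r *: u), (r *: u), v, v; split => // q; rewrite orbb.
  rewrite (le_trans (hess_term_bound kf h0 (r *: u) v q))//.
  rewrite ler_wpM2r// ler_wpM2r ?mulr_ge0// mulrC ler_wpM2r ?invr_ge0 ?sqr_ge0//.
  by rewrite ler_peMl// ler1n.
have phi_lip u v u' v' (e : R) q : 0 <= e ->
    norm2 u <= 1 -> norm2 u' <= 1 -> norm2 v <= 1 -> norm2 v' <= 1 ->
    norm2 (u - u') <= e -> norm2 (v - v') <= e ->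
    `|phi u v q - phi u' v' q| <= 8 * C * h ^- 3 * e * norm_weight q.1.
  move=> e0 u1 u1' v1 v1' du dv.
  exact: (hess_term_lipschitz kf h0 h1 r0 r1 C0 e0 v1 v1' du dv).
have [B [mB PB HB]] := uniform_deviation t0 small_dev tail mphi phi_win phi_lip.
exists B; split => // w nB nL u v u1 v1.
have v1' : norm2 v <= 1 by rewrite v1.
have [u' [v' [u'1 v'1 dv dev]]] := HB w nB nL u v u1 v1'.
have [Z0 [mZ0 Z0C Z0E]] := ex_measurable_density_at0 M C1 alpha2.
have mh := mean_hess_term kf M C1 eta0 alpha2 h0 r0 u'1 v'1 mZ0 Z0C Z0E.
rewrite -(Vmx_quadratic M C1 eta0 mZ0 Z0C Z0E) in mh.
have VQ := sym_quadratic_lower_bound (Vmx_sym P o rho k) Veig v'.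
(* The rounded direction is no longer a unit vector, but with a rounding error of at most 1/2 its
   norm is at least 1/2. *)
have v'2 : 4^-1 <= dotv v' v'.
  have : norm2 v <= norm2 (v - v') + norm2 v' by rewrite -[v in leLHS](subrK v') norm2D.
  rewrite v1 -norm2_sqr => H1.
  have H2 : 2^-1 <= norm2 v'.
    rewrite -(lerD2l 2^-1) (_ : 2^-1 + 2^-1 = 1); last by field.
    by rewrite (le_trans H1)// lerD2r (le_trans dv mesh_small).
  have -> : 4^-1 = 2^-1 ^+ 2 :> R by field.
  by rewrite lerXn2r ?nnegrE ?norm2_ge0.
rewrite -mean_hess -/(phi u v).
have VQ' : c0 * 4^-1 <= dotv v' (Vmx P o rho k *m v').
  by apply: le_trans VQ; rewrite ler_wpM2l// ltW.
apply: (le_trans _ (le_of_close dev mh VQ')).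
have -> : c0 / 8 = c0 * 4^-1 - c0 / 8 by field.
rewrite -addrA lerD2l -opprD lerN2; apply: le_trans small_bias.
apply: lerD; first by rewrite le_eqVlt; apply/orP; left; apply/eqP; ring.
by rewrite [leRHS]mulrDl lerD2l lip_small.
Qed.

Let newton_event : exists B, [/\ measurable B, (P B <= (2 / n%:R)%:E)%E &
  forall w, ~ B w -> ~ large_norms w -> forall u v, norm2 u <= 1 -> norm2 v = 1 ->
  `|dotv v (hess_loss beta s H h w (beta + r *: u) *m (r *: u)
     - grad_loss beta s H h w (beta + r *: u) + grad_loss beta s H h w beta)| <=
  KK * r ^+ 2 + r * (LL * rate)].
Proof.
have t0 : 0 <= dev_const * rate by rewrite mulr_ge0 ?sqrtr_ge0.
pose phi u v q := r^-1 * newton_term H h (r *: u) v q.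
have mphi u v : measurable_fun setT (phi u v).
  apply: measurable_funM => //.
  exact: (measurable_newton_term h (measurable_K1 kf) (measurable_K2 kf)).
have phi_win u v : norm2 u <= 1 -> norm2 v <= 1 ->
    exists u1 u2 a b : 'cV[R]_p, [/\ norm2 a <= 1, norm2 b <= 1 & forall q,
    `|phi u v q| <= 2 * C * h ^- 2 * (`|ip q.1 a| * `|ip q.1 b|) *
     ((`|q.2 + ip q.1 u1| <= h)%R || (`|q.2 + ip q.1 u2| <= h)%R)%:R].
  move=> u1 v1; exists (r *: u), 0, u, v; split => // q.
  by rewrite (le_trans (newton_term_bound kf h0 r0 C0 u v q))// dotv0r [_ * (2 * C)]mulrC.
have phi_lip u v u' v' (e : R) q : 0 <= e ->
    norm2 u <= 1 -> norm2 u' <= 1 -> norm2 v <= 1 -> norm2 v' <= 1 ->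
    norm2 (u - u') <= e -> norm2 (v - v') <= e ->
    `|phi u v q - phi u' v' q| <= 8 * C * h ^- 3 * e * norm_weight q.1.
  move=> e0 u1 u1' v1 v1' du dv.
  exact: (newton_term_lipschitz kf h0 h1 r0 r1 C0 e0 u1 u1' v1 du dv).
have [B [mB PB HB]] := uniform_deviation t0 small_dev tail mphi phi_win phi_lip.
exists B; split => // w nB nL u v u1 v1.
have v1' : norm2 v <= 1 by rewrite v1.
have [u' [v' [u'1 v'1 _ dev]]] := HB w nB nL u v u1 v1'.
have mn := mean_newton_term kf M C1 eta0 alpha2 h0 r0 u'1 v'1.
have {}dev := le_trans dev (lerD (lexx _) lip_small).
rewrite -(mean_newton beta s H h0).
have rhs0 : 0 <= KK * r ^+ 2 + r * (LL * rate).
  apply: addr_ge0; apply: mulr_ge0 => //; first exact: sqr_ge0.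
  by apply: mulr_ge0 => //; exact: sqrtr_ge0.
(* For r = 0 the undivided bracket vanishes; otherwise it is r times the rescaled term. *)
have [r00|rn] := eqVneq r 0.
  rewrite big1 ?mulr0 ?normr0// => i _.
  rewrite /signed /newton_term r00 scale0r dotv0r addr0 mulr0 sub0r.
  by rewrite addNr mulr0 mul0r mulr0.
have -> : n%:R^-1 * \sum_(i < n) signed beta (newton_term H h (r *: u) v) (W i w) =
    r * (n%:R^-1 * \sum_(i < n) signed beta (phi u v) (W i w)).
  rewrite [RHS]mulrCA [in RHS]mulr_sumr; congr (_ * _); apply: eq_bigr => i _.
  by rewrite /signed /phi; field.
move: dev mn; set S := _ * \sum_(i < n) _; set m := \int[P]_w _.
rewrite -mulrDl => dev mn.
have -> : r * S = r * m + r * (S - m) by ring.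
rewrite (le_trans (ler_normD _ _))// lerD//.
  by apply: (le_trans mn); rewrite le_eqVlt; apply/orP; left; apply/eqP; ring.
by rewrite normrM (ger0_norm r0) ler_wpM2l.
Qed.

(** The exceptional event is chosen before [b], so the conclusion may be used at a point computed
    from the sample. In its probability, 4 / n comes from the two grid bounds, Cm / n from
    [large_norms] and the rest from Chebyshev. *)
Lemma one_step_bound : exists B, [/\ measurable B,
  (P B <= ((4 + Cm) / n%:R + 2 * C ^+ 3 * Cm / K ^+ 2)%:E)%E &
  forall w, ~ B w -> forall b, norm2 (b - beta) <= r ->
  norm2 (newton_step beta s H h w b - beta) <=
    8 / c0 * (KK + LL + K) * (r ^+ 2 + h ^+ alpha
      + Num.sqrt (p%:R / (n%:R * h)) + r * rate)].
Proof.
have [B1 [mB1 PB1 HB1]] := hess_event.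
have [B2 [mB2 PB2 HB2]] := newton_event.
have [B3 [mB3 PB3 HB3]] := gradient_deviation K1.
have mL := measurable_large_norms.
have PL := large_norms_le.
have m12 : measurable (B1 `|` B2) by exact: measurableU.
have m123 : measurable (B1 `|` B2 `|` B3) by exact: measurableU.
exists (B1 `|` B2 `|` B3 `|` large_norms); split.
- exact: measurableU.
- apply: (le_trans (measureU2 P m123 mL)).
  have -> : (4 + Cm) / n%:R + 2 * C ^+ 3 * Cm / K ^+ 2 =
    2 / n%:R + 2 / n%:R + 2 * C ^+ 3 * Cm / K ^+ 2 + Cm / n%:R.
    by field; rewrite !gt_eqF.
  rewrite EFinD; apply: leeD PL; apply: (le_trans (measureU2 P m12 mB3)).
  rewrite EFinD; apply: leeD PB3; apply: (le_trans (measureU2 P mB1 mB2)).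
  by rewrite EFinD; exact: leeD PB1 PB2.
move=> w nB b br.
have nB1 : ~ B1 w by move=> Hw; apply: nB; left; left; left.
have nB2 : ~ B2 w by move=> Hw; apply: nB; left; left; right.
have nB3 : ~ B3 w by move=> Hw; apply: nB; left; right.
have nL : ~ large_norms w by move=> Hw; apply: nB; right.
(* For r = 0 both r^-1 and b - beta are 0. *)
pose u := r^-1 *: (b - beta).
have u1 : norm2 u <= 1.
  rewrite /u norm2Z ger0_norm ?invr_ge0// mulrC.
  have [->|rn] := eqVneq r 0; first by rewrite invr0 mulr0.
  by rewrite ler_pdivrMr ?mul1r// lt_def rn.
have ru : r *: u = b - beta.
  rewrite /u scalerA; have [r00|rn] := eqVneq r 0; last by rewrite divff// scale1r.
  by apply/eqP; rewrite r00 mul0r scale0r eq_sym -norm2_eq0 eq_le norm2_ge0 -r00 br.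
have bE : beta + r *: u = b by rewrite ru addrC subrK.
have rate0 : 0 <= rate by exact: sqrtr_ge0.
have sq0 : 0 <= Num.sqrt (p%:R / (n%:R * h)) by exact: sqrtr_ge0.
have ha0 : 0 <= h ^+ alpha by rewrite exprn_ge0// ltW.
set q1 := Num.sqrt _ in sq0 *; set q2 := h ^+ alpha in ha0 *; set q3 := rate in rate0 *.
have rq : 0 <= r * q3 by exact: mulr_ge0.
have r2 : 0 <= r ^+ 2 by exact: sqr_ge0.
have E : KK * r ^+ 2 + r * (LL * q3) + (KK * q2 + K * q1) <=
    (KK + LL + K) * (r ^+ 2 + q2 + q1 + r * q3).
  exact: (sum_products_le KK0 LL0 (ltW K1) r2 ha0 sq0 rq).
apply: (@le_trans _ _ ((c0 / 8)^-1 *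
    (KK * r ^+ 2 + r * (LL * q3) + (KK * q2 + K * q1)))); last first.
  rewrite invfM invrK [_ * 8]mulrC -[leRHS]mulrA ler_wpM2l//.
  by rewrite divr_ge0// ltW.
apply: newton_error.
- by rewrite divr_gt0.
- by move=> v v1; have := HB1 w nB1 nL u v u1 v1; rewrite bE.
- move=> v v1; have H2 := HB2 w nB2 nL u v u1 v1; rewrite bE ru in H2.
  have H3 := HB3 w nB3 v v1.
  set G := hess_loss _ _ _ _ _ _ in H2 *; set g := grad_loss _ _ _ _ _ b in H2 *.
  set g0 := grad_loss _ _ _ _ _ _ in H2 H3 *.
  have -> : G *m (b - beta) - g = (G *m (b - beta) - g + g0) - g0 by rewrite addrK.
  rewrite dotvBr (le_trans (ler_normB _ _))// lerD//.
  by apply: (le_trans H3); rewrite lerD2r le_eqVlt; apply/orP; left; apply/eqP; rewrite /q2; ring.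
- apply: addr_ge0; apply: addr_ge0; apply: mulr_ge0 => //; first by exact: mulr_ge0.
  exact: ltW.
Qed.

End one_step.

(** * Asymptotics *)

Lemma kernel_facts_le (R : realType) alpha (H : R -> R) (C C' : R) : C <= C' ->
  kernel_facts alpha H C -> kernel_facts alpha H C'.
Proof.
move=> CC [d1 s1 s2 b1 b2 l1 l2 m mk]; split.
- exact: d1.
- exact: s1.
- exact: s2.
- by move=> x; exact: le_trans (b1 x) CC.
- by move=> x; exact: le_trans (b2 x) CC.
- by move=> x y; apply: le_trans (l1 x y) _; exact: ler_wpM2r.
- by move=> x y; apply: le_trans (l2 x y) _; exact: ler_wpM2r.
- exact: m.
- exact: mk.
Qed.

Lemma bounded_derivs_le (R : realType) j (C C' : R) (f : R -> R) : C <= C' ->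
  bounded_derivs j C f -> bounded_derivs j C' f.
Proof.
by move=> CC bf i ij t; have [df fC] := bf i ij t; split; [exact: df|exact: le_trans fC CC].
Qed.

Lemma ex_small_factor (R : realType) (A c : R) : 0 <= A -> 0 < c ->
  exists2 e, 0 < e & forall x, 0 <= x -> x <= e -> A * x <= c.
Proof.
move=> A0 c0; have A1 : 0 < A + 1 by rewrite ltr_wpDl.
exists (c / (A + 1)); first by rewrite divr_gt0.
move=> x x0; rewrite ler_pdivlMr// => xc; apply: le_trans xc.
by rewrite mulrC ler_wpM2l// lerDl.
Qed.

Lemma norm2_dim0 (R : realType) (p : nat) (u : 'cV[R]_p) : p = 0%N -> norm2 u = 0.
Proof. by move=> p0; subst p; rewrite /norm2 /dotv big_ord0 sqrtr0. Qed.

Lemma le_common_bound (R : realType) (a b c d : R) : 0 <= a ->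
  let s := a + `|b| + `|c| + `|d| in [/\ a <= s, b <= s, c <= s & d <= s].
Proof.
move=> a0 s; rewrite /s; have nb := ler_norm b; have nc := ler_norm c; have nd := ler_norm d.
have b0 := normr_ge0 b; have c0 := normr_ge0 c; have d0 := normr_ge0 d.
by split; lra.
Qed.

(** Used with radius m t = M1 delta: each of 1, m and m^2 is at most (1 + m)^2, which goes into the
    constant of the O_P. *)
Lemma rescaled_rate_le (R : realType) (m t a b q : R) : 0 <= m -> 0 <= t -> 0 <= a ->
  0 <= b -> 0 <= q ->
  (m * t) ^+ 2 + a + b + m * t * q <= (1 + m) ^+ 2 * (t ^+ 2 + a + b + t * q).
Proof.
move=> m0 t0 a0 b0 q0; have c1 : 1 <= (1 + m) ^+ 2 by rewrite exprn_ege1// lerDl.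
have c2 : m ^+ 2 <= (1 + m) ^+ 2 by rewrite lerXn2r ?nnegrE ?addr_ge0// lerDr.
have c3 : m <= (1 + m) ^+ 2.
  by rewrite (@le_trans _ _ (1 + m))// ?lerDr// expr2 ler_peMl ?addr_ge0// lerDl.
rewrite !mulrDr !lerD//; first by rewrite exprMn ler_wpM2r// sqr_ge0.
- by rewrite ler_peMl.
- by rewrite ler_peMl.
by rewrite -mulrA ler_wpM2r// mulr_ge0.
Qed.

Section bandwidth.
Context (R : realType) (p n : nat) (h : R).
Hypotheses (n2 : (2 <= n)%N) (p0 : (0 < p)%N) (h0 : 0 < h) (h1 : h <= 1).
Hypothesis small : p%:R * ln n%:R / (n%:R * h ^+ 3) <= 2^-1.

Let nR0 : 0 < n%:R :> R. Proof. by rewrite ltr0n (leq_trans _ n2). Qed.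
Let h30 : 0 < h ^+ 3. Proof. exact: exprn_gt0. Qed.

Let small' : p%:R * ln n%:R <= 2^-1 * (n%:R * h ^+ 3).
Proof. by rewrite -ler_pdivrMr// mulr_gt0. Qed.

(** With ln n >= 1/2 the bandwidth condition loses its logarithm; p <= n and h^-3 <= n, on which the
    polynomial grid bounds rest, both follow. *)
Let p_small : p%:R <= n%:R * h ^+ 3.
Proof.
rewrite -(@ler_pM2l _ 2^-1)// mulrC.
by apply: le_trans small'; rewrite ler_wpM2l// ln_nat_ge_half.
Qed.

Lemma dimension_le : (p <= n)%N.
Proof.
rewrite -(ler_nat R) (le_trans p_small)// ler_piMr ?(ltW nR0)//.
by rewrite exprn_ile1// ltW.
Qed.

Lemma bandwidth_ge : h ^- 3 <= n%:R.
Proof.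
rewrite -div1r ler_pdivrMr//; apply: le_trans p_small.
by rewrite ler1n.
Qed.

End bandwidth.

Section vanishing_sequences.
Context (R : realType) (u : nat -> R).
Hypothesis u0 : u @ \oo --> (0 : R).

Lemma near_le_of_cvg0 e : 0 < e -> \forall n \near \oo, u n <= e.
Proof. by move=> e0; exact: (cvgr_le _ u0). Qed.

Lemma near_sqrt_le_of_cvg0 e : 0 < e -> \forall n \near \oo, Num.sqrt (u n) <= e.
Proof.
move=> e0; have := near_le_of_cvg0 (exprn_gt0 2 e0).
by apply: filterS => n un; rewrite -(ger0_norm (ltW e0)) -sqrtr_sqr ler_wsqrtr.
Qed.

End vanishing_sequences.

Lemma near_div_nat_le (R : realType) (A e : R) : 0 <= A -> 0 < e ->
  \forall n \near \oo, A / n%:R <= e.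
Proof.
move=> A0 e0; near=> n.
have n0 : (0 < n)%N by near: n; exact: nbhs_infty_gt.
rewrite ler_pdivrMr ?ltr0n// mulrC -ler_pdivrMr//.
by near: n; exact: nbhs_infty_ger.
Unshelve. all: by end_near. Qed.

Theorem proposition3p2 (R : realType) (alpha : nat) (H : R -> R)
  (* the n-th experiment: dimension, probability space, parameter,
     population variables (X, Z, epsilon) and sample of size n *)
  (p : nat -> nat) (d : nat -> measure_display)
  (T : forall n, measurableType (d n)) (P : forall n, probability (T n) R)
  (beta : forall n, 'cV[R]_(p n))
  (pop : forall n, observation R (T n) (p n))
  (sample : forall n, 'I_n -> observation R (T n) (p n))
  (* density of zeta given Z and law of epsilon given Z *)
  (rho : forall n, (p n).-tuple R -> R -> R)
  (kF : forall n, R.-pker ((p n).-tuple R) ~> R)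
  (* initial estimator, its rate, and the bandwidth *)
  (b0 : forall n, T n -> 'cV[R]_(p n)) (delta h : nat -> R)
  (* model and identifiability *)
  (hiid : forall n, iid_copies (P n) (pop n) (sample n))
  (hident : forall n, identifiable (P n) (beta n) (pop n))
  (* Assumption 1 *)
  (hkernel : kernel_cond alpha H)
  (* Assumption 2 *)
  (hrho : forall n,
     cond_density (P n) (obsZ (pop n)) (zeta (beta n) (pop n)) (rho n))
  (hrho_bound : exists C : R, forall n, {ae P n, forall w,
     (forall t, 0 < rho n (obsZ (pop n) w) t <= C) /\
     bounded_derivs alpha C (rho n (obsZ (pop n) w))})
  (* Assumption 3 *)
  (hindep : forall n,
     cond_indep (P n) (obsZ (pop n)) (obsE (pop n)) (obsX (pop n)))
  (hF : forall n, cond_dist (P n) (obsZ (pop n)) (obsE (pop n)) (kF n))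
  (hF_bound : exists C : R, forall n, {ae P n, forall w,
     bounded_derivs alpha.+1 C (cond_cdf (kF n) (obsZ (pop n) w))})
  (* Assumption 4 *)
  (heig : exists c1 : R, 1 < c1 /\ forall n (a : R),
     (eigenvalue (Vmx (P n) (pop n) (rho n) (kF n)) a -> c1^-1 < a < c1) /\
     (eigenvalue (Vsmx (P n) (pi_V H) (pop n) (rho n)) a -> c1^-1 < a < c1))
  (* Assumption 5 *)
  (hsubgauss : exists eta : R, 0 < eta /\ exists C : R,
     forall n (v : 'cV[R]_(p n)), norm2 v = 1 ->
     (\int[P n]_w (expR (eta * dotv v (zvec (pop n) w) ^+ 2))%:E <= C%:E)%E)
  (* initial estimator: a random vector converging at the rate delta *)
  (hb0_meas : forall n i, measurable_fun [set: T n] (fun w => b0 n w i 0))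
  (hdelta_ge0 : forall n, 0 <= delta n)
  (hdelta : delta @ \oo --> (0 : R))
  (hb0 : bigO_P P (fun n w => norm2 (b0 n w - beta n)) delta)
  (* bandwidth *)
  (hh_gt0 : forall n, 0 < h n)
  (hh : h @ \oo --> (0 : R))
  (hrate : (fun n => (p n)%:R * ln n%:R / (n%:R * h n ^+ 3)) @ \oo --> (0 : R)) :
  bigO_P P
    (fun n w => norm2 (newton_step (beta n) (sample n) H (h n) w (b0 n w)
                       - beta n))
    (fun n => delta n ^+ 2 + h n ^+ alpha
              + Num.sqrt ((p n)%:R / (n%:R * h n))
              + delta n * Num.sqrt ((p n)%:R * ln n%:R / (n%:R * h n ^+ 3))).
Proof.
have alpha2 : (2 <= alpha)%N by case: hkernel.
have [CH CH1 kfH] := kernel_cond_facts hkernel.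
have [Cr Hr] := hrho_bound.
have [CF HF] := hF_bound.
have [eta [eta0 [Cs Hs]]] := hsubgauss.
have [c1 [c11 Hc1]] := heig.
pose C := CH + `|Cr| + `|CF| + `|Cs|.
have [CHC CrC CFC CsC] : [/\ CH <= C, Cr <= C, CF <= C & Cs <= C].
  exact: (le_common_bound Cr CF Cs (le_trans ler01 CH1)).
have C1 : 1 <= C by exact: le_trans CHC.
have Cp : 0 < C by exact: lt_le_trans C1.
have kf := kernel_facts_le CHC kfH.
have RM n : regular_model alpha C eta (P n) (beta n) (pop n) (rho n) (kF n).
  have [med _ _ [fX [dX _]]] := hident n.
  split.
  - exact: med.
  - by exists fX.
  - exact: hrho.
  - apply: filterS (Hr n) => w [r1 r2]; split; last exact: bounded_derivs_le r2.
    by move=> t; have /andP[-> r3] := r1 t; rewrite /= (le_trans r3).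
  - exact: hindep.
  - exact: hF.
  - by apply: filterS (HF n) => w; exact: bounded_derivs_le.
  - by move=> v v1; apply: le_trans (Hs n v v1) _; rewrite lee_fin.
pose c0 := c1^-1.
have c00 : 0 < c0 by rewrite invr_gt0 (lt_trans _ c11).
pose Cm := moment_bound C eta.
have Cmp : 0 < Cm by exact: moment_bound_gt0.
pose KK := 2 * (C * response_density_bound alpha C) * Cm.
have KK0 : 0 <= KK.
  apply: mulr_ge0; last exact: ltW.
  apply: mulr_ge0 => //; apply: mulr_ge0; first exact: ltW.
  exact: response_density_bound_ge0.
pose LL := dev_const C eta + 8 * C.
have LL0 : 0 <= LL by rewrite addr_ge0 ?sqrtr_ge0// mulr_ge0// ltW.
pose x n := (p n)%:R * ln n%:R / (n%:R * h n ^+ 3).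
move=> e e0.
have e20 : 0 < e / 2 by rewrite divr_gt0.
have e40 : 0 < e / 4 by rewrite divr_gt0.
have [M1 [M10 HM1]] := hb0 _ e20.
(* Makes the Chebyshev probability equal to e / 4. The budget is e / 2 for the initial estimator, e
   / 4 here, and e / 4 for the events of probability O(1 / n). *)
pose K := Num.sqrt (2 * C ^+ 3 * Cm / (e / 4)).
have KA : 0 < 2 * C ^+ 3 * Cm by apply: mulr_gt0 => //; apply: mulr_gt0 => //; exact: exprn_gt0.
have K0 : 0 < K by rewrite sqrtr_gt0 divr_gt0.
have KE : 2 * C ^+ 3 * Cm / K ^+ 2 = e / 4.
  rewrite sqr_sqrtr; last by rewrite divr_ge0 ?(ltW KA)// ltW.
  by rewrite invf_div mulrCA divff ?mulr1// gt_eqF.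
pose Kc := 8 / c0 * (KK + LL + K).
have Kc0 : 0 < Kc by rewrite mulr_gt0 ?divr_gt0// ltr_wpDl// addr_ge0.
have M0 : 0 < Kc * (1 + M1) ^+ 2 by apply: mulr_gt0 => //; rewrite exprn_gt0// addr_gt0.
(* [Kc] is the constant of [one_step_bound]; the square accounts for the radius M1 delta in place of
   delta. *)
exists (Kc * (1 + M1) ^+ 2); split => //.
have A10 : 0 <= dev_const C eta * C / (16 * C ^+ 3 * Cm).
  apply: divr_ge0; first by apply: mulr_ge0; [exact: sqrtr_ge0|exact: ltW].
  by apply: mulr_ge0; [apply: mulr_ge0 => //; apply: exprn_ge0|]; exact: ltW.
have [e1 e10 He1] := ex_small_factor A10 (divr_gt0 eta0 (ltr0n R 2)).
(* The allowance c0 / 8 is shared by three vanishing terms: the bandwidth, the radius and the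
   uniform deviation. *)
have c240 : 0 < c0 / 24 by rewrite divr_gt0.
have [e2 e20' He2] := ex_small_factor LL0 c240.
have [e3 e30 He3] := ex_small_factor KK0 c240.
have M1delta : (fun n => M1 * delta n) @ \oo --> (0 : R).
  by rewrite -(mulr0 M1); exact: cvgMr.
near=> n.
have n2 : (2 <= n)%N by near: n; exact: nbhs_infty_ge.
have [B0 [mB0 HB0 PB0]] : exists B : set (T n), [/\ measurable B,
    [set w | M1 * delta n < norm2 (b0 n w - beta n)] `<=` B & (P n B <= (e / 2)%:E)%E].
  by near: n.
have a0 : 0 <= delta n ^+ 2 + h n ^+ alpha + Num.sqrt ((p n)%:R / (n%:R * h n))
    + delta n * Num.sqrt (x n).
  by rewrite !addr_ge0 ?sqr_ge0 ?sqrtr_ge0 ?mulr_ge0 ?sqrtr_ge0// exprn_ge0// ltW.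
(* In dimension 0 every norm is 0 and the empty event will do; the one-step bound is for p > 0. *)
have [pn0|p0] := posnP (p n).
  exists set0; split => //; last by rewrite measure0 lee_fin ltW.
  by move=> w /=; rewrite norm2_dim0// ltNge mulr_ge0// ltW.
have hn1 : h n <= 1 by near: n; exact: near_le_of_cvg0.
have xn : x n <= 2^-1 by near: n; exact: (near_le_of_cvg0 hrate).
have pn := dimension_le n2 (hh_gt0 n) hn1 xn.
have hn3 := bandwidth_ge n2 p0 (hh_gt0 n) xn.
have r0 : 0 <= M1 * delta n by rewrite mulr_ge0// ltW.
have r1 : M1 * delta n <= 1 by near: n; exact: (near_le_of_cvg0 M1delta).
have rate0 : 0 <= rate (p n) n (h n) by exact: sqrtr_ge0.
have small_dev : dev_const C eta * rate (p n) n (h n) * h n * C / (16 * C ^+ 3 * Cm) <= eta / 2.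
  (* As h <= 1, the factor h may be dropped, and the bandwidth condition makes the remaining rate
     vanish. *)
  apply: (@le_trans _ _ (dev_const C eta * C / (16 * C ^+ 3 * Cm) * rate (p n) n (h n))).
    have -> : dev_const C eta * rate (p n) n (h n) * h n * C / (16 * C ^+ 3 * Cm) =
       dev_const C eta * C / (16 * C ^+ 3 * Cm) * (rate (p n) n (h n) * h n) by ring.
    by rewrite ler_wpM2l// ler_piMr.
  by apply: He1 => //; near: n; exact: near_sqrt_le_of_cvg0.
have small_bias : KK * (h n + M1 * delta n) + LL * rate (p n) n (h n) <= c0 / 8.
  have -> : c0 / 8 = c0 / 24 + c0 / 24 + c0 / 24 by field.
  rewrite mulrDr lerD// ?lerD//.
  - by apply: He3; [exact: ltW|near: n; exact: near_le_of_cvg0].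
  - by apply: He3 => //; near: n; exact: near_le_of_cvg0.
  - by apply: He2 => //; near: n; exact: near_sqrt_le_of_cvg0.
have Veig a : eigenvalue (Vmx (P n) (pop n) (rho n) (kF n)) a -> c0 < a.
  by move=> /(Hc1 n a).1 /andP[].
have [B [mB PB HB]] := one_step_bound kf (RM n) C1 eta0 alpha2 (hiid n) n2 pn p0
  (hh_gt0 n) hn1 hn3 c00 Veig r0 r1 K0 small_dev small_bias.
have Pn : (4 + Cm) / n%:R <= e / 4.
  by near: n; apply: near_div_nat_le => //; rewrite addr_ge0// ltW.
exists (B0 `|` B); split.
- exact: measurableU.
- move=> w /=; apply: contraPP => /not_orP[nB0 nB]; apply/negP; rewrite -leNgt.
  have br : norm2 (b0 n w - beta n) <= M1 * delta n.
    by rewrite leNgt; apply/negP => /HB0.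
  apply: (le_trans (HB w nB _ br)).
  rewrite -/(x n) -/KK -/LL -/Kc -[leRHS]mulrA; apply: ler_wpM2l; first exact: ltW.
  by apply: rescaled_rate_le; rewrite ?sqrtr_ge0 ?exprn_ge0 ?(ltW M10) ?(ltW (hh_gt0 n)).
rewrite (le_trans (measureU2 (P n) mB0 mB))//.
have -> : e = e / 2 + (e / 4 + e / 4) by field.
rewrite EFinD; apply: leeD => //; apply: (le_trans PB).
by rewrite lee_fin KE lerD2r.
Unshelve. all: by end_near.
Qed.
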